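(* Let $n=2k$ be a positive even integer, let $\mathcal R$ be the universal $R$-matrix of $U_q[osp(2|n)]$ belonging to $U_q[osp(2|n)]^-\otimes U_q[osp(2|n)]^+$, and let $\pi$ be the vector representation. The $R$-matrix for the vector representation, $\mathfrak R=(\pi\otimes\pi)\mathcal R$, is given by $$\mathfrak R=\sum_{a,b}q^{(\varepsilon_a,\varepsilon_b)}E^a_a\otimes E^b_b+(q-q^{-1})\sum_{\varepsilon_b>\varepsilon_a}(-1)^{[b]}E^a_b\otimes\tilde\sigma_{ba},$$ where $$\tilde\sigma_{ba}=E^b_a-(-1)^{[b]([a]+[b])}\xi_a\xi_bq^{(\rho,\varepsilon_a-\varepsilon_b)}E^{\overline a}_{\overline b},\qquad\varepsilon_b>\varepsilon_a.$$
   Context: **Indices and weights.** $n=2k$. $V$ is a $\mathbb Z_2$-graded vector space of dimension $n+2$ with basis indexed by even indices $i\in\{1,2\}$ ($[i]=0$) and odd indices $\mu\in\{1,\dots,n\}$ ($[\mu]=1$); $a,b$ run over all indices. A symbol such as $(i=1)$ means the even index $1$, and $(\mu=k)$ means the odd index $k$. Put $\overline i=3-i$ for even indices (so $(i=\overline 1)$ is the even index $2$) and $\overline\mu=n+1-\mu$ for odd indices; $\xi_i=1$ for even indices and $\xi_\mu=(-1)^\mu$ for odd indices. The weight of an index $a$ is written generically $\varepsilon_a$: it is $\varepsilon_1$ or $\varepsilon_2=-\varepsilon_1$ for the even indices, and $\delta_\mu$ for the odd index $\mu$, with $\delta_{\overline\mu}=-\delta_\mu$. The bilinear form is $(\varepsilon_1,\varepsilon_1)=1$,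 $(\delta_\mu,\delta_\nu)=-\delta^\mu_\nu$, $(\varepsilon_1,\delta_\mu)=0$ for $1\le\mu,\nu\le k$. Weights are ordered by $\delta_1>\dots>\delta_k>\varepsilon_1>-\varepsilon_1>-\delta_k>\dots>-\delta_1$; equivalently, $\varepsilon_b>\varepsilon_a$ iff $\varepsilon_b-\varepsilon_a$ is a positive root of $osp(2|n)$ or equals $2\varepsilon_1$. Simple roots: $\alpha_\mu=\delta_\mu-\delta_{\mu+1}$ ($1\le\mu<k$, even), $\alpha_s=\delta_k-\varepsilon_1$ and $\alpha_t=\delta_k+\varepsilon_1$ (both odd). The graded half-sum of positive roots is $\rho=\sum_{\mu=1}^k(k-\mu)\delta_\mu$. For a generator label $c$, $[c]$ is the parity of $\alpha_c$. **The quantum superalgebra.** $q$ is real, with $q$ and $q^{1/2}$ such that all formulas make sense ($q>0$, $q\ne1$). $[A,B]=AB-(-1)^{[A][B]}BA$ and $(A\otimes B)(C\otimes D)=(-1)^{[B][C]}AC\otimes BD$. $U_q[osp(2|n)]$ is generated by $e_c,f_c,h_c$ (and $q^{\pm h_c/2}$), $c\in\{1,\dots,k-1,s,t\}$, where $e_c,f_c$ have parity $[c]$ and $h_c$ is even, subject to $[h_a,e_b]=(\alpha_a,\alpha_b)e_b$, $[h_a,f_b]=-(\alpha_a,\alpha_b)f_b$, $[h_a,h_b]=0$, $[e_a,f_b]=\delta^a_b\frac{q^{h_a}-q^{-h_a}}{q-q^{-1}}$, $[e_a,e_a]=[f_a,f_a]=0$ if $(\alpha_a,\alpha_a)=0$,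 and, for $b\ne c$ with $(\alpha_b,\alpha_b)\ne0$, $(\mathrm{ad}\,e_b\circ)^{1-a_{bc}}e_c=0$ and $(\mathrm{ad}\,f_b\circ)^{1-a_{bc}}f_c=0$, where $a_{bc}=2(\alpha_b,\alpha_c)/(\alpha_b,\alpha_b)$, together with Yamane's extra $q$-Serre relations. For raising generators these are, with $E_c=e_cq^{h_c/2}$ and $[x,y]_q=\mathrm{ad}\,x\circ y$ (which for $x=E_c$ and $y$ of weight $\beta$ equals $E_cy-(-1)^{[c][y]}q^{(\alpha_c,\beta)}yE_c$), when $k\ge2$: $[E_{k-1},[E_s,E_t]_q]_q=(q+q^{-1})[E_s,[E_{k-1},E_t]_q]_q$, $[E_{k-1},[E_t,E_s]_q]_q=(q+q^{-1})[E_t,[E_{k-1},E_s]_q]_q$, $[E_s,[E_t,E_{k-1}]_q]_q=[E_t,[E_s,E_{k-1}]_q]_q$; those for lowering generators are the images of these under the graded conjugation $\dagger$ given by $e_a^\dagger=f_a$, $f_a^\dagger=(-1)^{[a]}e_a$, $h_a^\dagger=h_a$, $(AB)^\dagger=(-1)^{[A][B]}B^\dagger A^\dagger$. The coproduct is the algebra homomorphism with $\Delta(e_a)=q^{h_a/2}\otimes e_a+e_a\otimes q^{-h_a/2}$, $\Delta(f_a)=q^{h_a/2}\otimes f_a+f_a\otimes q^{-h_a/2}$, $\Delta(q^{\pm h_a/2})=q^{\pm h_a/2}\otimes q^{\pm h_a/2}$; the antipode is the graded antihomomorphism with $S(e_a)=-q^{-(\alpha_a,\alpha_a)/2}e_a$,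 $S(f_a)=-q^{(\alpha_a,\alpha_a)/2}f_a$, $S(q^{\pm h_a})=q^{\mp h_a}$; the adjoint action is $\mathrm{ad}\,a\circ b=\sum_{(a)}(-1)^{[b][a^{(2)}]}a^{(1)}bS(a^{(2)})$, where $\Delta(a)=\sum a^{(1)}\otimes a^{(2)}$. $T(A\otimes B)=(-1)^{[A][B]}B\otimes A$ and $\Delta^T=T\circ\Delta$. $U_q[osp(2|n)]^+$ (resp. $U_q[osp(2|n)]^-$) is the Hopf subsuperalgebra generated by the raising generators $e_c$ (resp. lowering generators $f_c$) and the Cartan elements. **Universal $R$-matrix.** A universal $R$-matrix is an even, invertible element $\mathcal R$ of $U_q[osp(2|n)]^{\otimes2}$ (understood in the usual completed sense) with $\mathcal R\Delta(a)=\Delta^T(a)\mathcal R$ for all $a\in U_q[osp(2|n)]$, $(\mathrm{id}\otimes\Delta)\mathcal R=\mathcal R_{13}\mathcal R_{12}$ and $(\Delta\otimes\mathrm{id})\mathcal R=\mathcal R_{13}\mathcal R_{23}$. It is known that there is a unique one belonging to $U_q[osp(2|n)]^-\otimes U_q[osp(2|n)]^+$ (from the $\mathbb Z_2$-graded Drinfeld double construction). **Vector representation.** $E^a_b$ is the elementary matrix with $1$ in position $(a,b)$ and $0$ elsewhere, of parity $[a]+[b]$. $\pi:U_q[osp(2|n)]\to\mathrm{End}\,V$ is given by $\pi(e_\mu)=E^\mu_{\mu+1}+E^{\overline{\mu+1}}_{\overline\mu}$, $\pi(f_\mu)=E^{\mu+1}_\mu+E^{\overline\mu}_{\overline{\mu+1}}$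 ($1\le\mu<k$); $\pi(e_s)=E^{\mu=k}_{i=1}+(-1)^kE^{i=\overline1}_{\overline\mu=\overline k}$, $\pi(f_s)=-E^{i=1}_{\mu=k}+(-1)^kE^{\overline\mu=\overline k}_{i=\overline1}$; $\pi(e_t)=E^{\mu=k}_{i=\overline1}+(-1)^kE^{i=1}_{\overline\mu=\overline k}$, $\pi(f_t)=-E^{i=\overline1}_{\mu=k}+(-1)^kE^{\overline\mu=\overline k}_{i=1}$; and $\pi(h_c)=\sum_a(\alpha_c,\varepsilon_a)E^a_a$.
   Formalization: The sign of π(f_μ), 1≤μ<k, is reversed, since as printed π violates the relation for [e_μ,f_μ]; and the q-Serre relations are imposed with e_c q^{h_c/2}, f_c q^{h_c/2} in place of e_c, f_c, since the printed ones are incompatible with the coproduct. Nothing changes for k=1. *)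

(* Defs.v *)
From HB Require Import structures.
From mathcomp Require Import all_boot all_order all_algebra.
From mathcomp Require Import boolp classical_sets filter reals exp.
From mathcomp Require Import finmap.
From mathcomp.multinomials Require Import monalg.
From mathcomp Require Import mxtens.

Set Implicit Arguments.
Unset Strict Implicit.
Unset Printing Implicit Defensive.
Import Order.TTheory GRing.Theory Num.Theory.
Local Open Scope classical_set_scope.
Local Open Scope ring_scope.

(* Simple root labels: [Lmu c] is the label c + 1 in {1, ..., k - 1}. *)
Inductive label (k : nat) := Lmu of 'I_k.-1 | Ls | Lt.
Arguments Lmu {k}.
Arguments Ls {k}.
Arguments Lt {k}.

Definition label_enc k (c : label k) : 'I_k.-1 + bool :=
  match c with Lmu c => inl c | Ls => inr false | Lt => inr true end.
Definition label_dec k (x : 'I_k.-1 + bool) : label k :=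
  match x with inl c => Lmu c | inr false => Ls | inr true => Lt end.
Lemma label_encK k : cancel (@label_enc k) (@label_dec k).
Proof. by case. Qed.
HB.instance Definition _ k := Choice.copy (label k) (can_type (@label_encK k)).

(* e_c, f_c, h_c, q^(h_c/2), q^(-h_c/2) *)
Inductive gen (k : nat) :=
  GE of label k | GF of label k | GH of label k | GK of label k | GKv of label k.
Arguments GE {k}.
Arguments GF {k}.
Arguments GH {k}.
Arguments GK {k}.
Arguments GKv {k}.

Definition gen_enc k (x : gen k) : 'I_5 * label k :=
  match x with
  | GE c => (inord 0, c) | GF c => (inord 1, c) | GH c => (inord 2, c)
  | GK c => (inord 3, c) | GKv c => (inord 4, c)
  end.
Definition gen_dec k (x : 'I_5 * label k) : gen k :=
  match val x.1 with
  | 0 => GE x.2 | 1 => GF x.2 | 2 => GH x.2 | 3 => GK x.2 | _ => GKv x.2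
  end%N.
Lemma gen_encK k : cancel (@gen_enc k) (@gen_dec k).
Proof. by case=> c; rewrite /gen_dec /= inordK. Qed.
HB.instance Definition _ k := Choice.copy (gen k) (can_type (@gen_encK k)).

Definition lodd k (c : label k) : bool :=
  match c with Lmu _ => false | _ => true end.
Definition godd k (x : gen k) : bool :=
  match x with GE c | GF c => lodd c | _ => false end.

Section Osp.
(* The base field is any field containing the reals, e.g. R or R[i]. *)
Variables (R : realType) (F : fieldType) (iota : {rmorphism R -> F}).
Variables (k : nat) (q : R).

Definition qpow (x : R) : F := iota (q `^ x).

Definition sgn (b : bool) : F := (-1) ^+ b.

(* Real weights: coordinate 0 is along epsilon_1, coordinate j is along
   delta_j for 1 <= j <= k. *)
Definition weight := 'rV[R]_k.+1.
Definition coordw (j : nat) : weight := \row_i (i == j :> nat)%:R.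
Definition bform (x y : weight) : R :=
  x 0 ord0 * y 0 ord0 - \sum_(i < k.+1 | i != ord0) x 0 i * y 0 i.

Definition rho : weight := \sum_(1 <= mu < k.+1) (k - mu)%:R *: coordw mu.

Definition alpha (c : label k) : weight :=
  match c with
  | Lmu c => coordw c.+1 - coordw c.+2
  | Ls => coordw k - coordw 0
  | Lt => coordw k + coordw 0
  end.

(* Basis of V: positions 0 and 1 are the even indices i = 1, 2, and position
   mu + 1 is the odd index mu, for 1 <= mu <= n = 2k. *)
Definition idx := 'I_(2 * k).+2.
Definition evx (i : nat) : idx := inord i.-1.
Definition odx (mu : nat) : idx := inord mu.+1.

Definition iodd (a : idx) : bool := (1 < a)%N.
Definition bar (a : idx) : idx :=
  if iodd a then odx ((2 * k).+1 - a.-1) else inord (1 - a).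
Definition xi (a : idx) : F := if iodd a then (-1) ^+ a.-1 else 1.
Definition wgt (a : idx) : weight :=
  if iodd a then
    if (a.-1 <= k)%N then coordw a.-1 else - coordw ((2 * k).+1 - a.-1)
  else if (a == 0 :> nat)%N then coordw 0 else - coordw 0.

(* [gtw b a] is eps_b > eps_a; [wrank] lists the weights in decreasing order
   delta_1, ..., delta_k, eps_1, -eps_1, -delta_k, ..., -delta_1. *)
Definition wrank (a : idx) : nat :=
  if iodd a then if (a.-1 <= k)%N then a.-2 else a else (k + a)%N.
Definition gtw (b a : idx) : bool := (wrank b < wrank a)%N.

(* A presentation of the graded tensor power U^(x)N : one copy of the
   generators for each of the N slots, with A (x) B (x) ... written as the
   product A_1 B_2 ..., and generators of distinct slots supercommuting.
   [Utens N] is the free algebra on these generators; the tensor power itself is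
   its quotient by the two-sided ideal [relI] below, and elements of [Utens N]
   are only ever compared modulo left ideals containing [relI]. *)
Definition Utens (N : nat) : lalgType F :=
  {malg F[{fmonom ('I_N * gen k)%type}]}.

Definition gvar N (i : 'I_N) (x : gen k) : Utens N :=
  << fmu (i, x) >>.

Definition linext N (W : lmodType F) (w : seq ('I_N * gen k) -> W)
    (x : Utens N) : W :=
  \sum_(m <- msupp x) x@_m *: w m.

Definition freehom N M (phi : 'I_N * gen k -> Utens M) : Utens N -> Utens M :=
  linext (fun m => \prod_(g <- m) phi g).

(* The graded conjugation, slot by slot: e' = f, f' = (-1)^[f] e, h' = h and
   (AB)' = (-1)^([A][B]) B' A'. *)
Definition dag_gen N (g : 'I_N * gen k) : Utens N :=
  match g.2 with
  | GE c => gvar g.1 (GF c)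
  | GF c => sgn (lodd c) *: gvar g.1 (GE c)
  | x => gvar g.1 x
  end.
Fixpoint dag_word N (m : seq ('I_N * gen k)) : Utens N :=
  if m is g :: m' then
    sgn (godd g.2 && odd (count (fun g' => godd g'.2) m'))
      *: (dag_word m' * dag_gen g)
  else 1.
Definition dag N : Utens N -> Utens N := linext (@dag_word N).

Definition scomm N (px py : bool) (x y : Utens N) : Utens N :=
  x * y - sgn (px && py) *: (y * x).

Section Relations.
Variables (N : nat) (i : 'I_N).
Local Notation e c := (gvar i (GE c)).
Local Notation f c := (gvar i (GF c)).
Local Notation h c := (gvar i (GH c)).
Local Notation K c := (gvar i (GK c)).
Local Notation Kv c := (gvar i (GKv c)).

(* ad a o y = sum (-1)^([y][a2]) a1 y S(a2), for y of parity p, where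
   S(q^(-h/2)) = q^(h/2) and S(e) = - q^(-(alpha,alpha)/2) e,
   S(f) = - q^((alpha,alpha)/2) f. *)
Definition ad_e (c : label k) (p : bool) (y : Utens N) : Utens N :=
  e c * y * K c
  - (sgn (lodd c && p) * qpow (- (bform (alpha c) (alpha c) / 2)))
      *: (K c * y * e c).
Definition ad_f (c : label k) (p : bool) (y : Utens N) : Utens N :=
  f c * y * K c
  - (sgn (lodd c && p) * qpow (bform (alpha c) (alpha c) / 2))
      *: (K c * y * f c).

Definition Ec (c : label k) : Utens N := e c * K c.
Definition Fc (c : label k) : Utens N := f c * K c.

(* [E_c, y]_q = ad E_c o y = ad e_c o (ad q^(h_c/2) o y), y of parity p *)
Definition qbr (c : label k) (p : bool) (y : Utens N) : Utens N :=
  ad_e c p (K c * y * Kv c).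

(* Yamane's relations for the raising generators, written as elements that
   vanish; [u] is the label k - 1. *)
Definition yamane1 (u : 'I_k.-1) : Utens N :=
  let u := Lmu u in
  qbr u false (qbr Ls true (Ec Lt))
  - (iota q + (iota q)^-1) *: qbr Ls true (qbr u true (Ec Lt)).
Definition yamane2 (u : 'I_k.-1) : Utens N :=
  let u := Lmu u in
  qbr u false (qbr Lt true (Ec Ls))
  - (iota q + (iota q)^-1) *: qbr Lt true (qbr u true (Ec Ls)).
Definition yamane3 (u : 'I_k.-1) : Utens N :=
  let u := Lmu u in
  qbr Ls true (qbr Lt false (Ec u)) - qbr Lt true (qbr Ls false (Ec u)).

(* In the q-Serre relations the argument is E_c = e_c q^(h_c/2), resp.
   F_c = f_c q^(h_c/2) : with the present coproduct the relations with the bare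
   e_c, f_c would not span a Hopf ideal.  A label b with (alpha_b, alpha_b) <> 0
   is even, so that all iterates have the parity of c. *)
Inductive slot_rel : Utens N -> Prop :=
| rel_KKv a : slot_rel (K a * Kv a - 1)
| rel_KvK a : slot_rel (Kv a * K a - 1)
| rel_KK a b : slot_rel (K a * K b - K b * K a)
| rel_hK a b : slot_rel (h a * K b - K b * h a)
| rel_hh a b : slot_rel (h a * h b - h b * h a)
| rel_he a b :
    slot_rel (h a * e b - e b * h a - iota (bform (alpha a) (alpha b)) *: e b)
| rel_hf a b :
    slot_rel (h a * f b - f b * h a + iota (bform (alpha a) (alpha b)) *: f b)
| rel_Ke a b :
    slot_rel (K a * e b - qpow (bform (alpha a) (alpha b) / 2) *: (e b * K a))
| rel_Kf a b :
    slot_rel (K a * f b - qpow (- (bform (alpha a) (alpha b) / 2)) *: (f b * K a))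
| rel_ef a b :
    slot_rel (scomm (lodd a) (lodd b) (e a) (f b)
      - ((a == b)%:R / (iota q - (iota q)^-1)) *: (K a ^+ 2 - Kv a ^+ 2))
| rel_ee a : bform (alpha a) (alpha a) = 0 ->
    slot_rel (scomm (lodd a) (lodd a) (e a) (e a))
| rel_ff a : bform (alpha a) (alpha a) = 0 ->
    slot_rel (scomm (lodd a) (lodd a) (f a) (f a))
| rel_serre_e b c (m : nat) : b <> c -> bform (alpha b) (alpha b) != 0 ->
    m%:R = 1 - 2 * bform (alpha b) (alpha c) / bform (alpha b) (alpha b) ->
    slot_rel (iter m (ad_e b (lodd c)) (Ec c))
| rel_serre_f b c (m : nat) : b <> c -> bform (alpha b) (alpha b) != 0 ->
    m%:R = 1 - 2 * bform (alpha b) (alpha c) / bform (alpha b) (alpha b) ->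
    slot_rel (iter m (ad_f b (lodd c)) (Fc c))
| rel_yamane1 (u : 'I_k.-1) : (u.+2 = k)%N -> slot_rel (yamane1 u)
| rel_yamane2 (u : 'I_k.-1) : (u.+2 = k)%N -> slot_rel (yamane2 u)
| rel_yamane3 (u : 'I_k.-1) : (u.+2 = k)%N -> slot_rel (yamane3 u)
| rel_yamane1d (u : 'I_k.-1) : (u.+2 = k)%N -> slot_rel (dag (yamane1 u))
| rel_yamane2d (u : 'I_k.-1) : (u.+2 = k)%N -> slot_rel (dag (yamane2 u))
| rel_yamane3d (u : 'I_k.-1) : (u.+2 = k)%N -> slot_rel (dag (yamane3 u)).
End Relations.

Definition left_ideal (A : lalgType F) (I : set A) : Prop :=
  [/\ I 0, forall x y, I x -> I y -> I (x + y) & forall a x, I x -> I (a * x)].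
Definition twosided_ideal (A : lalgType F) (I : set A) : Prop :=
  left_ideal I /\ forall a x, I x -> I (x * a).
Definition subalg (A : lalgType F) (B : set A) : Prop :=
  [/\ B 1, forall x y, B x -> B y -> B (x + y),
      forall x y, B x -> B y -> B (x * y) & forall (c : F) x, B x -> B (c *: x)].

Definition cross_rel N : set (Utens N) :=
  [set z | exists i j x y, i != j /\
    z = scomm (godd x) (godd y) (gvar i x) (gvar j y)].
Definition relI N : set (Utens N) :=
  smallest (@twosided_ideal (Utens N))
    ([set z | exists i, slot_rel i z] `|` @cross_rel N).

(* Completion of U^(x)N : a basis of neighbourhoods of 0 is given by the finite
   intersections of the left ideals [nbI lam M], where lam assigns a real weight
   to each slot and U^(x)N / nbI lam M is the universal module generated by a
   vector of weight lam (on which q^(h/2) acts as the exponential of h) killed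
   by all products of M raising generators of one slot.
   Multiplication and coproduct extend to these completions, in which the
   infinite sum over U^- (x) U^+ and the Cartan factor (lam, mu) |-> q^(lam, mu)
   of the universal R-matrix converge. *)
Definition wt_rel N (lam : 'I_N -> weight) : set (Utens N) :=
  [set z | exists i c,
    z = gvar i (GH c) - (iota (bform (lam i) (alpha c)))%:A \/
    z = gvar i (GK c) - (qpow (bform (lam i) (alpha c) / 2))%:A].
Definition nil_rel N (M : nat) : set (Utens N) :=
  [set z | exists i (s : seq (label k)), size s = M /\
    z = \prod_(c <- s) gvar i (GE c)].
Definition nbI N (lam : 'I_N -> weight) (M : nat) : set (Utens N) :=
  smallest (@left_ideal (Utens N)) (@relI N `|` wt_rel lam `|` @nil_rel N M).

(* An element of the completed tensor square is represented by a Cauchy filter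
   on [Utens 2]; an identity phi = 0 in a completed tensor power holds at it when
   phi tends to 0 along the filter. *)
Definition cauchy_at N (RR : set_system (Utens N)) : Prop :=
  forall lam M, exists2 S, RR S & forall x y, S x -> S y -> nbI lam M (x - y).
Definition tends0 N (RR : set_system (Utens 2)) (phi : Utens 2 -> Utens N) : Prop :=
  forall lam M, \forall r \near RR, nbI lam M (phi r).

Definition sl N (j : nat) : 'I_N.+1 := inord j.
Arguments sl {N}.

(* The coproduct of a generator, placed in the slots i, j. *)
Definition cop N (i j : 'I_N) (x : gen k) : Utens N :=
  match x with
  | GE c => gvar i (GK c) * gvar j (GE c) + gvar i (GE c) * gvar j (GKv c)
  | GF c => gvar i (GK c) * gvar j (GF c) + gvar i (GF c) * gvar j (GKv c)
  | GH c => gvar i (GH c) + gvar j (GH c)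
  | GK c => gvar i (GK c) * gvar j (GK c)
  | GKv c => gvar i (GKv c) * gvar j (GKv c)
  end.

Definition Delta : Utens 1 -> Utens 2 := freehom (fun g => cop (sl 0) (sl 1) g.2).
(* T(A (x) B) = (-1)^([A][B]) B (x) A exchanges the two slots. *)
Definition twist : Utens 2 -> Utens 2 := freehom (fun g => gvar (rev_ord g.1) g.2).
Definition DeltaT (a : Utens 1) : Utens 2 := twist (Delta a).
Definition Delta_id : Utens 2 -> Utens 3 :=
  freehom (fun g => if g.1 == ord0 then cop (sl 0) (sl 1) g.2 else gvar (sl 2) g.2).
Definition id_Delta : Utens 2 -> Utens 3 :=
  freehom (fun g => if g.1 == ord0 then gvar (sl 0) g.2 else cop (sl 1) (sl 2) g.2).
(* R_(ij) *)
Definition placeR (i j : nat) : Utens 2 -> Utens 3 :=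
  freehom (fun g => gvar (if g.1 == ord0 then sl i.-1 else sl j.-1) g.2).

Definition parity_aut : Utens 2 -> Utens 2 :=
  freehom (fun g => sgn (godd g.2) *: gvar g.1 g.2).

(* U^- (x) U^+ inside U (x) U; the subalgebras generated by the f_c (resp. e_c)
   and the Cartan elements are stable under coproduct and antipode. *)
Definition minus_gen (x : gen k) : bool := if x is GE _ then false else true.
Definition plus_gen (x : gen k) : bool := if x is GF _ then false else true.
Definition UmUp : set (Utens 2) :=
  smallest (@subalg (Utens 2))
    [set z | exists x, minus_gen x /\ z = gvar (sl 0) x \/
                       plus_gen x /\ z = gvar (sl 1) x].

Record universal_R (RR : set_system (Utens 2)) : Prop := {
  uR_filter : ProperFilter RR;
  uR_cauchy : cauchy_at RR;
  uR_UmUp : RR UmUp;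
  uR_even : tends0 RR (fun r => parity_aut r - r);
  uR_inv : exists SS : set_system (Utens 2),
    [/\ ProperFilter SS, cauchy_at SS &
      forall lam M, \forall r \near RR & s \near SS,
        nbI lam M (r * s - 1) /\ nbI lam M (s * r - 1)];
  uR_Delta : forall a : Utens 1, tends0 RR (fun r => r * Delta a - DeltaT a * r);
  uR_id_Delta : tends0 RR (fun r => id_Delta r - placeR 1 3 r * placeR 1 2 r);
  uR_Delta_id : tends0 RR (fun r => Delta_id r - placeR 1 3 r * placeR 2 3 r)
}.

Definition El (a b : idx) : 'M[F]_((2 * k).+2) := delta_mx a b.

(* The vector representation.  The overall sign of pi(f_mu), 1 <= mu < k, is
   forced by the relation for [e_mu, f_mu], since h_mu acts on v_mu as
   (alpha_mu, delta_mu) = -1. *)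
Definition pirep (x : gen k) : 'M[F]_((2 * k).+2) :=
  match x with
  | GE (Lmu c) => let mu := c.+1 in
      El (odx mu) (odx mu.+1) + El (bar (odx mu.+1)) (bar (odx mu))
  | GF (Lmu c) => let mu := c.+1 in
      - (El (odx mu.+1) (odx mu) + El (bar (odx mu)) (bar (odx mu.+1)))
  | GE Ls => El (odx k) (evx 1) + (-1) ^+ k *: El (bar (evx 1)) (bar (odx k))
  | GF Ls => - El (evx 1) (odx k) + (-1) ^+ k *: El (bar (odx k)) (bar (evx 1))
  | GE Lt => El (odx k) (bar (evx 1)) + (-1) ^+ k *: El (evx 1) (bar (odx k))
  | GF Lt => - El (bar (evx 1)) (odx k) + (-1) ^+ k *: El (bar (odx k)) (evx 1)
  | GH c => \sum_a iota (bform (alpha c) (wgt a)) *: El a a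
  | GK c => \sum_a qpow (bform (alpha c) (wgt a) / 2) *: El a a
  | GKv c => \sum_a qpow (- (bform (alpha c) (wgt a) / 2)) *: El a a
  end.

(* A (x) B in End V (x) End V, realized as the operator
   (A (x) B)(v (x) w) = (-1)^([B][v]) A v (x) B w on V (x) V. *)
Definition gtens (A B : 'M[F]_((2 * k).+2)) :
    'M[F]_((2 * k).+2 * (2 * k).+2) :=
  \matrix_(x, y)
    let: (a, c) := mxtens_unindex x in let: (b, d) := mxtens_unindex y in
    sgn (iodd b && (iodd c (+) iodd d)) * (A a b * B c d).

Definition pipi : Utens 2 -> 'M[F]_((2 * k).+2 * (2 * k).+2) :=
  linext (fun m => \prod_(g <- m)
    (if g.1 == ord0 then gtens (pirep g.2) 1%:M else gtens 1%:M (pirep g.2))).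

(* [X] is the value at the completed element [RR] of the continuous extension
   of pi (x) pi (with values in a discrete space). *)
Definition pipi_value (RR : set_system (Utens 2))
    (X : 'M[F]_((2 * k).+2 * (2 * k).+2)) : Prop :=
  \forall r \near RR, pipi r = X.

Definition sigmat (b a : idx) : 'M[F]_((2 * k).+2) :=
  El b a - (sgn (iodd b && (iodd a (+) iodd b)) * xi a * xi b
            * qpow (bform rho (wgt a - wgt b))) *: El (bar a) (bar b).

End Osp.

(* Main.v *)
(** The matrix [(pi (x) pi) R] intertwines the two coproducts of the raising
    generators, so it is determined by its values on the vectors
    [v_low (x) v_b], with [v_low] the lowest weight vector.  As [R] lies in
    [U^- (x) U^+] and preserves weights, it acts there by a scalar
    [L (wgt low) (wgt b)], where [L l m] is the value of its Cartan part at the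
    weights [l], [m].

    To compute [L], let [R] act on Verma modules with arbitrary real highest
    weights.  The two coproduct axioms make [L] bimultiplicative, and the
    intertwining property on [f_c v] gives
    [L l m = q^(m, alpha_c) * L (l - alpha_c) m] when [(l, alpha_c) <> 0].
    Hence [L (wgt a) m = chi * q^(wgt a, m)] with [chi^2 = 1] independent of
    [a]; taking [m = wgt b / 2] and squaring, [L (wgt a) (wgt b) = q^(wgt a, wgt b)].
    It then remains to check that the claimed matrix is an intertwiner.

    That the Serre and Yamane elements act as zero on [V (x) V], and into the
    radical of a Verma module, follows from one computation: up to sign they
    commute with the generators of opposite type, so they vanish as soon as
    they kill a generating vector. *)
Require Import Defs.
From HB Require Import structures.
From mathcomp Require Import all_boot all_order all_algebra.
From mathcomp Require Import boolp classical_sets functions filter reals exp.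
From mathcomp Require Import finmap.
From mathcomp.multinomials Require Import monalg.
From mathcomp Require Import mxtens ring lra zify.

Set Implicit Arguments.
Unset Strict Implicit.
Unset Printing Implicit Defensive.
Import Order.TTheory GRing.Theory Num.Theory.
Local Open Scope classical_set_scope.
Local Open Scope ring_scope.

Local Arguments sl {N}.

(** * Actions of the free algebra *)

(** The element R is given only as a Cauchy filter, without a product formula, so each axiom has to
    be tested on vectors: in a module where the relations hold, a vector of weight [lam] killed by
    all products of [M] raising generators of one slot turns membership in [nbI lam M] into an
    equation. Such equations hold for r eventually along the filter, and finitely many of them can
    be combined. At m = wgt b the relations between the values of L determine them only up to a
    sign. Half of a weight of V is not a weight of V, whence the modules with arbitrary real highest
    weight. They are built on all words in the f_c, so that no basis theorem is needed; the price is
    that the lowering Serre elements act there by nonzero operators. Their images lie in a stable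
    subspace that the coordinate at the top vector does not see. The same argument needs L to be
    nonzero; this is where the invertibility of R is used. *)

Lemma malg_scalerAr (F : fieldType) (K : monomType) (a : F) (x y : {malg F[K]}) :
  x * (a *: y) = a *: (x * y).
Proof.
apply/malgP => m; rewrite mcoeffZ (mcoeffMlw m (fsubset_refl _) (msuppZ_le a y)).
rewrite mcoeffMl mulr_sumr; apply: eq_bigr => m1 _; rewrite mulr_sumr.
by apply: eq_bigr => m2 _; rewrite mcoeffZ mulrCA mulrnAr.
Qed.

Lemma malgUZ (F : fieldType) (K : monomType) (a : F) (m : K) :
  << a *g m >> = a *: << m >>.
Proof. by apply/malgP => m'; rewrite mcoeffZ !mcoeffU mulr_natr. Qed.

Section Linext.
Variables (F : fieldType) (k N : nat) (W : lmodType F).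
Implicit Types (w : seq ('I_N * gen k) -> W) (x y : Utens F k N).

Lemma linextEw w (d : {fset {fmonom ('I_N * gen k)%type}}) x :
  (msupp x `<=` d)%fset -> linext w x = \sum_(m <- d) x@_m *: w m.
Proof.
move=> le; rewrite /linext; apply: big_fset_incl => // m _ /mcoeff_outdom ->.
by rewrite scale0r.
Qed.

Lemma linext_is_linear w : linear (linext w).
Proof.
move=> a x y; pose d := (msupp (a *: x + y) `|` (msupp x `|` msupp y))%fset.
have sx : (msupp x `<=` d)%fset by rewrite /d fsetUCA fsubsetUl.
have sy : (msupp y `<=` d)%fset by rewrite /d fsetUA fsubsetUr.
rewrite (linextEw _ sx) (linextEw _ sy) (@linextEw w d) ?fsubsetUl //.
rewrite scaler_sumr -big_split; apply: eq_bigr => m _ /=.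
by rewrite mcoeffD mcoeffZ scalerDl scalerA.
Qed.

HB.instance Definition _ w :=
  GRing.isLinear.Build F (Utens F k N) W _ (linext w) (linext_is_linear w).

End Linext.

Section Monomials.
Variables (F : fieldType) (k N : nat).
Implicit Types (x y : Utens F k N) (m : seq ('I_N * gen k)).

Definition mon m : Utens F k N := << FMonom m >>.

Lemma linext_mon (W : lmodType F) (w : seq ('I_N * gen k) -> W) m :
  linext w (mon m) = w m.
Proof. by rewrite /linext msuppU1 big_seq_fset1 mcoeffUU scale1r. Qed.

Lemma Utens_scalerAr a x y : x * (a *: y) = a *: (x * y).
Proof. exact: malg_scalerAr. Qed.

Lemma monM m m' : mon m * mon m' = mon (m ++ m').
Proof.
rewrite /mon malgME !msuppU1 !big_seq_fset1 !mcoeffUU mulr1.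
by congr << _ >>; apply/eqP; rewrite fmP fmM.
Qed.

Lemma mon_nil : mon [::] = 1.
Proof. by congr << _ >>; apply/eqP; rewrite fmP fm1. Qed.

Lemma gvar_mon (i : 'I_N) (c : gen k) : gvar F i c = mon [:: (i, c)].
Proof. by congr << _ >>; apply/eqP; rewrite fmP fmU. Qed.

Lemma mon_sum x : x = \sum_(m <- msupp x) x@_m *: mon m.
Proof.
rewrite [LHS]monalgE; apply: eq_bigr => m _; rewrite /mon fmK.
exact: malgUZ.
Qed.

Lemma linear_mon (W : lmodType F) (f : Utens F k N -> W) x : linear f ->
  f x = \sum_(m <- msupp x) x@_m *: f (mon m).
Proof.
move=> lf.
pose fl : {linear Utens F k N -> W} :=
  HB.pack f (GRing.isLinear.Build F (Utens F k N) W _ f lf).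
rewrite -[f]/(fl : _ -> _) [in LHS](mon_sum x) linear_sum.
by apply: eq_bigr => m _; rewrite linearZ.
Qed.

Lemma eq_linear (W : lmodType F) (f g : Utens F k N -> W) : linear f -> linear g ->
  (forall m, f (mon m) = g (mon m)) -> f =1 g.
Proof.
move=> lf lg fg x; rewrite (linear_mon x lf) (linear_mon x lg).
by apply: eq_bigr => m _; rewrite fg.
Qed.

Lemma linear_mulrl y : linear (fun x => x * y).
Proof. by move=> c u v; rewrite mulrDl -scalerAl. Qed.
Lemma linear_mulrr x : linear (fun y => x * y).
Proof. by move=> c u v; rewrite mulrDr Utens_scalerAr. Qed.

End Monomials.

Section Act.
Variables (F : fieldType) (k N : nat) (W : lmodType F).
Implicit Types (rho : 'I_N * gen k -> {linear W -> W}) (x y : Utens F k N).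

(** A module over the free algebra is an arbitrary family [rho] of operators. The relations come in
    later, as the statement that [relI] acts by zero or into a stable subspace. *)
Definition act rho x (w : W) : W := linext (fun m => foldr (fun g => rho g) w m) x.

Lemma act_is_linear rho x : linear (act rho x).
Proof.
move=> a u v; rewrite /act /linext scaler_sumr -big_split; apply: eq_bigr => m _ /=.
rewrite scalerA mulrC -scalerA -scalerDr; congr (_ *: _).
by elim: (m : seq _) => //= g s ->; rewrite linearP.
Qed.
HB.instance Definition _ rho x :=
  GRing.isLinear.Build F W W _ (act rho x) (act_is_linear rho x).

Lemma act_mon rho m w : act rho (mon F m) w = foldr (fun g => rho g) w m.
Proof. by rewrite /act linext_mon. Qed.

Lemma act_gvar rho (i : 'I_N) (c : gen k) w : act rho (gvar F i c) w = rho (i, c) w.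
Proof. by rewrite gvar_mon act_mon. Qed.

Lemma act1 rho w : act rho 1 w = w.
Proof. by rewrite -mon_nil act_mon. Qed.

Lemma act0 rho w : act rho 0 w = 0. Proof. by rewrite /act raddf0. Qed.
Lemma actD rho x y w : act rho (x + y) w = act rho x w + act rho y w.
Proof. by rewrite /act raddfD. Qed.
Lemma actN rho x w : act rho (- x) w = - act rho x w.
Proof. by rewrite /act raddfN. Qed.
Lemma actB rho x y w : act rho (x - y) w = act rho x w - act rho y w.
Proof. by rewrite actD actN. Qed.
Lemma actZ rho a x w : act rho (a *: x) w = a *: act rho x w.
Proof. by rewrite /act linearZ. Qed.

Lemma actP rho a x y w : act rho (a *: x + y) w = a *: act rho x w + act rho y w.
Proof. by rewrite actD actZ. Qed.

Lemma actM rho x y w : act rho (x * y) w = act rho x (act rho y w).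
Proof.
apply: (eq_linear (f := fun x => act rho (x * y) w)
                  (g := fun x => act rho x (act rho y w))) => [a u v|a u v|m].
- by rewrite linear_mulrl actP.
- by rewrite actP.
apply: (eq_linear (f := fun y => act rho (_ * y) w)
                  (g := fun y => act rho _ (act rho y w))) => [a u v|a u v|m'].
- by rewrite linear_mulrr actP.
- by rewrite actP linearP.
by rewrite monM !act_mon foldr_cat.
Qed.

End Act.

(** Pullback of a module along an algebra homomorphism; coproducts and the placements [placeR] are
    evaluated through it. *)
Lemma act_freehom (F : fieldType) (k N M : nat) (W : lmodType F)
    (rho : 'I_M * gen k -> {linear W -> W}) (phi : 'I_N * gen k -> Utens F k M)
    (x : Utens F k N) w :
  act rho (freehom phi x) w = act (fun g => act rho (phi g) : {linear W -> W}) x w.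
Proof.
apply: (eq_linear (f := fun x => act rho (freehom phi x) w)
  (g := fun x => act (fun g => act rho (phi g) : {linear W -> W}) x w)) => [a u v|a u v|m].
- by rewrite -actP; congr (act _ _ w); apply: linext_is_linear.
- exact: actP.
rewrite /freehom linext_mon act_mon.
elim: m => [|g s IH]; first by rewrite big_nil act1.
by rewrite big_cons actM IH.
Qed.

Section Lead.
Variables (F : fieldType) (k N : nat).

(** The character of the free algebra with value [chi g] at each generator. With [chi2 l m] below,
    it is the Cartan part of an element of [UmUp] at the weights l, m. It does not respect the
    relation for [e_c, f_c], hence does not descend to the quotient by [relI]; it is applied to
    representatives r. *)
Definition lead (chi : 'I_N * gen k -> F) (x : Utens F k N) : F :=
  act (fun g => *:%R (chi g) : {linear F^o -> F^o}) x (1 : F^o).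

Variable chi : 'I_N * gen k -> F.
Lemma leadD x y : lead chi (x + y) = lead chi x + lead chi y.
Proof. by rewrite /lead actD. Qed.
Lemma leadZ a x : lead chi (a *: x) = a * lead chi x.
Proof. by rewrite /lead actZ. Qed.
Lemma lead1 : lead chi 1 = 1.
Proof. by rewrite /lead act1. Qed.
Lemma leadM x y : lead chi (x * y) = lead chi x * lead chi y.
Proof.
rewrite /lead actM; set a := act _ y _.
have {1}-> : a = a *: (1 : F^o) by exact: (esym (mulr1 (a : F))).
by rewrite linearZ /= mulrC.
Qed.
Lemma lead_gvar (i : 'I_N) g : lead chi (gvar F i g) = chi (i, g).
Proof. by rewrite /lead act_gvar; exact: (mulr1 (chi (i, g))). Qed.

End Lead.

(** Triangularity in abstract form. In the applications [T] confines vectors so that f in slot 0 and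
    e in slot 1 contribute nothing to the coordinate [ev]; what remains is the product of the Cartan
    eigenvalues. *)
Lemma UmUp_lead (F : fieldType) (k : nat) (W : lmodType F)
    (rho : 'I_2 * gen k -> {linear W -> W}) (chi : 'I_2 * gen k -> F)
    (T : W -> Prop) (ev : {scalar W}) (x : Utens F k 2) :
  (forall u v, T u -> T v -> T (u + v)) -> (forall a u, T u -> T (a *: u)) ->
  (forall g u, minus_gen g -> T u ->
     T (rho (sl 0, g) u) /\ ev (rho (sl 0, g) u) = chi (sl 0, g) * ev u) ->
  (forall g u, plus_gen g -> T u ->
     T (rho (sl 1, g) u) /\ ev (rho (sl 1, g) u) = chi (sl 1, g) * ev u) ->
  UmUp x -> forall u, T u -> T (act rho x u) /\ ev (act rho x u) = lead chi x * ev u.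
Proof.
move=> TD TZ H0 H1.
apply: (@smallest_sub _ _ _ [set x | forall u, T u ->
  T (act rho x u) /\ ev (act rho x u) = lead chi x * ev u]) => [|{}x [g hg]] /=.
  split => /=.
  - by move=> u Tu; rewrite act1 lead1 mul1r.
  - move=> y z hy hz u Tu; have [[Ty ey] [Tz ez]] := (hy _ Tu, hz _ Tu).
    by rewrite actD leadD linearD /= ey ez mulrDl; split => //; apply: TD.
  - move=> y z hy hz u Tu; have [Tz ez] := hz _ Tu; have [Ty ey] := hy _ Tz.
    by rewrite actM leadM ey ez mulrA.
  - move=> c y hy u Tu; have [Ty ey] := hy _ Tu.
    by rewrite actZ leadZ linearZ /= ey mulrA; split => //; apply: TZ.
case: hg => [[hg ->]|[hg ->]] u Tu; rewrite act_gvar lead_gvar; [exact: H0|exact: H1].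
Qed.

(** * Serre relations under commutation with the opposite generators *)

Section LinComb.
Variables (F : fieldType) (W : lmodType F).

(** Reflected module expressions: they reduce an equality of vectors to equalities of coefficients
    in F, where [ring] and [field] apply. *)
Inductive lcomb :=
  LAtom of nat | LAdd of lcomb & lcomb | LOpp of lcomb | LScale of F & lcomb | LZero.

Fixpoint lval (s : seq W) (e : lcomb) : W :=
  match e with
  | LAtom i => nth 0 s i
  | LAdd a b => lval s a + lval s b
  | LOpp a => - lval s a
  | LScale c a => c *: lval s a
  | LZero => 0
  end.

(** The comparison is by [eqn] so that [cbn] evaluates it on concrete positions. *)
Fixpoint lcoef (i : nat) (e : lcomb) : F :=
  match e with
  | LAtom j => if eqn j i then 1 else 0
  | LAdd a b => lcoef i a + lcoef i b
  | LOpp a => - lcoef i a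
  | LScale c a => c * lcoef i a
  | LZero => 0
  end.

Fixpoint lcoef_eq (n : nat) (e1 e2 : lcomb) : Prop :=
  if n is n'.+1 then lcoef n' e1 = lcoef n' e2 /\ lcoef_eq n' e1 e2 else True.

Lemma lvalE s e : lval s e = \sum_(i < size s) lcoef i e *: s`_i.
Proof.
elim: e => [j|a IHa b IHb|a IHa|c a IHa|] /=.
- have [lj|lj] := ltnP j (size s); last first.
    rewrite nth_default // big1 // => i _.
    case: eqnP => [e|_]; last by rewrite scale0r.
    by move: lj; rewrite e leqNgt ltn_ord.
  rewrite (bigD1 (Ordinal lj)) //= -[eqn j j]/(j == j) eqxx scale1r big1 ?addr0 // => i ne.
  case: eqnP => [e|_]; last by rewrite scale0r.
  by case/eqP: ne; apply/val_inj.
- by rewrite IHa IHb -big_split; apply: eq_bigr => i _; rewrite scalerDl.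
- by rewrite IHa -sumrN; apply: eq_bigr => i _; rewrite scaleNr.
- by rewrite IHa scaler_sumr; apply: eq_bigr => i _; rewrite scalerA.
- by rewrite big1 // => i _; rewrite scale0r.
Qed.

Lemma lval_eq s e1 e2 : lcoef_eq (size s) e1 e2 -> lval s e1 = lval s e2.
Proof.
move=> h; rewrite !lvalE; apply: eq_bigr => i _; congr (_ *: _).
elim: (size s) h i => [_ []//|n IH /= [e h] i].
have [->//|ne] := eqVneq (i : nat) n.
have li : (i < n)%N by rewrite ltn_neqAle ne -ltnS ltn_ord.
exact: (IH h (Ordinal li)).
Qed.

End LinComb.
Arguments LAtom {F}.
Arguments LZero {F}.

Ltac lindex x s :=
  match s with
  | x :: _ => constr:(0%N)
  | _ :: ?s' => let i := lindex x s' in constr:(S i)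
  end.
Ltac latoms t acc :=
  match t with
  | (?a + ?b)%R => let acc := latoms a acc in latoms b acc
  | (- ?a)%R => latoms a acc
  | (_ *: ?a)%R => latoms a acc
  | (0)%R => acc
  | _ => match acc with
         | _ => let i := lindex t acc in acc
         | _ => constr:(t :: acc)
         end
  end.
Ltac lreify F s t :=
  match t with
  | (?a + ?b)%R => let x := lreify F s a in let y := lreify F s b in
                   constr:(@LAdd F x y)
  | (- ?a)%R => let x := lreify F s a in constr:(@LOpp F x)
  | (?c *: ?a)%R => let x := lreify F s a in constr:(@LScale F c x)
  | (0)%R => constr:(@LZero F)
  | _ => let i := lindex t s in constr:(@LAtom F i)
  end.
(* Reduces an equality between linear combinations in a module over a field to
   the equality of the coefficients of each syntactic atom. *)
Ltac lincomb F W :=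
  match goal with
  | |- @eq ?T ?x ?y =>
    let s := latoms x (@nil T) in
    let s := latoms y s in
    let a := lreify F s x in let b := lreify F s y in
    apply: (@lval_eq F W s a b); cbn [lcoef_eq size lcoef eqn];
    repeat split
  end.

Section Serre.
Variables (F : fieldType) (W : lmodType F) (J : eqType).
Variables (E Fo K Kv : J -> {linear W -> W}) (p : J -> bool) (kap : J -> J -> F) (s : F) (c : J -> F).
Hypothesis s0 : s != 0.
Hypothesis KE : forall a b w, K a (E b w) = kap a b *: E b (K a w).
Hypothesis KvE : forall a b w, Kv a (E b w) = (kap a b)^-1 *: E b (Kv a w).
Hypothesis FE : forall a b w, Fo a (E b w) =
  sgn F (p a && p b) *:
    (E b (Fo a w) - ((a == b)%:R * c a) *: (K a (K a w) - Kv a (Kv a w))).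

(** Operator forms of the Serre elements, with the Cartan factors removed. The operators E, Fo, K,
    Kv are abstract, so that one computation covers the raising generators and, with K and Kv
    exchanged, the lowering ones; s stands for q^(1/2). *)
Definition serre_comm a b w := E a (E b w) - sgn F (p a && p b) *: E b (E a w).
Definition serre_cubic b c w :=
  E b (E b (E c w)) - (s ^+ 2 + s ^- 2) *: E b (E c (E b w)) + E c (E b (E b w)).
(** Antisymmetric in a and b. All three Yamane relations act by this operator, up to a scalar and a
    Cartan factor on the right. *)
Definition serre_yamane u a b w :=
  E u (E a (E b w)) + E a (E b (E u w)) - (s ^+ 2 + s ^- 2) *: E a (E u (E b w))
  - (E u (E b (E a w)) + E b (E a (E u w)) - (s ^+ 2 + s ^- 2) *: E b (E u (E a w))).

Let ED j : {morph E j : x y / x + y} := linearD (E j).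
Let EN j : {morph E j : x / - x} := linearN (E j).
Let FD j : {morph Fo j : x y / x + y} := linearD (Fo j).
Let FN j : {morph Fo j : x / - x} := linearN (Fo j).
Let EZ j a : {morph E j : x / a *: x} := linearZ_LR (E j) a.
Let FZ j a : {morph Fo j : x / a *: x} := linearZ_LR (Fo j) a.
Let KZ j a : {morph K j : x / a *: x} := linearZ_LR (K j) a.
Let KvZ j a : {morph Kv j : x / a *: x} := linearZ_LR (Kv j) a.
Let lin := (ED, EN, EZ, FD, FN, FZ, KZ, KvZ).

Let FEn a b w : (a == b) = false -> Fo a (E b w) = sgn F (p a && p b) *: E b (Fo a w).
Proof. by move=> ab; rewrite FE ab mul0r scale0r subr0. Qed.
Let FEe a w : Fo a (E a w) =
  sgn F (p a) *: (E a (Fo a w) - c a *: (K a (K a w) - Kv a (Kv a w))).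
Proof. by rewrite FE eqxx mul1r andbb. Qed.

(** Moving [Fo j] to the right produces extra terms only when j is a or b, each containing the
    difference of the squares of K and Kv. As kap = 1, this difference commutes with the other
    raising operator, and its two occurrences cancel. *)
Lemma serre_comm_comm a b j w : a != b -> kap a b = 1 -> kap b a = 1 ->
  Fo j (serre_comm a b w) = sgn F (p j && (p a (+) p b)) *: serre_comm a b (Fo j w).
Proof.
move=> /negPf ab k1 k2; rewrite /serre_comm.
have ba := ab; rewrite eq_sym in ba.
have [ea|/negPf na] := eqVneq j a; [|have [eb|/negPf nb] := eqVneq j b]; try subst j.
- rewrite !(FEe, FEn _ ab, lin) !(KE, KvE, lin) ?k1 ?k2 ?invr1 ?scale1r.
  by lincomb F W; rewrite /sgn; case: (p a); case: (p b); rewrite /= ?expr1 ?expr0; field; rewrite ?s0 ?oner_neq0.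
- rewrite !(FEe, FEn _ ba, lin) !(KE, KvE, lin) ?k1 ?k2 ?invr1 ?scale1r.
  by lincomb F W; rewrite /sgn; case: (p a); case: (p b); rewrite /= ?expr1 ?expr0; field; rewrite ?s0 ?oner_neq0.
- rewrite !(FEn _ na, FEn _ nb, lin).
  by lincomb F W; rewrite /sgn; case: (p j); case: (p a); case: (p b); rewrite /= ?expr1 ?expr0; ring.
Qed.

Lemma serre_sq_comm a j w : kap a a = 1 ->
  p a -> Fo j (E a (E a w)) = E a (E a (Fo j w)).
Proof.
move=> k1 pa; have [ea|/negPf na] := eqVneq j a; try subst j.
- rewrite !(FEe, lin) !(KE, KvE, lin) ?k1 ?invr1 ?scale1r pa.
  by lincomb F W; rewrite /sgn /= ?expr1; field; rewrite ?s0 ?oner_neq0.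
- rewrite !(FEn _ na, lin).
  by lincomb F W; rewrite /sgn pa; case: (p j); rewrite /= ?expr1 ?expr0; ring.
Qed.

(** The values [s ^- 2] and s of kap encode the inner products -2 and 1 of the roots; with the
    coefficient q + q^-1 the Cartan terms cancel for j = b and for j = d. *)
Lemma serre_cubic_comm b d j w : b != d -> p b = false ->
  kap b b = s ^- 2 -> kap b d = s -> kap d b = s ->
  Fo j (serre_cubic b d w) = sgn F (p j && p d) *: serre_cubic b d (Fo j w).
Proof.
move=> /negPf bd pb k1 k2 k3; rewrite /serre_cubic.
have db := bd; rewrite eq_sym in db.
have [ea|/negPf na] := eqVneq j b; [|have [eb|/negPf nb] := eqVneq j d]; try subst j.
- rewrite !(FEe, FEn _ bd, lin) !(KE, KvE, lin) ?k1 ?k2 ?k3.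
  by lincomb F W; rewrite /sgn pb; rewrite /= ?expr0; field; rewrite ?s0 ?oner_neq0.
- rewrite !(FEe, FEn _ db, lin) !(KE, KvE, lin) ?k1 ?k2 ?k3.
  by lincomb F W; rewrite /sgn pb; case: (p d); rewrite /= ?expr1 ?expr0; field; rewrite ?s0 ?oner_neq0.
- rewrite !(FEn _ na, FEn _ nb, lin).
  by lincomb F W; rewrite /sgn pb andbF; case: (_ && _); rewrite /= ?expr1 ?expr0; field; rewrite ?s0 ?oner_neq0.
Qed.

Lemma serre_yamane_comm u a b j w : u != a -> u != b -> a != b ->
  p u = false -> p a -> p b ->
  kap u a = s -> kap a u = s -> kap u b = s -> kap b u = s ->
  kap a b = s ^- 2 -> kap b a = s ^- 2 ->
  Fo j (serre_yamane u a b w) = serre_yamane u a b (Fo j w).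
Proof.
move=> /negPf ua /negPf ub /negPf ab pu pa pb k1 k2 k3 k4 k5 k6; rewrite /serre_yamane.
have au := ua; have bu := ub; have ba := ab; rewrite eq_sym in au.
rewrite eq_sym in bu; rewrite eq_sym in ba.
have [ea|/negPf nu] := eqVneq j u; [|have [eb|/negPf na] := eqVneq j a;
 [|have [eb|/negPf nb] := eqVneq j b]]; try subst j.
- rewrite !(FEe, FEn _ ua, FEn _ ub, lin) !(KE, KvE, lin) ?k1 ?k2 ?k3 ?k4 ?k5 ?k6.
  by lincomb F W; rewrite /sgn pu /= ?expr0; field; rewrite ?s0 ?oner_neq0.
- rewrite !(FEe, FEn _ au, FEn _ ab, lin) !(KE, KvE, lin) ?k1 ?k2 ?k3 ?k4 ?k5 ?k6.
  by lincomb F W; rewrite /sgn pu pa pb /= ?expr0 ?expr1; field; rewrite ?s0 ?oner_neq0.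
- rewrite !(FEe, FEn _ bu, FEn _ ba, lin) !(KE, KvE, lin) ?k1 ?k2 ?k3 ?k4 ?k5 ?k6.
  by lincomb F W; rewrite /sgn pu pa pb /= ?expr0 ?expr1; field; rewrite ?s0 ?oner_neq0.
- rewrite !(FEn _ nu, FEn _ na, FEn _ nb, lin).
  by lincomb F W; rewrite /sgn pu pa pb andbF andbT; case: (p j); rewrite /= ?expr1 ?expr0; field; rewrite ?s0 ?oner_neq0.
Qed.
End Serre.

(** * Weights and powers of q *)

Section Forms.
Variables (R : realType) (k : nat).
Local Notation coordw := (@coordw R k).
Local Notation alpha := (@alpha R k).

Lemma bformC (x y : weight R k) : bform x y = bform y x.
Proof. by rewrite /bform mulrC; congr (_ - _); apply: eq_bigr => i _; rewrite mulrC. Qed.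
Lemma bformDl (x y z : weight R k) : bform (x + y) z = bform x z + bform y z.
Proof.
rewrite /bform !mxE mulrDl addrACA -opprD -big_split; congr (_ - _).
by apply: eq_bigr => i _; rewrite mxE mulrDl.
Qed.
Lemma bformZl a (x z : weight R k) : bform (a *: x) z = a * bform x z.
Proof.
rewrite /bform !mxE mulrBr mulrA mulr_sumr; congr (_ - _).
by apply: eq_bigr => i _; rewrite mxE mulrA.
Qed.
Lemma bformNl (x z : weight R k) : bform (- x) z = - bform x z.
Proof. by rewrite -scaleN1r bformZl mulN1r. Qed.
Lemma bformDr (x y z : weight R k) : bform z (x + y) = bform z x + bform z y.
Proof. by rewrite !(bformC z) bformDl. Qed.
Lemma bformNr (x z : weight R k) : bform z (- x) = - bform z x.
Proof. by rewrite !(bformC z) bformNl. Qed.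
Definition bformE := (bformDl, bformDr, bformNl, bformNr).

Lemma bform_coordwl i (x : weight R k) (hi : (i < k.+1)%N) :
  bform (coordw i) x = (if i == 0%N then 1 else -1) * x 0 (Ordinal hi).
Proof.
rewrite /bform !mxE /=; case: i hi => [|i] hi /=.
  rewrite !mul1r big1 ?subr0 => [|j nj].
    by congr (x _ _); apply/val_inj.
  rewrite mxE; case: eqP => [e'|_]; last by rewrite mul0r.
  by move/eqP: nj; case; apply/val_inj; rewrite /= e'.
rewrite mul0r sub0r mulN1r; congr (- _).
rewrite (bigD1 (Ordinal hi)) //= mxE /= eqxx mul1r big1 ?addr0 // => j /andP[_ nj].
rewrite mxE; case: eqP => [e'|_]; last by rewrite mul0r.
by move/eqP: nj; case; apply/val_inj; rewrite /= e'.
Qed.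

Lemma bform_coordw i j : (i <= k)%N ->
  bform (coordw i) (coordw j) = if i == j then (if i == 0%N then 1 else -1) else 0.
Proof.
move=> hi; rewrite (bform_coordwl _ (hi : (i < k.+1)%N)) mxE /=.
by case: (i == j); rewrite ?mulr1 ?mulr0.
Qed.

Hypothesis k0 : (0 < k)%N.

Lemma alpha_even_sq (c : 'I_k.-1) : bform (alpha (Lmu c)) (alpha (Lmu c)) = -2.
Proof.
have := ltn_ord c => hc.
by rewrite /= !bformE !bform_coordw ?eqxx; [do ? case: eqP => /=; first [lia | lra] | lia..].
Qed.
Lemma alpha_even_even (c d : 'I_k.-1) : c != d ->
  bform (alpha (Lmu c)) (alpha (Lmu d)) = ((c == d.+1 :> nat) || (d == c.+1 :> nat))%:R.
Proof.
move=> cd; have hcd : (c <> d :> nat) by move/val_inj => e; rewrite e eqxx in cd.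
have := ltn_ord c => hc.
rewrite /= !bformE !bform_coordw; [| lia..].
by do ? case: eqP => /=; first [lia | lra].
Qed.
Lemma alpha_even_odd (c : 'I_k.-1) (d : label k) : lodd d ->
  bform (alpha (Lmu c)) (alpha d) = (c.+2 == k)%:R.
Proof.
have := ltn_ord c => hc; case: d => [d||] //= _;
rewrite !bformE !bform_coordw; try lia;
by do ? case: eqP => /=; first [lia | lra].
Qed.
Lemma alpha_odd_sq (d : label k) : lodd d -> bform (alpha d) (alpha d) = 0.
Proof.
case: d => [d||] //= _; rewrite !bformE !bform_coordw ?eqxx; try lia;
by do ? case: eqP => /=; first [lia | lra].
Qed.
Lemma alpha_st : bform (alpha Ls) (alpha Lt) = -2.
Proof.
rewrite /= !bformE !bform_coordw ?eqxx; try lia;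
by do ? case: eqP => /=; first [lia | lra].
Qed.

End Forms.

Section Qpow.
Variables (R : realType) (F : fieldType) (iota : {rmorphism R -> F}) (q : R).
Hypothesis (hq : 0 < q) (hq1 : q != 1).
Local Notation qpow := (qpow iota q).

Lemma qpowD x y : qpow (x + y) = qpow x * qpow y.
Proof. by rewrite /qpow powRD ?rmorphM // (gt_eqF hq) implybT. Qed.
Lemma qpow0 : qpow 0 = 1. Proof. by rewrite /qpow powRr0 rmorph1. Qed.
Lemma qpowN x : qpow (- x) = (qpow x)^-1.
Proof. by rewrite /qpow powRN fmorphV. Qed.
Lemma qpow_neq0 x : qpow x != 0.
Proof. by rewrite /qpow fmorph_eq0 gt_eqF // powR_gt0. Qed.
Lemma qpow1 : qpow 1 = iota q.
Proof. by rewrite /qpow powRr1 // ltW. Qed.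
Lemma qpow_half x : qpow x = qpow (x / 2) ^+ 2.
Proof. by rewrite expr2 -qpowD; congr qpow; lra. Qed.

Lemma qpow_inj1 x : qpow x = 1 -> x = 0.
Proof.
move=> /eqP; rewrite /qpow -(rmorph1 iota) (inj_eq (fmorph_inj iota)) powR_eq1.
by rewrite (negPf hq1) ltNge (ltW hq) /= => /eqP.
Qed.
(** The q-integer of a nonzero real number does not vanish, as q is positive and different from 1.
    It is applied to x = (l, alpha_c) with l an arbitrary real weight. *)
Lemma qpow_sub_neq0 x : x != 0 -> qpow x - qpow (- x) != 0.
Proof.
move=> x0; rewrite subr_eq0; apply: contra x0 => /eqP e.
have : qpow (x + x) = 1 by rewrite qpowD {1}e -qpowD addNr qpow0.
by move/qpow_inj1/eqP; rewrite -mulr2n mulrn_eq0.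
Qed.
Lemma qsub_neq0 : iota q - (iota q)^-1 != 0.
Proof. by rewrite -qpow1 -qpowN qpow_sub_neq0 // oner_neq0. Qed.

End Qpow.

(** * Parity and the graded conjugation *)

Section Parity.
Variables (F : fieldType) (k N : nat).
Implicit Types (x y : Utens F k N) (m : seq ('I_N * gen k)).

Definition wodd m : bool := odd (count (fun g => godd g.2) m).
Definition paut : Utens F k N -> Utens F k N :=
  linext (fun m => sgn F (wodd m) *: mon F m).
(** Homogeneity as an eigenvalue condition for the parity automorphism: it passes through products
    and sums without mention of supports. *)
Definition homog (b : bool) x : Prop := paut x = sgn F b *: x.

Lemma sgnM a b : sgn F (a (+) b) = sgn F a * sgn F b.
Proof. by rewrite /sgn signr_addb. Qed.
Lemma sgn0 : sgn F false = 1. Proof. by []. Qed.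
Lemma sgn1 : sgn F true = -1. Proof. by rewrite /sgn expr1. Qed.
Lemma sgn_cocycle a b c : sgn F (a && (b (+) c)) * sgn F (b && c) =
  sgn F ((a (+) b) && c) * sgn F (a && b).
Proof. by case: a; case: b; case: c; rewrite /= ?sgn0 ?sgn1; ring. Qed.

Lemma paut_mon m : paut (mon F m) = sgn F (wodd m) *: mon F m.
Proof. by rewrite /paut linext_mon. Qed.
Lemma pautP : linear paut.
Proof. exact: linext_is_linear. Qed.
Lemma pautZ c x : paut (c *: x) = c *: paut x.
Proof. by rewrite -[c *: x]addr0 pautP /paut raddf0 addr0. Qed.
Lemma dagP : linear (@dag F k N).
Proof. exact: linext_is_linear. Qed.
Lemma dagZ c x : dag (c *: x) = c *: dag x.
Proof. by rewrite -[c *: x]addr0 dagP /dag raddf0 addr0. Qed.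
Lemma dagB x y : dag (x - y) = dag x - dag y.
Proof. by rewrite addrC -scaleN1r dagP scaleN1r addrC. Qed.

Lemma pautM x y : paut (x * y) = paut x * paut y.
Proof.
apply: (eq_linear (f := fun x => paut (x * y)) (g := fun x => paut x * paut y)) => [c u v|c u v|m].
- by rewrite linear_mulrl pautP.
- by rewrite pautP linear_mulrl.
apply: (eq_linear (f := fun y => paut (_ * y)) (g := fun y => paut _ * paut y)) => [c u v|c u v|m'].
- by rewrite linear_mulrr pautP.
- by rewrite pautP linear_mulrr.
rewrite monM !paut_mon /wodd count_cat oddD sgnM -scalerAl Utens_scalerAr monM.
by rewrite scalerA.
Qed.

Lemma homogM a b x y : homog a x -> homog b y -> homog (a (+) b) (x * y).
Proof.
by rewrite /homog pautM => -> ->; rewrite Utens_scalerAr -scalerAl scalerA -sgnM addbC.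
Qed.
Lemma homogB b x y : homog b x -> homog b y -> homog b (x - y).
Proof.
by rewrite /homog addrC -scaleN1r pautP => -> ->; rewrite scalerDr !scalerA mulrC.
Qed.
Lemma homogZ b c x : homog b x -> homog b (c *: x).
Proof. by rewrite /homog pautZ => ->; rewrite !scalerA mulrC. Qed.
Lemma homog_gvar (i : 'I_N) (g : gen k) : homog (godd g) (gvar F i g).
Proof. by rewrite /homog gvar_mon paut_mon /wodd /= addn0 oddb. Qed.

Lemma dag_cat m m' : dag_word F (m ++ m')
  = sgn F (wodd m && wodd m') *: (dag_word F m' * dag_word F m).
Proof.
rewrite /wodd; elim: m => [|g m IH] /=; first by rewrite mulr1 scale1r.
rewrite IH count_cat !oddD -scalerAl scalerA sgn_cocycle Utens_scalerAr scalerA mulrA.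
rewrite oddb; reflexivity.
Qed.

Lemma dagM a b x y : homog a x -> homog b y ->
  dag (x * y) = sgn F (a && b) *: (dag y * dag x).
Proof.
move=> hx hy.
(* [pw] replaces the sign, which makes sense for homogeneous elements only, by a linear operator;
   the identity can then be checked on monomials, in x first and in y afterwards. *)
pose pw (c : bool) z := if c then paut z else z.
have pwP c : linear (pw c) by case: c => ? ? ?; rewrite /pw ?pautP.
have pw_mon c m : pw c (mon F m) = sgn F (wodd m && c) *: mon F m.
  case: c; first by rewrite /pw andbT paut_mon; reflexivity.
  by rewrite /pw andbF sgn0 scale1r.
have pw_homog c d z : homog d z -> pw c z = sgn F (d && c) *: z.
  case: c => hz; first by rewrite /pw andbT hz; reflexivity.
  by rewrite /pw andbF sgn0 scale1r.
suff -> : dag (x * y) = dag y * dag (pw b x).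
  by rewrite (pw_homog _ _ _ hx) dagZ Utens_scalerAr; reflexivity.
apply: (eq_linear (f := fun x => dag (x * y)) (g := fun x => dag y * dag (pw b x)))
  => [c u v|c u v|m].
- by rewrite linear_mulrl dagP; reflexivity.
- by rewrite pwP dagP linear_mulrr; reflexivity.
rewrite pw_mon dagZ Utens_scalerAr.
suff -> : dag (mon F m * y) = dag (pw (wodd m) y) * dag (mon F m).
  by rewrite (pw_homog _ _ _ hy) dagZ -scalerAl andbC; reflexivity.
apply: (eq_linear (f := fun z => dag (mon F m * z))
    (g := fun z => dag (pw (wodd m) z) * dag (mon F m))) => [c u v|c u v|m'].
- by rewrite linear_mulrr dagP; reflexivity.
- by rewrite pwP dagP linear_mulrl; reflexivity.
by rewrite monM pw_mon dagZ /dag !linext_mon dag_cat andbC -scalerAl; reflexivity.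
Qed.

Lemma dagM3 a b c x y z : homog a x -> homog b y -> homog c z ->
  dag (x * y * z) = (sgn F ((a (+) b) && c) * sgn F (a && b)) *: (dag z * (dag y * dag x)).
Proof.
move=> hx hy hz; apply: (eq_trans (dagM (homogM hx hy) hz)); rewrite -scalerA.
apply: (congr1 (fun u : Utens F k N => _ *: u)).
exact: (eq_trans (congr1 (fun u => dag z * u) (dagM hx hy)) (Utens_scalerAr _ _ _)).
Qed.

Lemma dag_skew a b x y t c : homog a x -> homog b y -> homog false t ->
  dag (x * y * t - c *: (t * y * x)) = sgn F (a && b) *: (dag t * (dag y * dag x))
    - (c * sgn F (a && b)) *: (dag x * (dag y * dag t)).
Proof.
move=> hx hy ht; apply: (eq_trans (dagB _ _)).
apply: (congr2 (fun u v : Utens F k N => u - v)).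
  by apply: (eq_trans (dagM3 hx hy ht)); rewrite andbF sgn0 mul1r; reflexivity.
apply: (eq_trans (dagZ _ _)); rewrite -scalerA; apply: (congr1 (fun u : Utens F k N => c *: u)).
by apply: (eq_trans (dagM3 ht hy hx)); rewrite sgn0 mulr1 andbC; reflexivity.
Qed.

Lemma dag_gvar (i : 'I_N) (g : gen k) : dag (gvar F i g) = dag_gen F (i, g).
Proof. by rewrite gvar_mon /dag linext_mon /= andbF scale1r mul1r. Qed.

End Parity.

(** * Modules satisfying the non-Serre relations *)

Section Premodule.
Variables (R : realType) (F : fieldType) (iota : {rmorphism R -> F}).
Variables (k : nat) (q : R).
Hypotheses (hk : (0 < k)%N) (hq : 0 < q) (hq1 : q != 1).
Variables (N : nat) (W : lmodType F) (rho : 'I_N * gen k -> {linear W -> W}).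
Local Notation J := ('I_N * label k)%type.
Local Notation qpow := (qpow iota q).

(** The N slots are treated as one algebra with a block-diagonal form, so that relations inside a
    slot and between distinct slots are instances of the same statements. *)
Definition slot_form (x y : J) : R :=
  if x.1 == y.1 then bform (alpha R x.2) (alpha R y.2) else 0.

Local Notation e x := (rho (x.1, GE x.2)).
Local Notation f x := (rho (x.1, GF x.2)).
Local Notation h x := (rho (x.1, GH x.2)).
Local Notation K x := (rho (x.1, GK x.2)).
Local Notation Kv x := (rho (x.1, GKv x.2)).
Local Notation p x := (lodd x.2).

(** All relations except those among raising generators alone or lowering generators alone; the
    latter, between distinct slots as well, are in [serre_in]. *)
Record premodule : Prop := {
  pm_KKv : forall (x : J) w, K x (Kv x w) = w;
  pm_KvK : forall (x : J) w, Kv x (K x w) = w;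
  pm_KK : forall (x y : J) w, K x (K y w) = K y (K x w);
  pm_hK : forall (x y : J) w, h x (K y w) = K y (h x w);
  pm_hh : forall (x y : J) w, h x (h y w) = h y (h x w);
  pm_he : forall (x y : J) w, h x (e y w) = e y (h x w) + iota (slot_form x y) *: e y w;
  pm_hf : forall (x y : J) w, h x (f y w) = f y (h x w) - iota (slot_form x y) *: f y w;
  pm_Ke : forall (x y : J) w, K x (e y w) = qpow (slot_form x y / 2) *: e y (K x w);
  pm_Kf : forall (x y : J) w, K x (f y w) = qpow (- (slot_form x y / 2)) *: f y (K x w);
  pm_ef : forall (x y : J) w, e x (f y w) = sgn F (p x && p y) *: f y (e x w)
     + ((x == y)%:R / (iota q - (iota q)^-1)) *: (K x (K x w) - Kv x (Kv x w))
}.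

(** [P] will be either vanishing or membership in the radical of a Verma module. The first clause
    covers distinct slots as well as orthogonal roots of one slot. *)
Definition serre_in (P : W -> Prop) (E : J -> {linear W -> W}) : Prop :=
  [/\ forall x y w, x != y -> slot_form x y = 0 ->
        P (serre_comm E (fun x => lodd x.2) x y w),
      forall x w, p x -> P (E x (E x w)),
      forall x y w, x != y -> p x = false -> x.1 = y.1 ->
        slot_form x x = -2 -> slot_form x y = 1 ->
        P (serre_cubic E (qpow (1 / 2)) x y w) &
      forall i (u : 'I_k.-1) w, (u.+2 = k)%N ->
        P (serre_yamane E (qpow (1 / 2)) (i, Lmu u) (i, Ls) (i, Lt) w)].

Hypothesis pm : premodule.

Lemma slot_formC x y : slot_form x y = slot_form y x.
Proof. by rewrite /slot_form eq_sym; case: eqP => // _; rewrite bformC. Qed.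

Lemma pm_Kve x y w : Kv x (e y w) = qpow (- (slot_form x y / 2)) *: e y (Kv x w).
Proof.
have E : e y w = K x (qpow (- (slot_form x y / 2)) *: e y (Kv x w)).
  by rewrite linearZ_LR (pm_Ke pm) (pm_KKv pm) scalerA -(qpowD _ hq) addNr qpow0 scale1r.
by rewrite [in LHS]E (pm_KvK pm).
Qed.
Lemma pm_Kvf x y w : Kv x (f y w) = qpow (slot_form x y / 2) *: f y (Kv x w).
Proof.
have E : f y w = K x (qpow (slot_form x y / 2) *: f y (Kv x w)).
  by rewrite linearZ_LR (pm_Kf pm) (pm_KKv pm) scalerA -(qpowD _ hq) addrN qpow0 scale1r.
by rewrite [in LHS]E (pm_KvK pm).
Qed.
Lemma pm_KKvC x y w : K x (Kv y w) = Kv y (K x w).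
Proof. by rewrite -[in RHS](pm_KKv pm y w) (pm_KK pm x y) (pm_KvK pm). Qed.
Lemma pm_KvKv x y w : Kv x (Kv y w) = Kv y (Kv x w).
Proof. by rewrite -[in RHS](pm_KKv pm y w) -pm_KKvC (pm_KvK pm). Qed.
Lemma pm_hKv x y w : h x (Kv y w) = Kv y (h x w).
Proof. by rewrite -[in RHS](pm_KKv pm y w) (pm_hK pm) (pm_KvK pm). Qed.

(* In both directions the e/f relation has the same shape, with the roles of
   q^h and q^(-h) exchanged. *)
Lemma pm_fe x y w : f x (e y w) = sgn F (p x && p y) *:
  (e y (f x w) - ((x == y)%:R * (iota q - (iota q)^-1)^-1) *:
     (K x (K x w) - Kv x (Kv x w))).
Proof.
rewrite (pm_ef pm y x) andbC eq_sym; have [->|_] := eqVneq x y; last first.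
  by lincomb F W; rewrite mul0r /sgn; case: (_ && _); rewrite ?expr0 ?expr1; ring.
by lincomb F W; rewrite mul1r /sgn; case: (_ && _); rewrite ?expr0 ?expr1; ring.
Qed.

(* ['e' = f, 'f' = (-1)^[e] e, 'q^h' = q^(-h)] again satisfies the relations, so
   that every computation with raising generators also applies to the lowering
   ones. *)
Lemma pm_ef_twist x y w : e x (f y w) = sgn F (p x && p y) *:
  (f y (e x w) - ((x == y)%:R * (sgn F (p x) * (iota q - (iota q)^-1)^-1)) *:
     (Kv x (Kv x w) - K x (K x w))).
Proof.
rewrite (pm_ef pm x y); have [->|_] := eqVneq x y; last first.
  by lincomb F W; rewrite !mul0r /sgn; case: (_ && _); rewrite ?expr0 ?expr1; ring.
by lincomb F W; rewrite !mul1r andbb /sgn; case: (lodd _); rewrite ?expr0 ?expr1; ring.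
Qed.

End Premodule.

Section PremoduleRel.
Variables (R : realType) (F : fieldType) (iota : {rmorphism R -> F}).
Variables (k : nat) (q : R).
Hypotheses (hk : (0 < k)%N) (hq : 0 < q) (hq1 : q != 1).
Variables (N : nat) (W : lmodType F) (rho : 'I_N * gen k -> {linear W -> W}).
Local Notation J := ('I_N * label k)%type.
Local Notation qpow := (qpow iota q).
Local Notation slot_form := (@slot_form R k N).
Local Notation s := (qpow (1 / 2)).

Definition opE (x : J) := rho (x.1, GE x.2).
Definition opF (x : J) := rho (x.1, GF x.2).
Definition opK (x : J) := rho (x.1, GK x.2).
Definition opKv (x : J) := rho (x.1, GKv x.2).
Local Notation par x := (lodd x.2).
Local Notation parf := (fun x : J => lodd x.2).
Local Notation kap x y := (qpow (slot_form x y / 2)).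

Hypothesis pm : premodule iota q rho.

Lemma qhalf_sq : s ^+ 2 = iota q.
Proof. by rewrite -qpow_half // qpow1. Qed.
Lemma qhalf_neg2 : qpow (-2 / 2) = s ^- 2.
Proof. by rewrite qhalf_sq -(qpow1 iota hq) -qpowN; congr qpow; lra. Qed.
Lemma qhalf0 : qpow (0 / 2) = 1. Proof. by rewrite mul0r qpow0. Qed.

Lemma slot_form_same i c d : slot_form (i, c) (i, d) = bform (alpha R c) (alpha R d).
Proof. by rewrite /slot_form /= eqxx. Qed.

Let s0 : s != 0 := qpow_neq0 iota hq _.
Let KE (x y : J) w : opK x (opE y w) = kap x y *: opE y (opK x w) := pm_Ke pm x y w.
Let KvE (x y : J) w : opKv x (opE y w) = (kap x y)^-1 *: opE y (opKv x w).
Proof. by rewrite -qpowN; apply: pm_Kve. Qed.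
Let KvF (x y : J) w : opKv x (opF y w) = kap x y *: opF y (opKv x w).
Proof. exact: pm_Kvf. Qed.
Let KF (x y : J) w : opK x (opF y w) = (kap x y)^-1 *: opF y (opK x w).
Proof. by rewrite -qpowN; apply: (pm_Kf pm). Qed.

Let FE (x y : J) w : opF x (opE y w) = sgn F (par x && par y) *:
  (opE y (opF x w) - ((x == y)%:R * (iota q - (iota q)^-1)^-1) *:
     (opK x (opK x w) - opKv x (opKv x w))) := pm_fe pm x y w.
Let EF (x y : J) w : opE x (opF y w) = sgn F (par x && par y) *:
  (opF y (opE x w) - ((x == y)%:R * (sgn F (par x) * (iota q - (iota q)^-1)^-1)) *:
     (opKv x (opKv x w) - opK x (opK x w))) := pm_ef_twist pm x y w.

Section Numeric.
Variables (i : 'I_N) (u : 'I_k.-1).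
Hypothesis uk : (u.+2 = k)%N.
Lemma kap_us : kap (i, Lmu u) (i, Ls) = s.
Proof. by rewrite slot_form_same alpha_even_odd // uk eqxx. Qed.
Lemma kap_ut : kap (i, Lmu u) (i, Lt) = s.
Proof. by rewrite slot_form_same alpha_even_odd // uk eqxx. Qed.
Lemma kap_st : kap (i, Ls) (i, Lt) = s ^- 2.
Proof. by rewrite slot_form_same alpha_st // qhalf_neg2. Qed.
End Numeric.

Lemma kapC x y : kap x y = kap y x. Proof. by rewrite slot_formC. Qed.
Lemma kap_odd x : par x -> kap x x = 1.
Proof. by case: x => i c px; rewrite slot_form_same alpha_odd_sq // qhalf0. Qed.

Lemma opE_comm x y j w : x != y -> slot_form x y = 0 ->
  opF j (serre_comm opE parf x y w)
    = sgn F (par j && (par x (+) par y)) *: serre_comm opE parf x y (opF j w).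
Proof.
move=> xy xy0; have k1 : kap x y = 1 by rewrite xy0 qhalf0.
by apply: (serre_comm_comm (p := parf) KE KvE FE) => //; rewrite kapC.
Qed.
(** The computation for raising operators, read with [opKv] in the role of [opK]; this is what
    [pm_ef_twist] was prepared for. *)
Lemma opF_comm x y j w : x != y -> slot_form x y = 0 ->
  opE j (serre_comm opF parf x y w)
    = sgn F (par j && (par x (+) par y)) *: serre_comm opF parf x y (opE j w).
Proof.
move=> xy xy0; have k1 : kap x y = 1 by rewrite xy0 qhalf0.
by apply: (serre_comm_comm (p := parf) KvF KF EF) => //; rewrite kapC.
Qed.

Lemma opE_sq x j w : par x -> opF j (opE x (opE x w)) = opE x (opE x (opF j w)).
Proof. by move=> px; apply: (serre_sq_comm KE KvE FE) => //; apply: kap_odd. Qed.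
Lemma opF_sq x j w : par x -> opE j (opF x (opF x w)) = opF x (opF x (opE j w)).
Proof. by move=> px; apply: (serre_sq_comm KvF KF EF) => //; apply: kap_odd. Qed.

Lemma opE_cubic x y j w : x != y -> par x = false ->
  slot_form x x = -2 -> slot_form x y = 1 ->
  opF j (serre_cubic opE s x y w) = sgn F (par j && par y) *: serre_cubic opE s x y (opF j w).
Proof.
move=> xy px xx1 xy1; have k1 : kap x y = s by rewrite xy1.
by apply: (serre_cubic_comm s0 KE KvE FE) => //; [rewrite xx1 qhalf_neg2 | rewrite kapC].
Qed.
Lemma opF_cubic x y j w : x != y -> par x = false ->
  slot_form x x = -2 -> slot_form x y = 1 ->
  opE j (serre_cubic opF s x y w) = sgn F (par j && par y) *: serre_cubic opF s x y (opE j w).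
Proof.
move=> xy px xx1 xy1; have k1 : kap x y = s by rewrite xy1.
by apply: (serre_cubic_comm s0 KvF KF EF) => //; [rewrite xx1 qhalf_neg2 | rewrite kapC].
Qed.

Lemma opE_yamane i (u : 'I_k.-1) j w : (u.+2 = k)%N ->
  opF j (serre_yamane opE s (i, Lmu u) (i, Ls) (i, Lt) w)
    = serre_yamane opE s (i, Lmu u) (i, Ls) (i, Lt) (opF j w).
Proof.
move=> uk; have [us ut st] := And3 (kap_us i uk) (kap_ut i uk) (kap_st i).
have us' : kap (i, Ls) (i, Lmu u) = s by rewrite kapC.
have ut' : kap (i, Lt) (i, Lmu u) = s by rewrite kapC.
have st' : kap (i, Lt) (i, Ls) = s ^- 2 by rewrite kapC.
have d c d' : c != d' -> (i, c) != (i, d') :> J by move=> cd; rewrite xpair_eqE eqxx.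
exact: (serre_yamane_comm (p := parf) s0 KE KvE FE j w (d (Lmu u) Ls isT) (d (Lmu u) Lt isT) (d Ls Lt isT)
  erefl isT isT us us' ut ut' st st').
Qed.
Lemma opF_yamane i (u : 'I_k.-1) j w : (u.+2 = k)%N ->
  opE j (serre_yamane opF s (i, Lmu u) (i, Ls) (i, Lt) w)
    = serre_yamane opF s (i, Lmu u) (i, Ls) (i, Lt) (opE j w).
Proof.
move=> uk; have [us ut st] := And3 (kap_us i uk) (kap_ut i uk) (kap_st i).
have us' : kap (i, Ls) (i, Lmu u) = s by rewrite kapC.
have ut' : kap (i, Lt) (i, Lmu u) = s by rewrite kapC.
have st' : kap (i, Lt) (i, Ls) = s ^- 2 by rewrite kapC.
have d c d' : c != d' -> (i, c) != (i, d') :> J by move=> cd; rewrite xpair_eqE eqxx.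
exact: (serre_yamane_comm (p := parf) s0 KvF KF EF j w (d (Lmu u) Ls isT) (d (Lmu u) Lt isT) (d Ls Lt isT)
  erefl isT isT us us' ut ut' st st').
Qed.
End PremoduleRel.

(** * Action of the defining relations *)

Section RelI.
Variables (R : realType) (F : fieldType) (iota : {rmorphism R -> F}).
Variables (k : nat) (q : R).
Hypotheses (hk : (0 < k)%N) (hq : 0 < q) (hq1 : q != 1).
Variables (N : nat) (W : lmodType F) (rho : 'I_N * gen k -> {linear W -> W}).
Local Notation J := ('I_N * label k)%type.
Local Notation qpow := (qpow iota q).
Local Notation slot_form := (@slot_form R k N).
Local Notation s := (qpow (1 / 2)).
Local Notation opE := (opE rho).
Local Notation opF := (opF rho).
Local Notation opK := (opK rho).
Local Notation opKv := (opKv rho).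
Local Notation par x := (lodd x.2).
Local Notation parf := (fun x : J => lodd x.2).

Hypothesis pm : premodule iota q rho.

Let actL (y : Utens F k N) a w : act rho y (a *: w) = a *: act rho y w := linearZ_LR (act rho y) a w.
Let rhoL g a w : rho g (a *: w) = a *: rho g w := linearZ_LR (rho g) a w.
Let actE := (actM, actD, actB, actN, actZ, act_gvar, act1).

Lemma act_stable (Z : W -> Prop) : (forall a u v, Z u -> Z v -> Z (a *: u + v)) ->
  Z 0 -> (forall g u, Z u -> Z (rho g u)) -> forall x u, Z u -> Z (act rho x u).
Proof.
move=> Zl Z0 Zg x u Zu; rewrite /act /linext; apply: (big_ind Z) => [//|v w Zv Zw|m _].
  by rewrite -[v]scale1r; apply: Zl.
rewrite -[_ *: _]addr0; apply: Zl => //.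
by elim: (m : seq _) => //= g t; apply: Zg.
Qed.

Lemma act_skew a b (x y z : Utens F k N) w :
  act rho (a *: (x * (y * z)) - b *: (z * (y * x))) w =
  a *: act rho x (act rho y (act rho z w)) - b *: act rho z (act rho y (act rho x w)).
Proof. by rewrite actB; congr (_ - _); rewrite actZ; congr (_ *: _); rewrite !actM. Qed.

Lemma act_subZ a (x y : Utens F k N) w :
  act rho (x - a *: y) w = act rho x w - a *: act rho y w.
Proof. by rewrite actB; congr (_ - _); rewrite actZ. Qed.
Lemma act_dag_subZ a (x y : Utens F k N) w :
  act rho (dag (x - a *: y)) w = act rho (dag x) w - a *: act rho (dag y) w.
Proof. by rewrite dagB dagZ act_subZ. Qed.
Lemma act_dag_sub (x y : Utens F k N) w :
  act rho (dag (x - y)) w = act rho (dag x) w - act rho (dag y) w.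
Proof. by rewrite dagB actB. Qed.

Section Slot.
Variable i : 'I_N.
Local Notation E c := (opE (i, c)).
Local Notation Fo c := (opF (i, c)).
Local Notation K c := (opK (i, c)).
Local Notation Kv c := (opKv (i, c)).
Local Notation frm c d := (bform (alpha R c) (alpha R d)).

Let KE c d w : K c (E d w) = qpow (frm c d / 2) *: E d (K c w).
Proof. by rewrite -(slot_form_same R i); apply: (pm_Ke pm). Qed.
Let KvE c d w : Kv c (E d w) = qpow (- (frm c d / 2)) *: E d (Kv c w).
Proof. by rewrite -(slot_form_same R i); apply: (pm_Kve hq pm). Qed.
Let KF c d w : K c (Fo d w) = qpow (- (frm c d / 2)) *: Fo d (K c w).
Proof. by rewrite -(slot_form_same R i); apply: (pm_Kf pm). Qed.
Let KvF c d w : Kv c (Fo d w) = qpow (frm c d / 2) *: Fo d (Kv c w).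
Proof. by rewrite -(slot_form_same R i); apply: (pm_Kvf hq pm). Qed.
Let KC c d w : K c (K d w) = K d (K c w). Proof. exact: (pm_KK pm (i, c) (i, d)). Qed.

Lemma qhalf_pinv z : qpow (z / 2) * qpow (- (z / 2)) = 1.
Proof. by rewrite -(qpowD _ hq) addrN qpow0. Qed.

Lemma act_ad_e c p y (G : F) w : (forall w, K c (act rho y w) = G *: act rho y (K c w)) ->
  act rho (ad_e iota q i c p y) w =
    E c (act rho y (K c w)) - (sgn F (lodd c && p) * G) *: act rho y (E c (K c w)).
Proof.
move=> hG; rewrite /ad_e !actE.
rewrite -[rho (i, GE c)]/(E c) -[rho (i, GK c)]/(K c) hG KE actL !scalerA.
congr (_ - _ *: _); rewrite -!mulrA; congr (_ * _).
by rewrite mulrCA [X in _ * X]mulrC qhalf_pinv mulr1.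
Qed.
Lemma act_ad_f c p y (G : F) w : (forall w, K c (act rho y w) = G *: act rho y (K c w)) ->
  act rho (ad_f iota q i c p y) w =
    Fo c (act rho y (K c w)) - (sgn F (lodd c && p) * G) *: act rho y (Fo c (K c w)).
Proof.
move=> hG; rewrite /ad_f !actE.
rewrite -[rho (i, GF c)]/(Fo c) -[rho (i, GK c)]/(K c) hG KF actL !scalerA.
congr (_ - _ *: _); rewrite -!mulrA; congr (_ * _).
by rewrite mulrCA qhalf_pinv mulr1.
Qed.
Lemma act_qbr c p y (G : F) w : (forall w, K c (act rho y w) = G *: act rho y (K c w)) ->
  act rho (qbr iota q i c p y) w = G *:
    (E c (act rho y (K c w)) - (sgn F (lodd c && p) * G) *: act rho y (E c (K c w))).
Proof.
move=> hG; have yK v : act rho (gvar F i (GK c) * y * gvar F i (GKv c)) v = G *: act rho y v.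
  by rewrite !actE [rho _ _]hG /= (pm_KKv pm (i, c)).
rewrite /qbr (@act_ad_e c p _ G) => [|v]; last by rewrite !yK [K c _]rhoL hG.
by rewrite !yK [E c _]rhoL scalerBr !scalerA mulrCA mulrA.
Qed.

Lemma act_Ec c w : act rho (Ec F i c) w = E c (K c w).
Proof. by rewrite /Ec !actE. Qed.
Lemma act_Fc c w : act rho (Fc F i c) w = Fo c (K c w).
Proof. by rewrite /Fc !actE. Qed.

Let hK (c : label k) : homog false (gvar F i (GK c)) := homog_gvar F i (GK c).
Let hKv (c : label k) : homog false (gvar F i (GKv c)) := homog_gvar F i (GKv c).
Let hE (c : label k) : homog (lodd c) (gvar F i (GE c)) := homog_gvar F i (GE c).

Lemma homog_Ec (c : label k) : homog (lodd c) (Ec F i c).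
Proof. by have := homogM (hE c) (hK c); rewrite addbF. Qed.

Lemma homog_conj c p (y : Utens F k N) : homog p y ->
  homog p (gvar F i (GK c) * y * gvar F i (GKv c)).
Proof. by move=> hy; have := homogM (homogM (hK c) hy) (hKv c); rewrite addbF. Qed.

Lemma homog_qbr c p (y : Utens F k N) : homog p y ->
  homog (lodd c (+) p) (qbr iota q i c p y).
Proof.
move=> /(homog_conj c) hz; rewrite /qbr /ad_e; apply: homogB; last apply: homogZ.
  by have := homogM (homogM (hE c) hz) (hK c); rewrite addbF.
by have := homogM (homogM (hK c) hz) (hE c); rewrite addbC.
Qed.

(** The conjugation reverses products, so the two terms of the bracket exchange their roles and the
    result is, up to a scalar, a q-commutator with f_c. *)
Lemma act_dag_qbr c p (y : Utens F k N) (G : F) w : homog p y -> G != 0 ->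
  (forall w, K c (act rho (dag y) w) = G *: act rho (dag y) (K c w)) ->
  act rho (dag (qbr iota q i c p y)) w =
    (- (qpow (- (frm c c / 2)) / G)) *:
    (Fo c (act rho (dag y) (K c w)) - (sgn F (lodd c && p) * G) *: act rho (dag y) (Fo c (K c w))).
Proof.
move=> hy G0 hG.
have hz := homog_conj c hy.
have hGv v : Kv c (act rho (dag y) v) = G^-1 *: act rho (dag y) (Kv c v).
  rewrite -[in LHS](pm_KKv pm (i, c) v) -[X in act _ _ X]/(K c (Kv c v)).
  rewrite -[act _ _ (K c _)]scale1r -(mulVf G0) -scalerA -hG [Kv c _]rhoL.
  by congr (_ *: _); apply: (pm_KvK pm (i, c)).
have dzv v : act rho (dag (gvar F i (GK c) * y * gvar F i (GKv c))) v = G^-1 *: act rho (dag y) v.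
  have /(congr1 (fun z => act rho z v)) D := dagM3 (hK c) hy (hKv c).
  apply: (eq_trans D); rewrite !dag_gvar /dag_gen /=; move: (dag y) hGv => Y hGv.
  rewrite actZ !actM !act_gvar andbF !sgn0 mul1r scale1r.
  by rewrite [rho _ _]hGv; congr (_ *: act _ _ _); apply: (pm_KvK pm (i, c)).
have := dag_skew (sgn F (lodd c && p) * qpow (- (frm c c / 2))) (hE c) hz (hK c).
move/(congr1 (fun z => act rho z w)) => D; apply: (eq_trans D) => {D}.
have -> : dag (gvar F i (GE c)) = gvar F i (GF c) by rewrite dag_gvar; reflexivity.
have -> : dag (gvar F i (GK c)) = gvar F i (GK c) by rewrite dag_gvar; reflexivity.
move: (dag (gvar F i (GK c) * y * gvar F i (GKv c))) dzv => Z dzv.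
rewrite act_skew; rewrite !dzv; rewrite !act_gvar {Z dzv}.
move: (dag y) hG hGv => Y hG hGv.
rewrite -[rho (i, GF c)]/(Fo c) -[rho (i, GK c)]/(K c) !(hG, KF, actL, rhoL).
rewrite -[rho ((i, c).1, GF (i, c).2)]/(Fo c).
by lincomb F W; case: (lodd c && p); rewrite ?sgn0 ?sgn1; field; rewrite ?G0.
Qed.

Local Notation kp c d := (qpow (frm c d / 2)).
Let kp0 (c d : label k) : kp c d != 0 := qpow_neq0 iota hq _.
Let kpC (c d : label k) : kp d c = kp c d. Proof. by rewrite bformC. Qed.
Let EL c a w : E c (a *: w) = a *: E c w := linearZ_LR (E c) a w.
Let FL c a w : Fo c (a *: w) = a *: Fo c w := linearZ_LR (Fo c) a w.
Let KL c a w : K c (a *: w) = a *: K c w := linearZ_LR (K c) a w.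
Let ED c : {morph E c : u v / u + v} := linearD (E c).
Let EN c : {morph E c : u / - u} := linearN (E c).
Let FD c : {morph Fo c : u v / u + v} := linearD (Fo c).
Let FN c : {morph Fo c : u / - u} := linearN (Fo c).
Let KD c : {morph K c : u v / u + v} := linearD (K c).
Let KN c : {morph K c : u / - u} := linearN (K c).
Let KF' c d w : K c (Fo d w) = (kp c d)^-1 *: Fo d (K c w).
Proof. by rewrite KF qpowN. Qed.
Let lin := (EL, FL, KL, ED, EN, FD, FN, KD, KN).

Lemma K_Ec x c w : K x (act rho (Ec F i c) w) = kp x c *: act rho (Ec F i c) (K x w).
Proof. by rewrite !act_Ec KE (KC x). Qed.
Lemma K_Fc x c w : K x (act rho (Fc F i c) w) = (kp x c)^-1 *: act rho (Fc F i c) (K x w).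
Proof. by rewrite !act_Fc KF' (KC x). Qed.

Lemma act_serre_e1 b c w : frm b c = 0 -> act rho (ad_e iota q i b (lodd c) (Ec F i c)) w =
  serre_comm opE parf (i, b) (i, c) (K c (K b w)).
Proof.
move=> bc0; rewrite (act_ad_e (lodd c) _ (K_Ec b c)) !act_Ec KE (kpC b c) bc0 mul0r qpow0.
by rewrite mulr1 scale1r /serre_comm (KC c b).
Qed.
Lemma act_serre_f1 b c w : frm b c = 0 -> act rho (ad_f iota q i b (lodd c) (Fc F i c)) w =
  serre_comm opF parf (i, b) (i, c) (K c (K b w)).
Proof.
move=> bc0; rewrite (act_ad_f (lodd c) _ (K_Fc b c)) !act_Fc KF' (kpC b c) bc0 mul0r qpow0.
by rewrite invr1 mulr1 scale1r /serre_comm (KC c b).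
Qed.

Lemma act_serre_e2 b c w : lodd b = false -> frm b b = -2 -> frm b c = 1 ->
  act rho (ad_e iota q i b (lodd c) (ad_e iota q i b (lodd c) (Ec F i c))) w =
  serre_cubic opE s (i, b) (i, c) (K c (K b (K b w))).
Proof.
move=> b0 bb bc; have H := act_ad_e (lodd c) _ (K_Ec b c).
have kbb : kp b b = s ^- 2 by rewrite bb qhalf_neg2.
have s0 : s != 0 := qpow_neq0 iota hq _.
have H1 v : K b (act rho (ad_e iota q i b (lodd c) (Ec F i c)) v)
    = s^-1 *: act rho (ad_e iota q i b (lodd c) (Ec F i c)) (K b v).
  rewrite !H !act_Ec b0 /= !sgn0 !(KE, lin) (kpC b c) kbb bc !(KC b c).
  by lincomb F W; field; rewrite ?s0 ?oner_neq0.
rewrite (act_ad_e (lodd c) _ H1) !H !act_Ec b0 /= !sgn0 !(KE, lin) (kpC b c) kbb bc ?(KC b c) /serre_cubic.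
by lincomb F W; field; rewrite ?s0 ?oner_neq0.
Qed.
Lemma act_serre_f2 b c w : lodd b = false -> frm b b = -2 -> frm b c = 1 ->
  act rho (ad_f iota q i b (lodd c) (ad_f iota q i b (lodd c) (Fc F i c))) w =
  serre_cubic opF s (i, b) (i, c) (K c (K b (K b w))).
Proof.
move=> b0 bb bc; have H := act_ad_f (lodd c) _ (K_Fc b c).
have kbb : kp b b = s ^- 2 by rewrite bb qhalf_neg2.
have s0 : s != 0 := qpow_neq0 iota hq _.
have H1 v : K b (act rho (ad_f iota q i b (lodd c) (Fc F i c)) v)
    = s *: act rho (ad_f iota q i b (lodd c) (Fc F i c)) (K b v).
  rewrite !H !act_Fc b0 /= !sgn0 !(KF', lin) (kpC b c) kbb bc !(KC b c).
  by lincomb F W; field; rewrite ?s0 ?oner_neq0.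
rewrite (act_ad_f (lodd c) _ H1) !H !act_Fc b0 /= !sgn0 !(KF', lin) (kpC b c) kbb bc ?(KC b c) /serre_cubic.
by lincomb F W; field; rewrite ?s0 ?oner_neq0.
Qed.

(** Every nested bracket in the Yamane relations has this shape. The Cartan factors are collected on
    the right, where they are common to all terms and only cubic words remain to be compared. *)
Lemma act_qbr2 c d e p1 p2 w :
  act rho (qbr iota q i c p1 (qbr iota q i d p2 (Ec F i e))) w =
  (kp d e * kp c d * kp c e) *:
  (E c (E d (E e (K e (K d (K c w)))))
   - (sgn F (lodd d && p2) * kp d e ^+ 2) *: E c (E e (E d (K e (K d (K c w)))))
   - (sgn F (lodd c && p1) * (kp c d * kp c e) ^+ 2) *:
     (E d (E e (E c (K e (K d (K c w)))))
      - (sgn F (lodd d && p2) * kp d e ^+ 2) *: E e (E d (E c (K e (K d (K c w))))))).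
Proof.
have H := act_qbr p2 _ (K_Ec d e).
have H1 v : K c (act rho (qbr iota q i d p2 (Ec F i e)) v)
    = (kp c d * kp c e) *: act rho (qbr iota q i d p2 (Ec F i e)) (K c v).
  rewrite !H !act_Ec !(KE, lin) !(KC c).
  by lincomb F W; ring.
rewrite (act_qbr p1 _ H1) !H !act_Ec !(KE, lin) (kpC d e) (kpC c d) (kpC c e).
by lincomb F W; ring.
Qed.

Lemma act_dag_Ec c w : act rho (dag (Ec F i c)) w = (kp c c)^-1 *: Fo c (K c w).
Proof.
have := congr1 (fun z => act rho z w) (dagM (hE c) (hK c)).
rewrite andbF sgn0 scale1r !dag_gvar => D; apply: (eq_trans D).
by rewrite actM !act_gvar /=; exact: KF'.
Qed.

Lemma act_dag_qbr_fun c p (y : Utens F k N) (Y : W -> W) (G : F) w :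
  homog p y -> G != 0 -> (forall w, act rho (dag y) w = Y w) ->
  (forall w, K c (Y w) = G *: Y (K c w)) ->
  act rho (dag (qbr iota q i c p y)) w = (- ((kp c c)^-1 / G)) *:
    (Fo c (Y (K c w)) - (sgn F (lodd c && p) * G) *: Y (Fo c (K c w))).
Proof.
move=> hy G0 yY hG; rewrite -!yY -qpowN; apply: act_dag_qbr => // v.
by rewrite !yY.
Qed.

Lemma act_dag_qbr2 c d e p1 w : p1 = lodd d (+) lodd e ->
  act rho (dag (qbr iota q i c p1 (qbr iota q i d (lodd e) (Ec F i e)))) w =
  ((kp d e * kp c d * kp c e) / (kp c c * kp d d * kp e e)) *:
  (Fo c (Fo d (Fo e (K e (K d (K c w)))))
   - (sgn F (lodd d && lodd e) * kp d e ^- 2) *: Fo c (Fo e (Fo d (K e (K d (K c w)))))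
   - (sgn F (lodd c && p1) * (kp c d * kp c e) ^- 2) *:
     (Fo d (Fo e (Fo c (K e (K d (K c w)))))
      - (sgn F (lodd d && lodd e) * kp d e ^- 2) *: Fo e (Fo d (Fo c (K e (K d (K c w))))))).
Proof.
(* [Y1] and [Y2] are the conjugates of [Ec e] and of the inner bracket, written as functions; their
   commutation with K supplies the scalar G required by [act_dag_qbr_fun]. *)
move=> ->; pose Y1 v := (kp e e)^-1 *: Fo e (K e v).
have K1 v : K d (Y1 v) = (kp d e)^-1 *: Y1 (K d v).
  by rewrite /Y1 !(KF', lin) (KC d); lincomb F W; ring.
have H := fun v => act_dag_qbr_fun v (homog_Ec e) (invr_neq0 (kp0 d e)) (act_dag_Ec e) K1.
pose Y2 v := (- ((kp d d)^-1 / (kp d e)^-1)) *: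
    (Fo d (Y1 (K d v)) - (sgn F (lodd d && lodd e) * (kp d e)^-1) *: Y1 (Fo d (K d v))).
have K2 v : K c (Y2 v) = (kp c d * kp c e)^-1 *: Y2 (K c v).
  rewrite /Y2 /Y1 !(KF', lin) !(KC c).
  by lincomb F W; field; rewrite !kp0 ?oner_neq0.
have G0 : (kp c d * kp c e)^-1 != 0 by rewrite invr_neq0 // mulf_neq0.
apply: (eq_trans (act_dag_qbr_fun w (homog_qbr d (homog_Ec e)) G0 H K2)).
rewrite /Y2 /Y1 !(KF', lin) (kpC d e) (kpC c d) (kpC c e).
by lincomb F W; field; rewrite !kp0 ?oner_neq0.
Qed.

Section Yamane.
Variable u : 'I_k.-1.
Hypothesis uk : (u.+2 = k)%N.
Let us : kp (Lmu u) Ls = s. Proof. by rewrite -(slot_form_same R i) kap_us. Qed.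
Let ut : kp (Lmu u) Lt = s. Proof. by rewrite -(slot_form_same R i) kap_ut. Qed.
Let st : kp (Ls : label k) Lt = s ^- 2. Proof. by rewrite -(slot_form_same R i) kap_st. Qed.
Let uu : kp (Lmu u) (Lmu u) = s ^- 2. Proof. by rewrite alpha_even_sq // qhalf_neg2. Qed.
Let ss : kp (Ls : label k) Ls = 1. Proof. by rewrite alpha_odd_sq // qhalf0. Qed.
Let tt : kp (Lt : label k) Lt = 1. Proof. by rewrite alpha_odd_sq // qhalf0. Qed.
Let su : kp Ls (Lmu u) = s. Proof. by rewrite kpC us. Qed.
Let tu : kp Lt (Lmu u) = s. Proof. by rewrite kpC ut. Qed.
Let ts : kp (Lt : label k) Ls = s ^- 2. Proof. by rewrite kpC st. Qed.
Let s0 : s != 0 := qpow_neq0 iota hq _.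
Let KCs := (KC Ls (Lmu u), KC Lt (Lmu u), KC Lt Ls).
Let kk := (us, ut, st, uu, ss, tt, su, tu, ts).
Local Notation Kw w := (K (Lmu u) (K Ls (K Lt w))).
Local Notation YE := (serre_yamane opE s (i, Lmu u) (i, Ls) (i, Lt)).
Local Notation YF := (serre_yamane opF s (i, Lmu u) (i, Ls) (i, Lt)).

Lemma act_yamane1 w : act rho (yamane1 iota q i u) w = YE (Kw w).
Proof.
apply: (eq_trans (act_subZ _ _ _ w)).
apply: (eq_trans (congr2 (fun v1 v2 => v1 - (iota q + (iota q)^-1) *: v2)
  (act_qbr2 (Lmu u) Ls Lt false true w)
  (act_qbr2 Ls (Lmu u) Lt true true w))).
rewrite /= !KCs !kk !sgn0 !sgn1 -(qhalf_sq iota hq) /serre_yamane.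
by lincomb F W; field; rewrite ?s0 ?oner_neq0.
Qed.
Lemma act_yamane2 w : act rho (yamane2 iota q i u) w = - YE (Kw w).
Proof.
apply: (eq_trans (act_subZ _ _ _ w)).
apply: (eq_trans (congr2 (fun v1 v2 => v1 - (iota q + (iota q)^-1) *: v2)
  (act_qbr2 (Lmu u) Lt Ls false true w)
  (act_qbr2 Lt (Lmu u) Ls true true w))).
rewrite /= !KCs !kk !sgn0 !sgn1 -(qhalf_sq iota hq) /serre_yamane.
by lincomb F W; field; rewrite ?s0 ?oner_neq0.
Qed.
Lemma act_yamane3 w : act rho (yamane3 iota q i u) w = YE (Kw w).
Proof.
apply: (eq_trans (actB rho _ _ w)).
apply: (eq_trans (congr2 (fun v1 v2 => v1 - v2)
  (act_qbr2 Ls Lt (Lmu u) true false w)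
  (act_qbr2 Lt Ls (Lmu u) true false w))).
rewrite /= !KCs !kk !sgn0 !sgn1 /serre_yamane.
by lincomb F W; field; rewrite ?s0 ?oner_neq0.
Qed.
Lemma act_dag_yamane1 w : act rho (dag (yamane1 iota q i u)) w = s ^+ 2 *: YF (Kw w).
Proof.
apply: (eq_trans (act_dag_subZ _ _ _ w)).
apply: (eq_trans (congr2 (fun v1 v2 => v1 - (iota q + (iota q)^-1) *: v2)
  (@act_dag_qbr2 (Lmu u) Ls Lt false w erefl)
  (@act_dag_qbr2 Ls (Lmu u) Lt true w erefl))).
rewrite /= !KCs !kk !sgn0 !sgn1 -(qhalf_sq iota hq) /serre_yamane.
by lincomb F W; field; rewrite ?s0 ?oner_neq0.
Qed.
Lemma act_dag_yamane2 w : act rho (dag (yamane2 iota q i u)) w = - (s ^+ 2 *: YF (Kw w)).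
Proof.
apply: (eq_trans (act_dag_subZ _ _ _ w)).
apply: (eq_trans (congr2 (fun v1 v2 => v1 - (iota q + (iota q)^-1) *: v2)
  (@act_dag_qbr2 (Lmu u) Lt Ls false w erefl)
  (@act_dag_qbr2 Lt (Lmu u) Ls true w erefl))).
rewrite /= !KCs !kk !sgn0 !sgn1 -(qhalf_sq iota hq) /serre_yamane.
by lincomb F W; field; rewrite ?s0 ?oner_neq0.
Qed.
Lemma act_dag_yamane3 w : act rho (dag (yamane3 iota q i u)) w = s ^+ 2 *: YF (Kw w).
Proof.
apply: (eq_trans (act_dag_sub _ _ w)).
apply: (eq_trans (congr2 (fun v1 v2 => v1 - v2)
  (@act_dag_qbr2 Ls Lt (Lmu u) true w erefl)
  (@act_dag_qbr2 Lt Ls (Lmu u) true w erefl))).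
rewrite /= !KCs !kk !sgn0 !sgn1 /serre_yamane.
by lincomb F W; field; rewrite ?s0 ?oner_neq0.
Qed.
End Yamane.

End Slot.
End RelI.

Section RelIAct.
Variables (R : realType) (F : fieldType) (iota : {rmorphism R -> F}).
Variables (k : nat) (q : R).
Hypotheses (hk : (0 < k)%N) (hq : 0 < q) (hq1 : q != 1).
Variables (N : nat) (W : lmodType F) (rho : 'I_N * gen k -> {linear W -> W}).
Local Notation J := ('I_N * label k)%type.
Local Notation qpow := (qpow iota q).
Hypothesis pm : premodule iota q rho.

Variable Z : W -> Prop.
Hypothesis ZP : forall a u v, Z u -> Z v -> Z (a *: u + v).
Hypothesis Z0 : Z 0.
Hypothesis Zrho : forall g u, Z u -> Z (rho g u).
Hypotheses (ZE : serre_in iota q Z (opE rho)) (ZF : serre_in iota q Z (opF rho)).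

Lemma stable_scale a u : Z u -> Z (a *: u).
Proof. by move=> Zu; rewrite -[_ *: _]addr0; apply: ZP. Qed.

Lemma even_form (b c : label k) : lodd b = false -> b <> c ->
  exists t : bool, bform (alpha R b) (alpha R c) = t%:R.
Proof.
case: b => // b _ bc; case: c bc => [c||] bc; last 2 first.
- by exists (b.+2 == k); rewrite alpha_even_odd.
- by exists (b.+2 == k); rewrite alpha_even_odd.
have nbc : b != c by apply/eqP => e; apply: bc; rewrite e.
by eexists; apply: alpha_even_even.
Qed.

Lemma even_of_form (b : label k) : bform (alpha R b) (alpha R b) != 0 -> lodd b = false.
Proof. by case: b => // /eqP; case; rewrite alpha_odd_sq. Qed.

(** As (alpha_b, alpha_b) = -2, the exponent is 1 + (alpha_b, alpha_c), and the inner product is 0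
    or 1. So only the commutation and the cubic relation occur. *)
Lemma serre_exponent (b c : label k) (m : nat) : b <> c ->
  bform (alpha R b) (alpha R b) != 0 ->
  m%:R = 1 - 2 * bform (alpha R b) (alpha R c) / bform (alpha R b) (alpha R b) ->
  [/\ lodd b = false, bform (alpha R b) (alpha R b) = -2 &
    (m = 1%N /\ bform (alpha R b) (alpha R c) = 0) \/
    (m = 2%N /\ bform (alpha R b) (alpha R c) = 1)].
Proof.
move=> bc /even_of_form eb; have [t et] := even_form eb bc.
have bb : bform (alpha R b) (alpha R b) = -2 by case: b eb {bc et} => // b _; apply: alpha_even_sq.
rewrite bb et => em; split => //.
have {}em : m%:R = (t.+1)%:R :> R by rewrite em -natr1; field.
move/eqP: em; rewrite eqr_nat => /eqP ->.
by case: t {et}; [right | left].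
Qed.

Section Expand.
Implicit Types (a b c d x y : Utens F k N) (t : F) (w : W).
Lemma act_mulB1 a b w : act rho (a * b - 1) w = act rho a (act rho b w) - w.
Proof. by rewrite actB; congr (_ - _); [rewrite actM | rewrite act1]. Qed.
Lemma act_mulB a b c d w : act rho (a * b - c * d) w =
  act rho a (act rho b w) - act rho c (act rho d w).
Proof. by rewrite actB; congr (_ - _); rewrite actM. Qed.
Lemma act_mulBZ t a b c d w : act rho (a * b - t *: (c * d)) w =
  act rho a (act rho b w) - t *: act rho c (act rho d w).
Proof. by rewrite act_subZ; congr (_ - _ *: _); rewrite actM. Qed.
Lemma act_mulBBZ t a b c d x w : act rho (a * b - c * d - t *: x) w =
  act rho a (act rho b w) - act rho c (act rho d w) - t *: act rho x w.
Proof. by rewrite act_subZ act_mulB. Qed.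
Lemma act_mulBDZ t a b c d x w : act rho (a * b - c * d + t *: x) w =
  act rho a (act rho b w) - act rho c (act rho d w) + t *: act rho x w.
Proof. by rewrite actD act_mulB; congr (_ + _); rewrite actZ. Qed.
Lemma act_scommBZ p1 p2 t a b x y w :
  act rho (scomm p1 p2 a b - t *: (x ^+ 2 - y ^+ 2)) w =
  act rho a (act rho b w) - sgn F (p1 && p2) *: act rho b (act rho a w)
  - t *: (act rho x (act rho x w) - act rho y (act rho y w)).
Proof. by rewrite act_subZ; congr (_ - _ *: _); [rewrite /scomm act_mulBZ | rewrite !expr2 act_mulB]. Qed.
End Expand.

Lemma slot_rel_act i x : slot_rel iota q i x -> forall w, Z (act rho x w).
Proof.
have e0 u v : u = v -> Z (u - v) by move=> ->; rewrite subrr.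
case=> [a|a|a b|a b|a b|a b|a b|a b|a b|a b|a aa|a aa|b c m bc bb em|b c m bc bb em|||||| ] => [||||||||||||||u uk|u uk|u uk|u uk|u uk|u uk] w.
- by rewrite act_mulB1 !act_gvar; apply: e0; apply: (pm_KKv pm (i, a)).
- by rewrite act_mulB1 !act_gvar; apply: e0; apply: (pm_KvK pm (i, a)).
- by rewrite act_mulB !act_gvar; apply: e0; apply: (pm_KK pm (i, a) (i, b)).
- by rewrite act_mulB !act_gvar; apply: e0; apply: (pm_hK pm (i, a) (i, b)).
- by rewrite act_mulB !act_gvar; apply: e0; apply: (pm_hh pm (i, a) (i, b)).
- rewrite act_mulBBZ !act_gvar -addrA -opprD; apply: e0.
  by have := pm_he pm (i, a) (i, b) w; rewrite slot_form_same.
- rewrite act_mulBDZ !act_gvar -addrA -[X in _ + X]opprK opprD opprK; apply: e0.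
  by have := pm_hf pm (i, a) (i, b) w; rewrite slot_form_same.
- rewrite act_mulBZ !act_gvar; apply: e0.
  by have := pm_Ke pm (i, a) (i, b) w; rewrite slot_form_same.
- rewrite act_mulBZ !act_gvar; apply: e0.
  by have := pm_Kf pm (i, a) (i, b) w; rewrite slot_form_same.
- rewrite act_scommBZ !act_gvar -addrA -opprD; apply: e0.
  by have := pm_ef pm (i, a) (i, b) w; rewrite xpair_eqE eqxx.
- rewrite /scomm act_mulBZ !act_gvar -[X in X - _]scale1r -scalerBl; apply: stable_scale.
  have [_ H _ _] := ZE; apply: (H (i, a)) => /=.
  by apply: contraT => /negbTE ea; case: a aa ea => // a; rewrite alpha_even_sq // => /eqP; rewrite oppr_eq0 pnatr_eq0.
- rewrite /scomm act_mulBZ !act_gvar -[X in X - _]scale1r -scalerBl; apply: stable_scale.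
  have [_ H _ _] := ZF; apply: (H (i, a)) => /=.
  by apply: contraT => /negbTE ea; case: a aa ea => // a; rewrite alpha_even_sq // => /eqP; rewrite oppr_eq0 pnatr_eq0.
- have [eb b2 [[-> bc0]|[-> bc1]]] := serre_exponent bc bb em; have [H1 _ H2 _] := ZE.
    rewrite /= (act_serre_e1 hq pm) //; apply: H1; rewrite ?slot_form_same //.
    by rewrite xpair_eqE eqxx; apply/eqP.
  rewrite /= (act_serre_e2 hq pm) //; apply: H2; rewrite ?slot_form_same //.
  by rewrite xpair_eqE eqxx; apply/eqP.
- have [eb b2 [[-> bc0]|[-> bc1]]] := serre_exponent bc bb em; have [H1 _ H2 _] := ZF.
    rewrite /= (act_serre_f1 hq pm) //; apply: H1; rewrite ?slot_form_same //.
    by rewrite xpair_eqE eqxx; apply/eqP.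
  rewrite /= (act_serre_f2 hq pm) //; apply: H2; rewrite ?slot_form_same //.
  by rewrite xpair_eqE eqxx; apply/eqP.
- by rewrite (act_yamane1 hk hq pm i uk); have [_ _ _ H] := ZE; apply: H.
- rewrite (act_yamane2 hk hq pm i uk) -scaleN1r; apply: stable_scale.
  by have [_ _ _ H] := ZE; apply: H.
- by rewrite (act_yamane3 hk hq pm i uk); have [_ _ _ H] := ZE; apply: H.
- rewrite (act_dag_yamane1 hk hq pm i uk); apply: stable_scale.
  by have [_ _ _ H] := ZF; apply: H.
- rewrite (act_dag_yamane2 hk hq pm i uk) -scaleN1r; do 2 apply: stable_scale.
  by have [_ _ _ H] := ZF; apply: H.
- rewrite (act_dag_yamane3 hk hq pm i uk); apply: stable_scale.
  by have [_ _ _ H] := ZF; apply: H.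
Qed.

(** Distinct slots are orthogonal for [slot_form], so each of the 25 pairs of generator kinds is an
    instance of a premodule relation or of the first Serre clause. *)
Lemma cross_rel_act x : cross_rel x -> forall w, Z (act rho x w).
Proof.
case=> i [j [x1 [x2 [ij ->]]]] w; rewrite /scomm act_mulBZ !act_gvar.
have ji := ij; rewrite eq_sym in ji.
have f0 (c d : label k) : slot_form R (i, c) (j, d) = 0 by rewrite /slot_form /= (negPf ij).
have f0' (c d : label k) : slot_form R (j, c) (i, d) = 0 by rewrite /slot_form /= (negPf ji).
have ne (c d : label k) : (i, c) != (j, d) by rewrite xpair_eqE (negPf ij).
have ne' (c d : label k) : (j, c) != (i, d) by rewrite xpair_eqE (negPf ji).
have e0 u v : u = v -> Z (u - v) by move=> ->; rewrite subrr.
have q0 : qpow (0 / 2) = 1 by rewrite mul0r qpow0.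
have q0' : qpow (- (0 / 2)) = 1 by rewrite mul0r oppr0 qpow0.
have i0 : iota 0 = 0 by rewrite rmorph0.
case: x1 x2 => c [] d; rewrite /= ?andbF ?sgn0 ?scale1r.
- by have [H _ _ _] := ZE; apply: (H (i, c) (j, d)).
- apply: e0; have := pm_ef pm (i, c) (j, d) w.
  by rewrite (negPf (ne c d)) mul0r scale0r addr0.
- apply: e0; have := pm_he pm (j, d) (i, c) w.
  by rewrite f0' i0 scale0r addr0.
- apply: e0; have := pm_Ke pm (j, d) (i, c) w.
  by rewrite f0' q0 scale1r.
- apply: e0; have := pm_Kve hq pm (j, d) (i, c) w.
  by rewrite f0' q0' scale1r.
- apply: e0; have := pm_fe pm (i, c) (j, d) w.
  by rewrite (negPf (ne c d)) mul0r scale0r subr0.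
- by have [H _ _ _] := ZF; apply: (H (i, c) (j, d)).
- apply: e0; have := pm_hf pm (j, d) (i, c) w.
  by rewrite f0' i0 scale0r subr0.
- apply: e0; have := pm_Kf pm (j, d) (i, c) w.
  by rewrite f0' q0' scale1r.
- apply: e0; have := pm_Kvf hq pm (j, d) (i, c) w.
  by rewrite f0' q0 scale1r.
- apply: e0; have := pm_he pm (i, c) (j, d) w.
  by rewrite f0 i0 scale0r addr0.
- apply: e0; have := pm_hf pm (i, c) (j, d) w.
  by rewrite f0 i0 scale0r subr0.
- by apply: e0; apply: (pm_hh pm (i, c) (j, d)).
- by apply: e0; apply: (pm_hK pm (i, c) (j, d)).
- by apply: e0; apply: (pm_hKv pm (i, c) (j, d)).
- apply: e0; have := pm_Ke pm (i, c) (j, d) w.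
  by rewrite f0 q0 scale1r.
- apply: e0; have := pm_Kf pm (i, c) (j, d) w.
  by rewrite f0 q0' scale1r.
- by apply: e0; apply/esym; apply: (pm_hK pm (j, d) (i, c)).
- by apply: e0; apply: (pm_KK pm (i, c) (j, d)).
- by apply: e0; apply: (pm_KKvC pm (i, c) (j, d)).
- apply: e0; have := pm_Kve hq pm (i, c) (j, d) w.
  by rewrite f0 q0' scale1r.
- apply: e0; have := pm_Kvf hq pm (i, c) (j, d) w.
  by rewrite f0 q0 scale1r.
- by apply: e0; apply/esym; apply: (pm_hKv pm (j, d) (i, c)).
- by apply: e0; apply/esym; apply: (pm_KKvC pm (j, d) (i, c)).
- by apply: e0; apply: (pm_KvKv pm (i, c) (j, d)).
Qed.

(** The stable subspace Z allows one proof for both uses: Z = 0 for V (x) V, and Z the radical for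
    Verma modules. *)
Lemma relI_act x : relI iota q x -> forall w, Z (act rho x w).
Proof.
apply: (@smallest_sub _ _ _ [set x | forall w, Z (act rho x w)]) => [|{}x [[i hx]|hx]] /=.
- split=> [|a y hy w /=]; last by rewrite actM.
  split=> [w|y z hy hz w|a y hy w] /=.
  + by rewrite act0.
  + by rewrite actD -[act _ y _]scale1r; apply: ZP.
  + by rewrite actM; apply: act_stable.
- exact: slot_rel_act hx.
- exact: cross_rel_act hx.
Qed.

End RelIAct.

(** * Verma modules *)

Section SerreLinear.
Variables (F : fieldType) (W : lmodType F) (J : eqType) (E : J -> {linear W -> W}).
Variables (p : J -> bool) (s : F).
Let ED c : {morph E c : u v / u + v} := linearD (E c).
Let EL c a w : E c (a *: w) = a *: E c w := linearZ_LR (E c) a w.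
Lemma serre_comm_linear a b : linear (serre_comm E p a b).
Proof. by move=> t u v; rewrite /serre_comm !(ED, EL); lincomb F W; ring. Qed.
Lemma serre_sq_linear a : linear (fun w => E a (E a w)).
Proof. by move=> t u v; rewrite !(ED, EL). Qed.
Lemma serre_cubic_linear a b : linear (serre_cubic E s a b).
Proof. by move=> t u v; rewrite /serre_cubic !(ED, EL); lincomb F W; ring. Qed.
Lemma serre_yamane_linear a b c : linear (serre_yamane E s a b c).
Proof. by move=> t u v; rewrite /serre_yamane !(ED, EL); lincomb F W; ring. Qed.
End SerreLinear.

(** Each Serre element, viewed as an operator S, kills v and commutes with all [G j] up to nonzero
    scalars. The last hypothesis is where a particular module says how it is generated from v by the
    operators [G j]. *)
Lemma serre_in_generated (R : realType) (F : fieldType) (iota : {rmorphism R -> F})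
    (k : nat) (q : R) (N : nat) (W : lmodType F) (Z : W -> Prop) (v : W)
    (E G : 'I_N * label k -> {linear W -> W}) :
  (forall x y j w, x != y -> slot_form R x y = 0 ->
     G j (serre_comm E (fun x => lodd x.2) x y w)
     = sgn F (lodd j.2 && (lodd x.2 (+) lodd y.2)) *: serre_comm E (fun x => lodd x.2) x y (G j w)) ->
  (forall x j w, lodd x.2 -> G j (E x (E x w)) = E x (E x (G j w))) ->
  (forall x y j w, x != y -> lodd x.2 = false -> slot_form R x x = -2 -> slot_form R x y = 1 ->
     G j (serre_cubic E (qpow iota q (1 / 2)) x y w)
     = sgn F (lodd j.2 && lodd y.2) *: serre_cubic E (qpow iota q (1 / 2)) x y (G j w)) ->
  (forall i (u : 'I_k.-1) j w, (u.+2 = k)%N ->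
     G j (serre_yamane E (qpow iota q (1 / 2)) (i, Lmu u) (i, Ls) (i, Lt) w)
     = serre_yamane E (qpow iota q (1 / 2)) (i, Lmu u) (i, Ls) (i, Lt) (G j w)) ->
  (forall x, E x v = 0) ->
  (forall S : W -> W, linear S -> S v = 0 ->
     (forall j, exists2 a : F, a != 0 & forall w, G j (S w) = a *: S (G j w)) -> forall w, Z (S w)) ->
  serre_in iota q Z E.
Proof.
move=> Hcomm Hsq Hcubic Hyam Ev fin.
have sg0 b : sgn F b != 0 by rewrite signr_eq0.
have n1 : 1 != 0 :> F := oner_neq0 F.
split=> [x y w xy xy0|x w px|x y w xy px e1 xx xy1|i u w uk].
- apply: (fin _ (serre_comm_linear E _ x y)) => [|j].
    by rewrite /serre_comm !(Ev, linear0, scaler0, subr0).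
  by eexists; [apply: sg0 | move=> u; apply: Hcomm].
- apply: (fin _ (serre_sq_linear E x)) => [|j]; first by rewrite !Ev linear0.
  by exists 1 => // u; rewrite Hsq // scale1r.
- apply: (fin _ (serre_cubic_linear E _ x y)) => [|j].
    by rewrite /serre_cubic !(Ev, linear0, scaler0, subr0, addr0).
  by eexists; [apply: sg0 | move=> u; apply: Hcubic].
- apply: (fin _ (serre_yamane_linear E _ _ _ _)) => [|j].
    by rewrite /serre_yamane !(Ev, linear0, scaler0, subr0, addr0).
  by exists 1 => // t; rewrite Hyam // scale1r.
Qed.

(** * Vectors that detect the neighbourhoods [nbI] *)

Section NbI.
Variables (R : realType) (F : fieldType) (iota : {rmorphism R -> F}).
Variables (k : nat) (q : R) (N : nat) (W : lmodType F).
Variable rho : 'I_N * gen k -> {linear W -> W}.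
Variable Z : W -> Prop.
Hypothesis ZP : forall a u v, Z u -> Z v -> Z (a *: u + v).
Hypothesis Z0 : Z 0.
Hypothesis Zrho : forall g u, Z u -> Z (rho g u).
Hypothesis relIZ : forall x, relI iota q x -> forall w, Z (act rho x w).

(** The elements that send v into Z form a left ideal, and the hypotheses on v put the generators of
    [nbI lam M] into it. *)
Lemma nbI_act (lam : 'I_N -> weight R k) M v x :
  (forall i c, rho (i, GH c) v = iota (bform (lam i) (alpha R c)) *: v) ->
  (forall i c, rho (i, GK c) v = qpow iota q (bform (lam i) (alpha R c) / 2) *: v) ->
  (forall i s, size s = M -> foldr (fun c => rho (i, GE c)) v s = 0) ->
  nbI iota q lam M x -> Z (act rho x v).
Proof.
move=> hv Kv ev.
apply: (@smallest_sub _ _ _ [set x | Z (act rho x v)]) => [|{}x [[hx|]|]] /=.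
- split=> [|y z hy hz|a y hy] /=.
  + by rewrite act0.
  + by rewrite actD -[act _ y _]scale1r; apply: ZP.
  + by rewrite actM; apply: act_stable.
- exact: relIZ.
- case=> i [c [->|->]]; rewrite actB actZ act1 act_gvar.
  + by rewrite hv subrr; apply: Z0.
  + by rewrite Kv subrr; apply: Z0.
- case=> i [s [ss ->]]; suff -> : act rho (\prod_(c <- s) gvar F i (GE c)) v
      = foldr (fun c => rho (i, GE c)) v s by rewrite ev.
  elim: s {ss} => [|c s IH] /=; first by rewrite big_nil act1.
  by rewrite big_cons actM IH act_gvar.
Qed.
End NbI.

Section Verma.
Variables (R : realType) (F : fieldType) (iota : {rmorphism R -> F}).
Variables (k : nat) (q : R).
Hypotheses (hk : (0 < k)%N) (hq : 0 < q) (hq1 : q != 1).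
Variables (N : nat) (lam : 'I_N -> weight R k).
Local Notation J := ('I_N * label k)%type.
Local Notation qpow := (qpow iota q).
Local Notation slot_form := (@slot_form R k N).
Local Notation par x := (lodd x.2).

(* A function on words in the labels is read as a formal, possibly infinite,
   combination of the vectors f_x1 ... f_xm v, with v of weight [lam]. *)
Definition verma := (seq J -> F^o).

(** The eigenvalue of h_x on f_s v; [qint_at] is its q-integer, by which [e_x, f_x] acts on f_s
    v. *)
Definition wt_at (x : J) (s : seq J) : R :=
  bform (lam x.1) (alpha R x.2) - \sum_(y <- s) slot_form x y.
Definition qint_at x s : F := (qpow (wt_at x s) - qpow (- wt_at x s)) / (iota q - (iota q)^-1).

Definition verma_f x (phi : verma) : verma :=
  fun s => if s is y :: t then (if y == x then phi t else 0) else 0.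
Definition verma_diag (m : seq J -> F) (phi : verma) : verma := fun s => m s * phi s.
(** The words t for which e_x f_t v contains f_s v arise from s by inserting x. If x is inserted at
    the front, the commutator contributes a q-integer; if further inside, e_x first passes the
    letters before it, with their signs. *)
Fixpoint verma_e x (phi : seq J -> F) s : F :=
  qint_at x s * phi (x :: s) +
  (if s is y :: t then sgn F (par x && par y) * verma_e x (fun t => phi (y :: t)) t else 0).

Definition verma_act (g : 'I_N * gen k) : verma -> verma :=
  match g.2 with
  | GE c => verma_e (g.1, c)
  | GF c => verma_f (g.1, c)
  | GH c => verma_diag (fun s => iota (wt_at (g.1, c) s))
  | GK c => verma_diag (fun s => qpow (wt_at (g.1, c) s / 2))
  | GKv c => verma_diag (fun s => qpow (- (wt_at (g.1, c) s / 2)))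
  end.

Lemma verma_e_linear x a (phi psi : verma) s :
  verma_e x (a *: phi + psi) s = a * verma_e x phi s + verma_e x psi s.
Proof.
elim: s phi psi => [|y s IH] phi psi /=.
  by rewrite -[(a *: phi + psi) _]/(a * phi _ + psi _); ring.
rewrite -[(a *: phi + psi) _]/(a * phi _ + psi _).
have -> : (fun t => (a *: phi + psi) (y :: t))
  = a *: ((fun t => phi (y :: t)) : verma) + ((fun t => psi (y :: t)) : verma) by [].
by rewrite IH; ring.
Qed.

Lemma verma_act_linear g : linear (verma_act g).
Proof.
case: g => i [] c a phi psi; apply/funext => s; rewrite /verma_act /=.
- exact: verma_e_linear.
- rewrite /verma_f -[(a *: _ + _) s]/(a * _ + _).
  by case: s => [|y s]; rewrite ?mulr0 ?addr0 //; case: eqP; rewrite ?mulr0 ?addr0.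
- by rewrite -[(a *: _ + _) s]/(a * _ + _) /verma_diag -[(a *: _ + _) s]/(a * _ + _); ring.
- by rewrite -[(a *: _ + _) s]/(a * _ + _) /verma_diag -[(a *: _ + _) s]/(a * _ + _); ring.
- by rewrite -[(a *: _ + _) s]/(a * _ + _) /verma_diag -[(a *: _ + _) s]/(a * _ + _); ring.
Qed.
HB.instance Definition _ g :=
  GRing.isLinear.Build F verma verma _ (verma_act g) (verma_act_linear g).
Definition verma_rho g : {linear verma -> verma} := verma_act g.

Lemma verma_e0 x (phi : seq J -> F) s : (forall t, phi t = 0) -> verma_e x phi s = 0.
Proof.
elim: s phi => [|y s IH] phi h /=; rewrite h mulr0 ?addr0 // add0r.
by rewrite IH ?mulr0.
Qed.

Lemma wt_at_cons x y s : wt_at x (y :: s) = wt_at x s - slot_form x y.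
Proof. by rewrite /wt_at big_cons opprD addrA addrAC. Qed.
Lemma wt_at_insert x y s t : wt_at x (s ++ y :: t) = wt_at x (s ++ t) - slot_form x y.
Proof.
elim: s => [|z s IH]; first exact: wt_at_cons.
by rewrite !cat_cons !wt_at_cons IH addrAC.
Qed.

Lemma verma_e_diag x (m m' : seq J -> F) (phi : seq J -> F) s :
  (forall s t, m (s ++ x :: t) = m' (s ++ t)) ->
  verma_e x (fun t => m t * phi t) s = m' s * verma_e x phi s.
Proof.
elim: s m m' phi => [|y s IH] m m' phi h /=.
  by rewrite (h [::] [::]); ring.
rewrite (h [::]) (IH (fun t => m (y :: t)) (fun t => m' (y :: t))) => [|s1 t1].
  by rewrite /=; ring.
exact: (h (y :: s1)).
Qed.

Lemma verma_premodule : premodule iota q verma_rho.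
Proof.
have qK a u : qpow a * (qpow (- a) * u) = u by rewrite mulrA -(qpowD _ hq) addrN qpow0 mul1r.
have qK' a u : qpow (- a) * (qpow a * u) = u by rewrite mulrA -(qpowD _ hq) addNr qpow0 mul1r.
split=> [[i c] w|[i c] w|[i c] [j d] w|[i c] [j d] w|[i c] [j d] w|[i c] [j d] w
  |[i c] [j d] w|[i c] [j d] w|[i c] [j d] w|[i c] [j d] w]; apply/funext => s;
  rewrite [LHS]/= /verma_diag /verma_act /=.
- exact: qK.
- exact: qK'.
- exact: mulrCA.
- exact: mulrCA.
- exact: mulrCA.
- change (iota (wt_at (i, c) s) * verma_e (j, d) w s =
    verma_e (j, d) (fun s => iota (wt_at (i, c) s) * w s) s
    + iota (slot_form (i, c) (j, d)) * verma_e (j, d) w s).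
  rewrite (@verma_e_diag _ _ (fun s => iota (wt_at (i, c) s - slot_form (i, c) (j, d)))).
    by rewrite /= [X in X * _ + _]rmorphB mulrBl subrK.
  by move=> s1 t1; rewrite -wt_at_insert.
- change (iota (wt_at (i, c) s) * verma_f (j, d) w s =
    verma_f (j, d) (fun s => iota (wt_at (i, c) s) * w s) s
    - iota (slot_form (i, c) (j, d)) * verma_f (j, d) w s).
  case: s => [|z s] /=; first by rewrite !mulr0 subr0.
  case: eqP => [->|_]; last by rewrite !mulr0 subr0.
  by rewrite wt_at_cons rmorphB mulrBl.
- change (qpow (wt_at (i, c) s / 2) * verma_e (j, d) w s = qpow (slot_form (i, c) (j, d) / 2) *
    verma_e (j, d) (fun s => qpow (wt_at (i, c) s / 2) * w s) s).
  rewrite (@verma_e_diag _ _ (fun s => qpow ((wt_at (i, c) s - slot_form (i, c) (j, d)) / 2))).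
    by rewrite mulrA -(qpowD _ hq); congr (qpow _ * _); field.
  by move=> s1 t1; rewrite -wt_at_insert.
- change (qpow (wt_at (i, c) s / 2) * verma_f (j, d) w s = qpow (- (slot_form (i, c) (j, d) / 2)) *
    verma_f (j, d) (fun s => qpow (wt_at (i, c) s / 2) * w s) s).
  case: s => [|z s] /=; first by rewrite !mulr0.
  case: eqP => [->|_]; last by rewrite !mulr0.
  by rewrite wt_at_cons mulrA -(qpowD _ hq); congr (qpow _ * _); field.
- change (verma_e (i, c) (verma_f (j, d) w) s =
    sgn F (lodd c && lodd d) * verma_f (j, d) (verma_e (i, c) w) s
    + ((i, c) == (j, d))%:R / (iota q - (iota q)^-1) *
      (qpow (wt_at (i, c) s / 2) * (qpow (wt_at (i, c) s / 2) * w s)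
       - qpow (- (wt_at (i, c) s / 2)) * (qpow (- (wt_at (i, c) s / 2)) * w s))).
  rewrite !mulrA -!(qpowD _ hq) -opprD -splitr -mulrBl.
  have -> : verma_e (i, c) (verma_f (j, d) w) s =
      qint_at (i, c) s * (if (i, c) == (j, d) then w s else 0)
      + sgn F (lodd c && lodd d) * verma_f (j, d) (verma_e (i, c) w) s.
    case: s => [|z s] /=; first by rewrite mulr0.
    case: (z =P (j, d)) => [->|_] /=; first by [].
    by rewrite verma_e0 ?mulr0.
  rewrite addrC /qint_at; case: eqP => _; last by rewrite !mul0r mulr0.
  by rewrite mul1r; ring.
Qed.

Definition verma_top : verma := fun s => if s is [::] then 1 else 0.

(* The radical: combinations annihilated, at the top weight, by all words in the
   raising generators. *)
Definition verma_rad (phi : verma) : Prop :=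
  forall w : seq J, foldr (fun x => opE verma_rho x) phi w [::] = 0.

Lemma verma_sumE (I : finType) (g : I -> verma) s :
  (\sum_i g i) s = \sum_i (g i s : F).
Proof. by apply: (big_ind2 (fun (u : verma) (v : F) => u s = v)) => // u1 v1 u2 v2 <- <-. Qed.

(** A nonempty word begins with one of finitely many letters, so a finite sum of images of the f_x,
    plus a multiple of the top vector, gives even an infinite combination. *)
Lemma verma_sum (phi : verma) : phi = (phi [::] : F) *: verma_top +
  \sum_(i : 'I_N) \sum_(b : 'I_k.-1 + bool)
     opF verma_rho (i, label_dec b) (fun s => phi ((i, label_dec b) :: s)).
Proof.
apply/funext => s; rewrite -[RHS]/(_ * _ + _) verma_sumE.
under [X in _ = _ + X]eq_bigr do rewrite verma_sumE.
case: s => [|[i c] s] /=; first by rewrite mulr1 big1 ?addr0 // => i _; rewrite big1.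
rewrite mulr0 add0r (bigD1 i) //= (bigD1 (label_enc c)) //= label_encK.
rewrite [X in _ = X + _ + _](_ : _ = phi ((i, c) :: s)); last first.
  by rewrite /opF /= /verma_act /= eqxx.
rewrite !big1 ?addr0 // => [j ji|b bc].
  rewrite big1 // => b _; rewrite /opF /= /verma_act /= xpair_eqE eq_sym.
  by rewrite (negPf ji).
rewrite /opF /= /verma_act /= xpair_eqE eqxx /=; case: eqP => // e.
case/eqP: bc; rewrite e; case: b {e} => [?|[]] //.
Qed.

(** As phi may have infinite support, the induction is on the word at which [S phi] is read: f_x
    removes the first letter of that word. *)
Lemma verma_serre_zero (S : verma -> verma) : linear S -> S verma_top = 0 ->
  (forall x, exists a : F, forall phi, S (opF verma_rho x phi) = a *: opF verma_rho x (S phi)) ->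
  forall phi, S phi = 0.
Proof.
move=> Sl S0 SF phi; apply/funext => s.
pose Sh : {linear verma -> verma} :=
  HB.pack S (GRing.isLinear.Build F verma verma _ S Sl).
have St psi : S psi = \sum_(i : 'I_N) \sum_(b : 'I_k.-1 + bool)
    S (opF verma_rho (i, label_dec b) (fun s => psi ((i, label_dec b) :: s))).
  rewrite -[S psi]/(Sh psi) [in LHS](verma_sum psi) linearD linearZ_LR.
  rewrite -[Sh verma_top]/(S verma_top) S0 scaler0 add0r linear_sum.
  by apply: eq_bigr => i _; rewrite linear_sum.
elim: s phi => [|y s IH] phi; rewrite St verma_sumE big1 // => i _; rewrite verma_sumE big1 // => b _;
  have [a ->] := SF (i, label_dec b).
  exact: mulr0.
rewrite -[LHS]/(a * (if _ then S _ s else 0)) IH.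
by case: ifP; rewrite mulr0.
Qed.

Lemma verma_E_top x : opE verma_rho x verma_top = 0.
Proof.
case: x => i c; apply/funext => s; rewrite -[LHS]/(verma_e (i, c) verma_top s).
by case: s => [|y s] /=; rewrite ?mulr0 ?addr0 // verma_e0 ?mulr0 ?addr0.
Qed.

Local Notation Ew := (foldr (fun x => opE verma_rho x)).

Lemma verma_Ew_linear w a u v : Ew (a *: u + v) w = a *: Ew u w + Ew v w.
Proof. by elim: w => //= x w ->; rewrite linearP. Qed.

Lemma verma_rad_nil u : verma_rad u -> u [::] = 0.
Proof. by move=> /(_ [::]). Qed.

Lemma verma_radP a u v : verma_rad u -> verma_rad v -> verma_rad (a *: u + v).
Proof.
move=> hu hv w; rewrite verma_Ew_linear -[LHS]/(a * (Ew u w [::]) + Ew v w [::]).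
by rewrite hu hv mulr0 addr0.
Qed.
Lemma verma_rad0 : verma_rad 0.
Proof.
move=> w; have -> : Ew 0 w = 0 by elim: w => //= x w ->; rewrite linear0.
by [].
Qed.
Lemma verma_radE x u : verma_rad u -> verma_rad (opE verma_rho x u).
Proof. by move=> hu w; have := hu (rcons w x); rewrite foldr_rcons. Qed.
Lemma verma_radZ a u : verma_rad u -> verma_rad (a *: u).
Proof. by move=> hu; rewrite -[_ *: _]addr0; apply: verma_radP => //; apply: verma_rad0. Qed.

(** Membership in the radical is tested by words of raising operators. The innermost letter is
    carried through [T], at the cost of a scalar and of a remainder that is already in the radical;
    for the empty word only the coordinate of [T u] at the top matters. *)
Lemma verma_rad_op (P : verma -> Prop) (T : verma -> verma) :
  (forall x u, P u -> P (opE verma_rho x u)) -> (forall u, P u -> T u [::] = 0) ->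
  (forall x u, P u -> exists a r, verma_rad r /\
     opE verma_rho x (T u) = a *: T (opE verma_rho x u) + r) ->
  forall u, P u -> verma_rad (T u).
Proof.
move=> PE T0 TE u Pu w; elim/last_ind: w u Pu => [|w x IH] u Pu; first exact: T0.
rewrite foldr_rcons; have [a [r [hr ->]]] := TE x u Pu.
rewrite verma_Ew_linear -[LHS]/(a * (Ew _ w [::]) + Ew r w [::]).
by rewrite (IH _ (PE _ _ Pu)) hr mulr0 addr0.
Qed.

Let pm := verma_premodule.

Lemma verma_radK x u : verma_rad u -> verma_rad (opK verma_rho x u).
Proof.
apply: verma_rad_op => {u} [y u|u hu|y u hu]; first exact: verma_radE.
  by case: x => i c; rewrite -[LHS]/(_ * (u [::])) (verma_rad_nil hu) mulr0.
exists (qpow (slot_form x y / 2))^-1, 0; split; first exact: verma_rad0.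
by rewrite addr0 [opK _ _ (opE _ _ _)](pm_Ke pm) scalerA mulVf ?scale1r // qpow_neq0.
Qed.
Lemma verma_radKv x u : verma_rad u -> verma_rad (opKv verma_rho x u).
Proof.
apply: verma_rad_op => {u} [y u|u hu|y u hu]; first exact: verma_radE.
  by case: x => i c; rewrite -[LHS]/(_ * (u [::])) (verma_rad_nil hu) mulr0.
exists (qpow (- (slot_form x y / 2)))^-1, 0; split; first exact: verma_rad0.
by rewrite addr0 [opKv _ _ (opE _ _ _)](pm_Kve hq pm) scalerA mulVf ?scale1r // qpow_neq0.
Qed.
Lemma verma_radh i c u : verma_rad u -> verma_rad (verma_rho (i, GH c) u).
Proof.
apply: verma_rad_op => {u} [y u|u hu|y u hu]; first exact: verma_radE.
  by rewrite -[LHS]/(_ * (u [::])) (verma_rad_nil hu) mulr0.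
exists 1, (- iota (slot_form (i, c) y) *: opE verma_rho y u).
split; first by apply: verma_radZ; apply: verma_radE.
have -> : verma_rho (i, GH c) (opE verma_rho y u) = opE verma_rho y (verma_rho (i, GH c) u)
    + iota (slot_form (i, c) y) *: opE verma_rho y u := pm_he pm (i, c) y u.
by rewrite scale1r scaleNr addrK.
Qed.
Lemma verma_radF x u : verma_rad u -> verma_rad (opF verma_rho x u).
Proof.
apply: verma_rad_op => {u} [y u|u hu|y u hu]; first exact: verma_radE.
  by case: x.
have -> : opE verma_rho y (opF verma_rho x u) = _ := pm_ef pm y x u.
(* The remainder is the q^h - q^-h term of the commutator of e and f, which stays in the radical by
   the Cartan case. *)
do 2 eexists; split; last reflexivity.
apply: verma_radZ; rewrite addrC -scaleN1r; apply: verma_radP.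
  by do 2 apply: verma_radKv.
by do 2 apply: verma_radK.
Qed.
Lemma verma_rad_rho g u : verma_rad u -> verma_rad (verma_rho g u).
Proof.
case: g => i [] c hu; [exact: (verma_radE (i, c))|exact: (verma_radF (i, c))|
  exact: verma_radh|exact: (verma_radK (i, c))|exact: (verma_radKv (i, c))].
Qed.

Lemma verma_serreE : serre_in iota q verma_rad (opE verma_rho).
Proof.
apply: (serre_in_generated (opE_comm hq pm) (opE_sq hk hq pm) (opE_cubic hq pm)
  (opE_yamane hk hq pm) verma_E_top) => S Sl S0 SF w.
suff -> : S w = 0 by apply: verma_rad0.
apply: verma_serre_zero => // x; have [a a0 Ha] := SF x; exists a^-1 => phi.
by rewrite Ha scalerA mulVf ?scale1r.
Qed.

(** In contrast to the raising case these operators are not zero, since distinct words in the f_x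
    are independent. But they commute with raising operators up to a scalar, and their values have
    no coefficient at the empty word. *)
Lemma verma_serreF : serre_in iota q verma_rad (opF verma_rho).
Proof.
have fin (S : verma -> verma) : (forall u, S u [::] = 0) ->
    (forall x, exists a : F, forall phi, opE verma_rho x (S phi) = a *: S (opE verma_rho x phi)) ->
    forall w, verma_rad (S w).
  move=> S0 SE w; apply: (@verma_rad_op (fun=> True)) => // x u _.
  have [a Ha] := SE x; exists a, 0; split; first exact: verma_rad0.
  by rewrite addr0.
have F0 x u : opF verma_rho x u [::] = 0 by case: x.
have addE (u v : verma) s : (u + v) s = u s + v s by [].
have oppE (u : verma) s : (- u) s = - u s by [].
have scaleE (a : F) (u : verma) s : (a *: u) s = a * u s by [].
split=> [x y w xy xy0|x w px|x y w xy px e1 xx xy1|i u w uk].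
- apply: (fin (serre_comm (opF verma_rho) (fun x => lodd x.2) x y)).
  + by move=> v; rewrite /serre_comm !(addE, oppE, scaleE, F0, mulr0, subr0, addr0).
  + by move=> j; eexists => phi; rewrite (opF_comm hq pm).
- apply: (fin (fun w => opF verma_rho x (opF verma_rho x w))).
  + by move=> v; rewrite F0.
  + by move=> j; exists 1 => phi; rewrite (opF_sq hk hq pm) // scale1r.
- apply: (fin (serre_cubic (opF verma_rho) (qpow (1 / 2)) x y)).
  + by move=> v; rewrite /serre_cubic !(addE, oppE, scaleE, F0, mulr0, subr0, addr0).
  + by move=> j; eexists => phi; rewrite (opF_cubic hq pm).
- apply: (fin (serre_yamane (opF verma_rho) (qpow (1 / 2)) (i, Lmu u) (i, Ls) (i, Lt))).
  + by move=> v; rewrite /serre_yamane !(addE, oppE, scaleE, F0, mulr0, subr0, addr0).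
  + by move=> j; exists 1 => phi; rewrite (opF_yamane hk hq pm) // scale1r.
Qed.

Lemma verma_relI x w : relI iota q x -> verma_rad (act verma_rho x w).
Proof.
move=> hx; exact: (relI_act hk hq pm verma_radP verma_rad0 verma_rad_rho verma_serreE verma_serreF hx).
Qed.

End Verma.

(** * Cartan part of the R-matrix *)

Section CopAct.
Variables (F : fieldType) (k N : nat) (W : lmodType F) (rho : 'I_N * gen k -> {linear W -> W}).

Definition cop_act (i j : 'I_N) (g : gen k) (w : W) : W :=
  match g with
  | GE c => rho (i, GK c) (rho (j, GE c) w) + rho (i, GE c) (rho (j, GKv c) w)
  | GF c => rho (i, GK c) (rho (j, GF c) w) + rho (i, GF c) (rho (j, GKv c) w)
  | GH c => rho (i, GH c) w + rho (j, GH c) w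
  | GK c => rho (i, GK c) (rho (j, GK c) w)
  | GKv c => rho (i, GKv c) (rho (j, GKv c) w)
  end.

Lemma act_gvar2 (i j : 'I_N) (g h : gen k) w :
  act rho (gvar F i g * gvar F j h) w = rho (i, g) (rho (j, h) w).
Proof. by rewrite actM; rewrite !act_gvar. Qed.

Lemma act_cop i j g w : act rho (cop F i j g) w = cop_act i j g w.
Proof.
case: g => c; rewrite /cop /cop_act.
- by rewrite actD; congr (_ + _); apply: act_gvar2.
- by rewrite actD; congr (_ + _); apply: act_gvar2.
- by rewrite actD !act_gvar.
- exact: act_gvar2.
- exact: act_gvar2.
Qed.
End CopAct.

Section DeltaAct.
Variables (F : fieldType) (k : nat) (W : lmodType F) (rho : 'I_2 * gen k -> {linear W -> W}).

Lemma act_Delta g w :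
  act rho (Delta (gvar F ord0 g)) w = cop_act rho (sl 0) (sl 1) g w.
Proof. by rewrite /Delta act_freehom act_gvar; apply: act_cop. Qed.

Lemma act_DeltaT g w :
  act rho (DeltaT (gvar F ord0 g)) w = cop_act rho (sl 1) (sl 0) g w.
Proof.
rewrite /DeltaT /twist /Delta !act_freehom act_gvar.
have e0 : rev_ord (sl 0 : 'I_2) = sl 1 by apply/val_inj; rewrite /= !inordK.
have e1 : rev_ord (sl 1 : 'I_2) = sl 0 by apply/val_inj; rewrite /= !inordK.
apply: (eq_trans (act_cop _ _ _ _ _)).
by case: g => c; rewrite /cop_act /= !act_gvar /= ?e0 ?e1.
Qed.
End DeltaAct.

Section LeadVerma.
Variables (R : realType) (F : fieldType) (iota : {rmorphism R -> F}).
Variables (k : nat) (q : R).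
Hypotheses (hk : (0 < k)%N) (hq : 0 < q) (hq1 : q != 1).
Local Notation qpow := (qpow iota q).

Definition gen_wt (l : weight R k) (g : gen k) : F :=
  match g with
  | GE _ | GF _ => 0
  | GH c => iota (bform l (alpha R c))
  | GK c => qpow (bform l (alpha R c) / 2)
  | GKv c => qpow (- (bform l (alpha R c) / 2))
  end.
Definition wt2 (l m : weight R k) (i : 'I_2) := if i == ord0 then l else m.
Definition chi2 l m (g : 'I_2 * gen k) : F := gen_wt (wt2 l m g.1) g.2.
Local Notation lead2 l m r := (lead (chi2 l m) r).

Section Slots.
Variables (N : nat) (lam : 'I_N -> weight R k).
Local Notation J := ('I_N * label k)%type.
Local Notation verma := (verma F k N).
Local Notation rho := (verma_rho iota q lam).
Local Notation top := (@verma_top F k N).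

Definition verma_coord (s : seq J) (phi : verma) : F := phi s.
Lemma verma_coord_linear s : scalar (verma_coord s).
Proof. by []. Qed.
HB.instance Definition _ s :=
  GRing.isLinear.Build F verma F *%R (verma_coord s) (verma_coord_linear s).

Variable P : pred 'I_N.
(** [P] marks the slots that receive the U^- factor. On combinations of words in these slots alone,
    e from any other slot acts as zero, and f never produces the empty word. *)
Definition slot_supp (phi : verma) : Prop :=
  forall s, ~~ all (fun x : J => P x.1) s -> phi s = 0.

Lemma slot_suppD u v : slot_supp u -> slot_supp v -> slot_supp (u + v).
Proof. by move=> hu hv s hs; rewrite -[LHS]/(u s + v s) hu // hv // addr0. Qed.
Lemma slot_suppZ a u : slot_supp u -> slot_supp (a *: u).
Proof. by move=> hu s hs; rewrite -[LHS]/(a * u s) hu // mulr0. Qed.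
Lemma slot_supp_top : slot_supp top.
Proof. by case. Qed.

Lemma slot_supp_cartan i g u : match g with GE _ | GF _ => False | _ => True end ->
  slot_supp u -> slot_supp (rho (i, g) u).
Proof.
by case: g => // c _ hu s hs; rewrite -[LHS]/(_ * u s) hu // mulr0.
Qed.
Lemma slot_supp_minus i g u : P i -> minus_gen g -> slot_supp u -> slot_supp (rho (i, g) u).
Proof.
move=> Pi; case: g => // c _; try by apply: slot_supp_cartan.
move=> hu [|x s] //= hs; rewrite -[LHS]/(if x == (i, c) then u s else 0).
by case: eqP hs => // -> /=; rewrite Pi /=; apply: hu.
Qed.
Lemma slot_supp_e i c u : ~~ P i -> slot_supp u -> rho (i, GE c) u = 0.
Proof.
move=> Pi hu; apply/funext => s; rewrite -[LHS]/(verma_e iota q lam (i, c) u s).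
elim: s u hu => [|x s IH] u hu /=; rewrite (hu (_ :: _)) ?mulr0 /= ?(negPf Pi) //.
  by rewrite addr0.
rewrite IH ?mulr0 ?addr0 // => t ht; apply: hu; rewrite /= negb_and ht orbT //.
Qed.
Lemma slot_supp_plus i g u : ~~ P i -> plus_gen g -> slot_supp u -> slot_supp (rho (i, g) u).
Proof.
move=> Pi; case: g => // c _ hu; try by apply: slot_supp_cartan.
by rewrite slot_supp_e.
Qed.

Lemma verma_top_val i g u : match g with GE _ => False | _ => True end ->
  rho (i, g) u [::] = gen_wt (lam i) g * u [::].
Proof.
case: g => // c _; first by rewrite /= mul0r.
all: by rewrite -[LHS]/(_ * u [::]) /gen_wt /wt_at big_nil subr0.
Qed.
Lemma verma_plus_val i g u : ~~ P i -> plus_gen g -> slot_supp u ->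
  rho (i, g) u [::] = gen_wt (lam i) g * u [::].
Proof.
move=> Pi; case: g => // c _ hu; try exact: verma_top_val.
by rewrite slot_supp_e // mul0r.
Qed.

Lemma verma_top_wt i c : rho (i, GH c) top = iota (bform (lam i) (alpha R c)) *: top.
Proof.
apply/funext => s; rewrite -[LHS]/(_ * top s) -[RHS]/(_ * top s).
by case: s => [|x s]; rewrite ?mulr0 // /wt_at big_nil subr0.
Qed.
Lemma verma_top_K i c : rho (i, GK c) top = qpow (bform (lam i) (alpha R c) / 2) *: top.
Proof.
apply/funext => s; rewrite -[LHS]/(_ * top s) -[RHS]/(_ * top s).
by case: s => [|x s]; rewrite ?mulr0 // /wt_at big_nil subr0.
Qed.
Lemma verma_top_e i c : rho (i, GE c) top = 0.
Proof. exact: (verma_E_top iota q lam (i, c)). Qed.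

Lemma verma_e_f_top i c j d : rho (i, GE c) (rho (j, GF d) top) =
  (((i, c) == (j, d))%:R * qint_at iota q lam (i, c) [::]) *: top.
Proof.
apply/funext => s; rewrite -[LHS]/(verma_e iota q lam (i, c) (verma_f (j, d) top) s) -[RHS]/(_ * top s).
case: s => [|y s] /=; first by case: eqP => _; rewrite ?mulr0 ?mul0r ?mul1r ?addr0.
rewrite mulr0 [if _ then 0 else 0]if_same mulr0 add0r; case: eqP => _; last by rewrite verma_e0 ?mulr0.
have /(congr1 (fun g : verma => g s)) := verma_top_e i c.
by rewrite -[LHS]/(verma_e iota q lam (i, c) top s) => ->; rewrite mulr0.
Qed.

Lemma verma_f_top_h i c j d : rho (i, GH c) (rho (j, GF d) top) =
  iota (bform (lam i) (alpha R c) - slot_form R (i, c) (j, d)) *: rho (j, GF d) top.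
Proof.
apply/funext => s; rewrite -[LHS]/(_ * verma_f (j, d) top s) -[RHS]/(_ * verma_f (j, d) top s).
case: s => [|y [|z s]]; rewrite /= ?if_same ?mulr0 //; case: eqP => [->|_]; rewrite ?mulr0 //.
by rewrite wt_at_cons /wt_at big_nil subr0.
Qed.
Lemma verma_f_top_K i c j d : rho (i, GK c) (rho (j, GF d) top) =
  qpow ((bform (lam i) (alpha R c) - slot_form R (i, c) (j, d)) / 2) *: rho (j, GF d) top.
Proof.
apply/funext => s; rewrite -[LHS]/(_ * verma_f (j, d) top s) -[RHS]/(_ * verma_f (j, d) top s).
case: s => [|y [|z s]]; rewrite /= ?if_same ?mulr0 //; case: eqP => [->|_]; rewrite ?mulr0 //.
by rewrite wt_at_cons /wt_at big_nil subr0.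
Qed.
Lemma verma_f_top_Kv i c j d : rho (i, GKv c) (rho (j, GF d) top) =
  qpow (- ((bform (lam i) (alpha R c) - slot_form R (i, c) (j, d)) / 2)) *: rho (j, GF d) top.
Proof.
apply/funext => s; rewrite -[LHS]/(_ * verma_f (j, d) top s) -[RHS]/(_ * verma_f (j, d) top s).
case: s => [|y [|z s]]; rewrite /= ?if_same ?mulr0 //; case: eqP => [->|_]; rewrite ?mulr0 //.
by rewrite wt_at_cons /wt_at big_nil subr0.
Qed.

(** [M] = 1 is enough, because a single raising generator already kills the top vector; the radical
    is invisible at the empty word. *)
Lemma verma_top_nbI x : nbI iota q lam 1 x -> act rho x top [::] = 0.
Proof.
move=> hx; apply: (@verma_rad_nil _ _ iota k q N lam).
apply: (nbI_act (rho := rho) (Z := verma_rad iota q lam) _ _ _ _ _ _ _ hx).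
- exact: verma_radP.
- exact: verma_rad0.
- by move=> g u; apply: verma_rad_rho.
- by move=> y hy w; apply: verma_relI.
- exact: verma_top_wt.
- exact: verma_top_K.
- by move=> i [|c [|]] //= _; apply: verma_top_e.
Qed.

Lemma lead_slots (phi : 'I_2 * gen k -> Utens F k N) l m r u :
  (forall g u, minus_gen g -> slot_supp u -> slot_supp (act rho (phi (sl 0, g)) u) /\
     act rho (phi (sl 0, g)) u [::] = gen_wt l g * u [::]) ->
  (forall g u, plus_gen g -> slot_supp u -> slot_supp (act rho (phi (sl 1, g)) u) /\
     act rho (phi (sl 1, g)) u [::] = gen_wt m g * u [::]) ->
  UmUp r -> slot_supp u -> slot_supp (act rho (freehom phi r) u) /\
    act rho (freehom phi r) u [::] = lead2 l m r * u [::].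
Proof.
move=> Hm Hp hr hu; rewrite act_freehom.
have s0 : (sl 0 : 'I_2) == ord0 by apply/eqP/val_inj; rewrite /= inordK.
have s1 : ((sl 1 : 'I_2) == ord0) = false by apply/eqP => /(congr1 val); rewrite /= inordK.
apply: (UmUp_lead (T := slot_supp) (ev := verma_coord [::]) _ _ _ _ hr hu).
- exact: slot_suppD.
- exact: slot_suppZ.
- by move=> g v hg hv; rewrite /chi2 /wt2 /= s0; apply: Hm.
- by move=> g v hg hv; rewrite /chi2 /wt2 /= s1; apply: Hp.
Qed.

Lemma lead_gvar_minus i g u : P i -> minus_gen g -> slot_supp u ->
  slot_supp (act rho (gvar F i g) u) /\ act rho (gvar F i g) u [::] = gen_wt (lam i) g * u [::].
Proof.
move=> Pi hg hu; rewrite act_gvar; split; first exact: slot_supp_minus.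
by apply: verma_top_val; case: g hg.
Qed.
Lemma lead_gvar_plus i g u : ~~ P i -> plus_gen g -> slot_supp u ->
  slot_supp (act rho (gvar F i g) u) /\ act rho (gvar F i g) u [::] = gen_wt (lam i) g * u [::].
Proof.
move=> Pi hg hu; rewrite act_gvar; split; first exact: slot_supp_plus.
exact: verma_plus_val.
Qed.

(** Weights add under the coproduct. This is the source of the multiplicativity of the Cartan part
    in either argument. *)
Lemma lead_cop i j g u :
  (P i && P j && minus_gen g) || (~~ P i && ~~ P j && plus_gen g) -> slot_supp u ->
  slot_supp (act rho (cop F i j g) u) /\
  act rho (cop F i j g) u [::] = gen_wt (lam i + lam j) g * u [::].
Proof.
have addE (v w : verma) s : (v + w) s = v s + w s by [].
have cK a c v : slot_supp v -> slot_supp (rho (a, GK c) v) by apply: slot_supp_cartan.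
have cKv a c v : slot_supp v -> slot_supp (rho (a, GKv c) v) by apply: slot_supp_cartan.
have cH a c v : slot_supp v -> slot_supp (rho (a, GH c) v) by apply: slot_supp_cartan.
rewrite act_cop; case: g => c /=; rewrite ?andbF ?orbF ?andbT /=.
- case/andP=> Pi Pj hu; rewrite (slot_supp_e _ Pj hu) linear0 add0r (slot_supp_e _ Pi) ?mul0r; last exact: cKv.
  by split=> // s.
- case/andP=> Pi Pj hu; split.
    by apply: slot_suppD; [apply: cK | ]; apply: slot_supp_minus => //; apply: cKv.
  by rewrite addE !verma_top_val // /gen_wt !(mul0r, mulr0, addr0).
- move=> _ hu; split; first by apply: slot_suppD; apply: cH.
  by rewrite addE !verma_top_val //= bformDl [X in _ = X * _]rmorphD mulrDl.
- move=> _ hu; split; first by apply: (cK _ _ _ (cK _ _ _ hu)).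
  by rewrite !verma_top_val //= mulrA -(qpowD _ hq) bformDl; congr (qpow _ * _); field.
- move=> _ hu; split; first by apply: (cKv _ _ _ (cKv _ _ _ hu)).
  by rewrite !verma_top_val //= mulrA -(qpowD _ hq) bformDl; congr (qpow _ * _); field.
Qed.

End Slots.
Definition wt3 (l m n : weight R k) (i : 'I_3) :=
  match val i with 0 => l | 1 => m | _ => n end%N.

Section Relations.
Variable RR : set_system (Utens F k 2).
Hypothesis hRR : universal_R iota q RR.
#[local] Instance near_filter : Filter (nbhs RR) := @filter_filter _ _ (uR_filter hRR).

Let v0 : val (sl 0 : 'I_3) = 0%N. Proof. by rewrite /= inordK. Qed.
Let v1 : val (sl 1 : 'I_3) = 1%N. Proof. by rewrite /= inordK. Qed.
Let v2 : val (sl 2 : 'I_3) = 2%N. Proof. by rewrite /= inordK. Qed.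
Let s0 : (sl 0 : 'I_2) == ord0. Proof. by apply/eqP/val_inj; rewrite /= inordK. Qed.
Let s1 : ((sl 1 : 'I_2) == ord0) = false.
Proof. by apply/eqP => /(congr1 val); rewrite /= inordK. Qed.

(** The axiom for (id (x) Delta) R, applied to the top vector of highest weights l, m, n in three
    slots and read at the empty word. Only the first slot is on the U^- side. *)
Lemma near_lead_id_Delta (l m n : weight R k) :
  \forall r \near RR, lead2 l (m + n) r = lead2 l n r * lead2 l m r.
Proof.
pose lam := wt3 l m n; pose rho := verma_rho iota q lam; pose top := @verma_top F k 3.
have := uR_id_Delta hRR lam 1; apply: filterS2 (uR_UmUp hRR) => r hr.
move=> /verma_top_nbI /eqP.
rewrite actB actM -[X in X == _]/(_ - _) subr_eq0 => /eqP.
pose P (i : 'I_3) := val i == 0%N.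
have P0 : P (sl 0) by rewrite /P v0.
have P1 : ~~ P (sl 1) by rewrite /P v1.
have P2 : ~~ P (sl 2) by rewrite /P v2.
have l0 : lam (sl 0) = l by rewrite /lam /wt3 v0.
have l1 : lam (sl 1) = m by rewrite /lam /wt3 v1.
have l2 : lam (sl 2) = n by rewrite /lam /wt3 v2.
have T0 : slot_supp P (@verma_top F k 3) by apply: slot_supp_top.
have [T1 E1] : slot_supp P (act rho (placeR 1 2 r) top) /\
    act rho (placeR 1 2 r) top [::] = lead2 l m r * top [::].
  apply: lead_slots hr T0 => g u hg hu /=; rewrite ?s0 ?s1.
    by rewrite -l0; apply: lead_gvar_minus.
  by rewrite -l1; apply: lead_gvar_plus.
have [_ E2] : slot_supp P (act rho (placeR 1 3 r) (act rho (placeR 1 2 r) top)) /\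
    act rho (placeR 1 3 r) (act rho (placeR 1 2 r) top) [::]
    = lead2 l n r * act rho (placeR 1 2 r) top [::].
  apply: lead_slots hr T1 => g u hg hu /=; rewrite ?s0 ?s1.
    by rewrite -l0; apply: lead_gvar_minus.
  by rewrite -l2; apply: lead_gvar_plus.
have [_ E3] : slot_supp P (act rho (id_Delta r) top) /\
    act rho (id_Delta r) top [::] = lead2 l (m + n) r * top [::].
  apply: lead_slots hr T0 => g u hg hu /=; rewrite ?s0 ?s1.
    by rewrite -l0; apply: lead_gvar_minus.
  by rewrite -l1 -l2; apply: lead_cop; rewrite // P1 P2 hg orbT.
move=> H; have := etrans (esym E3) (etrans H (etrans E2 (congr1 (fun z => lead2 l n r * z) E1))).
by rewrite !mulr1.
Qed.

(** The mirror evaluation, with the first two slots on the U^- side. *)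
Lemma near_lead_Delta_id (l m n : weight R k) :
  \forall r \near RR, lead2 (l + m) n r = lead2 l n r * lead2 m n r.
Proof.
pose lam := wt3 l m n; pose rho := verma_rho iota q lam; pose top := @verma_top F k 3.
have := uR_Delta_id hRR lam 1; apply: filterS2 (uR_UmUp hRR) => r hr.
move=> /verma_top_nbI /eqP.
rewrite actB actM -[X in X == _]/(_ - _) subr_eq0 => /eqP.
pose P (i : 'I_3) := val i != 2%N.
have P0 : P (sl 0) by rewrite /P v0.
have P1 : P (sl 1) by rewrite /P v1.
have P2 : ~~ P (sl 2) by rewrite /P v2.
have l0 : lam (sl 0) = l by rewrite /lam /wt3 v0.
have l1 : lam (sl 1) = m by rewrite /lam /wt3 v1.
have l2 : lam (sl 2) = n by rewrite /lam /wt3 v2.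
have T0 : slot_supp P (@verma_top F k 3) by apply: slot_supp_top.
have [T1 E1] : slot_supp P (act rho (placeR 2 3 r) top) /\
    act rho (placeR 2 3 r) top [::] = lead2 m n r * top [::].
  apply: lead_slots hr T0 => g u hg hu /=; rewrite ?s0 ?s1.
    by rewrite -l1; apply: lead_gvar_minus.
  by rewrite -l2; apply: lead_gvar_plus.
have [_ E2] : slot_supp P (act rho (placeR 1 3 r) (act rho (placeR 2 3 r) top)) /\
    act rho (placeR 1 3 r) (act rho (placeR 2 3 r) top) [::]
    = lead2 l n r * act rho (placeR 2 3 r) top [::].
  apply: lead_slots hr T1 => g u hg hu /=; rewrite ?s0 ?s1.
    by rewrite -l0; apply: lead_gvar_minus.
  by rewrite -l2; apply: lead_gvar_plus.
have [_ E3] : slot_supp P (act rho (Delta_id r) top) /\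
    act rho (Delta_id r) top [::] = lead2 (l + m) n r * top [::].
  apply: lead_slots hr T0 => g u hg hu /=; rewrite ?s0 ?s1.
    by rewrite -l0 -l1; apply: lead_cop; rewrite // P0 P1 hg.
  by rewrite -l2; apply: lead_gvar_plus.
move=> H; have := etrans (esym E3) (etrans H (etrans E2 (congr1 (fun z => lead2 l n r * z) E1))).
by rewrite !mulr1.
Qed.

(** The intertwining relation for e_c is applied to u = f_c v in slot 0. On the left e_c brings u
    back to the top before r acts, on the right after, and the Cartan factors of Delta and of its
    transpose differ by q^(m, alpha_c). *)
Lemma near_lead_root (l m : weight R k) (c : label k) : bform l (alpha R c) != 0 ->
  \forall r \near RR,
    lead2 l m r = qpow (bform m (alpha R c)) * lead2 (l - alpha R c) m r.
Proof.
move=> lc; pose lam := wt2 l m.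
pose rho := verma_rho iota q lam; pose top := @verma_top F k 2.
pose u := rho (sl 0, GF c) top.
have s01 : (sl 1 == sl 0 :> 'I_2) = false.
  by apply/eqP => /(congr1 val); rewrite /= !inordK.
have s10 : (sl 0 == sl 1 :> 'I_2) = false by rewrite eq_sym.
have l0 : lam (sl 0) = l by rewrite /lam /wt2 s0.
have l1 : lam (sl 1) = m by rewrite /lam /wt2 s1.
have slot2 (i : 'I_2) : i = sl 0 \/ i = sl 1.
  case: (eqVneq i ord0) => [->|i0]; [left|right]; first by apply/esym/eqP.
  apply/val_inj; rewrite /= inordK //; case: i i0 => [[|[|]]] //.
pose d : F := (qpow (bform l (alpha R c)) - qpow (- bform l (alpha R c)))
   / (iota q - (iota q)^-1).
have d0 : d != 0 by rewrite mulf_neq0 ?invr_neq0 ?qsub_neq0 ?qpow_sub_neq0.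
have rhoZ g a w : rho g (a *: w) = a *: rho g w := linearZ_LR (rho g) a w.
have ez i e : rho (i, GE e) top = 0 by apply: verma_top_e.
have eu i e : rho (i, GE e) u = (((i, e) == (sl 0, c))%:R * qint_at iota q lam (i, e) [::]) *: top.
  exact: verma_e_f_top.
have hu i e : rho (i, GH e) u = iota (bform (lam i) (alpha R e) - slot_form R (i, e) (sl 0, c)) *: u.
  exact: verma_f_top_h.
have Ku i e : rho (i, GK e) u
    = qpow ((bform (lam i) (alpha R e) - slot_form R (i, e) (sl 0, c)) / 2) *: u.
  exact: verma_f_top_K.
have Kvu i e : rho (i, GKv e) u
    = qpow (- ((bform (lam i) (alpha R e) - slot_form R (i, e) (sl 0, c)) / 2)) *: u.
  exact: verma_f_top_Kv.
have wtu i e : bform (wt2 (l - alpha R c) m i) (alpha R e)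
    = bform (lam i) (alpha R e) - slot_form R (i, e) (sl 0, c).
  have [->|->] := slot2 i.
    by rewrite slot_form_same l0 /wt2 s0 bformDl bformNl (bformC (alpha R e)).
  by rewrite /slot_form /= s01 l1 /wt2 s1 subr0.
(* [M] = 2, because one raising generator sends u to a multiple of the top vector and a second one
   kills it. *)
have := uR_Delta hRR (gvar F ord0 (GE c)) (wt2 (l - alpha R c) m) 2.
apply: filterS2 (uR_UmUp hRR) => r hr hn.
have : verma_rad iota q lam (act rho (r * Delta (gvar F ord0 (GE c)) - DeltaT (gvar F ord0 (GE c)) * r) u).
  apply: (nbI_act (rho := rho) (Z := verma_rad iota q lam) _ _ _ _ _ _ _ hn).
  - exact: verma_radP.
  - exact: verma_rad0.
  - by move=> g v; apply: verma_rad_rho.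
  - by move=> y hy w; apply: verma_relI.
  - by move=> i e; rewrite wtu; apply: hu.
  - by move=> i e; rewrite wtu; apply: Ku.
  - move=> i [|e1 [|e2 [|]]] //= _.
    by rewrite -/(rho _) -/(rho (i, GE e1)) eu rhoZ ez scaler0.
move/verma_rad_nil/eqP; rewrite act_mulB act_Delta act_DeltaT -[X in X == _]/(_ - _) subr_eq0.
move=> /eqP; rewrite /cop_act.
pose P (i : 'I_2) := i == sl 0.
have P0 : P (sl 0) by rewrite /P.
have P1 : ~~ P (sl 1) by rewrite /P s01.
have -> : rho (sl 0, GK c) (rho (sl 1, GE c) u) + rho (sl 0, GE c) (rho (sl 1, GKv c) u)
    = (qpow (- (bform m (alpha R c) / 2)) * qint_at iota q lam (sl 0, c) [::]) *: top.
  rewrite eu xpair_eqE s01 mul0r scale0r linear0 add0r Kvu rhoZ eu eqxx mul1r scalerA.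
  by rewrite /slot_form /= s01 subr0 l1.
have [_ E1] : slot_supp P (act rho r top) /\ act rho r top [::] = lead2 l m r * top [::].
  apply: (UmUp_lead (T := slot_supp P) (ev := verma_coord [::]) _ _ _ _ hr).
  - exact: slot_suppD.
  - exact: slot_suppZ.
  - move=> g v hg hv; split; first exact: slot_supp_minus.
    by rewrite /chi2 -[wt2 l m _]/(lam (sl 0)); apply: verma_top_val; case: g hg.
  - move=> g v hg hv; split; first exact: slot_supp_plus.
    by rewrite /chi2 -[wt2 l m _]/(lam (sl 1)); apply: (@verma_plus_val _ _ P).
  - exact: slot_supp_top.
have [[T2 _] E2] : (slot_supp P (act rho r u) /\ act rho r u [::] = 0) /\
    act rho r u [:: (sl 0, c)] = lead2 (l - alpha R c) m r * u [:: (sl 0, c)].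
  (* The coefficient read is that of the one-letter word of u. The added condition at the empty word
     is needed because f_c would carry the top vector into that word. *)
  apply: (UmUp_lead (T := fun v => slot_supp P v /\ v [::] = 0)
    (ev := verma_coord [:: (sl 0, c)]) _ _ _ _ hr).
  - move=> v w [hv v0'] [hw w0]; split; first exact: slot_suppD.
    by rewrite -[LHS]/(v [::] + w [::]) v0' w0 addr0.
  - move=> a v [hv v0']; split; first exact: slot_suppZ.
    by rewrite -[LHS]/(a * v [::]) v0' mulr0.
  - move=> g v hg [hv v0']; split.
      split; first exact: slot_supp_minus.
      by rewrite verma_top_val ?v0' ?mulr0 //; case: g hg.
    rewrite /chi2 /wt2 /= s0; case: g hg => // e _.
    + rewrite mul0r -[LHS]/(if (sl 0, c) == (sl 0, e) then v [::] else 0) v0'.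
      by case: ifP.
    + rewrite -[LHS]/(_ * v [:: (sl 0, c)]) wt_at_cons /wt_at big_nil subr0 slot_form_same l0.
      by rewrite /= bformDl bformNl (bformC (alpha R e)).
    + rewrite -[LHS]/(_ * v [:: (sl 0, c)]) wt_at_cons /wt_at big_nil subr0 slot_form_same l0.
      by rewrite /= bformDl bformNl (bformC (alpha R e)).
    + rewrite -[LHS]/(_ * v [:: (sl 0, c)]) wt_at_cons /wt_at big_nil subr0 slot_form_same l0.
      by rewrite /= bformDl bformNl (bformC (alpha R e)).
  - move=> g v hg [hv v0']; split.
      split; first exact: slot_supp_plus.
      by rewrite (@verma_plus_val _ _ P) ?v0' ?mulr0.
    have cross e : slot_form R (sl 1 : 'I_2, e) (sl 0, c) = 0 by rewrite /slot_form /= s01.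
    rewrite /chi2 /wt2 /= s1; case: g hg => // e _.
    + by rewrite mul0r (slot_supp_e _ _ P1 hv).
    + by rewrite -[LHS]/(_ * v [:: (sl 0, c)]) wt_at_cons /wt_at big_nil !subr0 cross subr0 l1.
    + by rewrite -[LHS]/(_ * v [:: (sl 0, c)]) wt_at_cons /wt_at big_nil !subr0 cross subr0 l1.
    + by rewrite -[LHS]/(_ * v [:: (sl 0, c)]) wt_at_cons /wt_at big_nil !subr0 cross subr0 l1.
  - split; last by [].
    by apply: slot_supp_minus => //; apply: slot_supp_top.
rewrite (slot_supp_e _ _ P1); last exact: slot_supp_cartan.
rewrite addr0 (linearZ_LR (act rho r)) -[X in X = _]/(_ * act rho r top [::]) E1 mulr1.
rewrite verma_top_val //= l1 -[rho _ _ _]/(verma_e iota q lam (sl 0, c) (act rho r u) [::]).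
rewrite /= addr0 E2 -[u _]/(if (sl 0, c) == (sl 0, c) then 1 else 0 : F) eqxx mulr1.
have -> : qint_at iota q lam (sl 0, c) [::] = d by rewrite /qint_at /wt_at big_nil subr0 l0.
(* The hypothesis (l, alpha_c) <> 0 enters here: the q-integer d is nonzero and can be cancelled. *)
move=> H; apply: (mulfI d0); apply: (mulfI (qpow_neq0 iota hq (- (bform m (alpha R c) / 2)))).
rewrite mulrA H qpowN [qpow (bform m _)](qpow_half iota hq).
by field; rewrite qpow_neq0.
Qed.

End Relations.
End LeadVerma.

(** * Vector representation *)

Section Indices.
Variables (R : realType) (F : fieldType) (iota : {rmorphism R -> F}).
Variables (k : nat) (q : R).
Hypothesis hk : (0 < k)%N.
Local Notation idx := (idx k).
Local Notation wgt := (@wgt R k).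

Lemma val_odx mu : (mu <= 2 * k)%N -> odx k mu = mu.+1 :> nat.
Proof. by move=> h; rewrite /odx inordK // !ltnS. Qed.
Lemma val_evx1 : evx k 1 = 0%N :> nat. Proof. by rewrite /evx inordK. Qed.
Lemma val_bar (a : idx) : bar a = (if (1 < a)%N then (2 * k + 3 - a)%N else (1 - a)%N) :> nat.
Proof.
have := ltn_ord a => ha; rewrite /bar /iodd; case: ifP => h.
  by rewrite val_odx; lia.
by rewrite inordK; lia.
Qed.

Lemma barK : involutive (@bar k).
Proof.
move=> a; apply/val_inj => /=; have := ltn_ord a => ha; rewrite !val_bar.
by do ! case: ifP; lia.
Qed.
Lemma bar_inj : injective (@bar k). Proof. exact: inv_inj barK. Qed.
Lemma iodd_bar (a : idx) : iodd (bar a) = iodd a.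
Proof.
have := ltn_ord a => ha; rewrite /iodd val_bar; case: ifP; lia.
Qed.
Lemma bar_neq (a : idx) : (bar a == a) = false.
Proof.
apply/eqP => /(congr1 val) /=; have := ltn_ord a => ha; rewrite val_bar.
by case: ifP; lia.
Qed.

(** In the vector representation e_c has two legs, from [lo c] to [hi c] and from [bar (hi c)] to
    [bar (lo c)], the second with sign [leg_sign c]. This makes the three kinds of labels
    uniform. *)
Definition hi (c : label k) : idx :=
  match c with Lmu c => odx k c.+1 | _ => odx k k end.
Definition lo (c : label k) : idx :=
  match c with Lmu c => odx k c.+2 | Ls => evx k 1 | Lt => bar (evx k 1) end.
Definition leg_sign (c : label k) : F := if lodd c then (-1) ^+ k else 1.

Lemma val_hi c : hi c = (match c with Lmu c => c.+2 | _ => k.+1 end) :> nat.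
Proof. by case: c => [c||]; rewrite /hi val_odx //; try (have := ltn_ord c); lia. Qed.
Lemma val_lo c : lo c = (match c with Lmu c => c.+3 | Ls => 0 | Lt => 1 end)%N :> nat.
Proof.
case: c => [c||]; rewrite /lo ?val_bar ?val_evx1 // val_odx //.
by have := ltn_ord c; lia.
Qed.

Lemma iodd_hi c : iodd (hi c).
Proof. by rewrite /iodd val_hi; case: c => [c||]; lia. Qed.
Lemma iodd_lo c : iodd (lo c) = ~~ lodd c.
Proof. by rewrite /iodd val_lo; case: c. Qed.

Ltac idx_neq c := apply/eqP => /(congr1 (@nat_of_ord _)); rewrite ?val_bar ?val_hi ?val_lo;
  case: c => [c'||] /=; try (have := ltn_ord c'); try case: ifP; lia.

Lemma hi_lo c : (hi c == lo c) = false. Proof. by idx_neq c. Qed.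
Lemma hi_blo c : (hi c == bar (lo c)) = false. Proof. by idx_neq c. Qed.
Lemma lo_inj : injective lo.
Proof.
move=> c d /(congr1 (@nat_of_ord _)); rewrite !val_lo.
case: c => [c||]; case: d => [d||] //= [e]; congr Lmu; exact/val_inj.
Qed.
Lemma lo_bhi c d : (lo c == bar (hi d)) = false.
Proof.
apply/eqP => /(congr1 (@nat_of_ord _)); rewrite val_bar val_hi val_lo.
case: c => [c||]; [have := ltn_ord c | |]; case: d => [d||] /=; try (have := ltn_ord d);
  (try case: ifP); lia.
Qed.
Lemma hi_blo2 c d : (hi c == bar (lo d)) = false.
Proof.
apply/eqP => /(congr1 (@nat_of_ord _)); rewrite val_bar val_hi val_lo.
by case: c => [c||]; [have := ltn_ord c | |]; case: d => [d||] /=; try (have := ltn_ord d); (try case: ifP); lia.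
Qed.
Lemma hi_bhi c d : (hi c == bar (hi d)) = false.
Proof.
apply/eqP => /(congr1 (@nat_of_ord _)); rewrite val_bar !val_hi.
by case: c => [c||]; [have := ltn_ord c | |]; case: d => [d||] /=; try (have := ltn_ord d); (try case: ifP); lia.
Qed.
(** The labels s and t share the upper end delta_k, which is why commuting e_s with f_t needs an
    argument of its own. *)
Lemma hi_eq c d : hi c = hi d -> c = d \/ lodd c && lodd d.
Proof.
move/(congr1 (@nat_of_ord _)); rewrite !val_hi.
case: c => [c||]; case: d => [d||] /=; try (have := ltn_ord c); try (have := ltn_ord d);
  first [by right | by left | by move=> *; exfalso; lia | idtac].
by move=> _ _ [e]; left; congr Lmu; apply/val_inj.
Qed.

Definition topx : idx := odx k 1.
Definition botx : idx := bar topx.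

(** The weight diagram of V is connected downwards from delta_1: through delta_k to both even
    weights, and from there through -delta_k to -delta_1. *)
Lemma lower_ind (P : idx -> Prop) : P topx ->
  (forall c, P (hi c) -> P (lo c)) -> (forall c, P (bar (lo c)) -> P (bar (hi c))) ->
  forall a, P a.
Proof.
move=> P0 Pl Pb.
have Podx mu : (mu < k)%N -> P (odx k mu.+1).
  elim: mu => // mu IH h; have h' : (mu < k.-1)%N by lia.
  by apply: (Pl (Lmu (Ordinal h'))); apply: IH; lia.
have Pk : P (odx k k).
  have -> : odx k k = odx k k.-1.+1 by rewrite prednK.
  by apply: Podx; lia.
have P1 : P (evx k 1) by apply: (Pl Ls).
have P2 : P (bar (evx k 1)) by apply: (Pl Lt).
have Pbk : P (bar (odx k k)) by apply: (Pb Ls).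
have Pbodx j : (j < k)%N -> P (bar (odx k (k - j))).
  elim: j => [|j IH] h; first by rewrite subn0.
  have h' : (k - j.+2 < k.-1)%N by lia.
  have := Pb (Lmu (Ordinal h')); rewrite /= => H.
  have -> : (k - j.+1 = (k - j.+2).+1)%N by lia.
  have e : ((k - j.+2).+2 = k - j)%N by lia.
  by apply: H; rewrite e; apply: IH; lia.
move=> a; have := ltn_ord a => ha.
have [a1|a1] := leqP a 1.
  have [a0|a0] := eqVneq (a : nat) 0%N.
    by have -> : a = evx k 1 by apply/val_inj; rewrite /= val_evx1.
  have -> : a = bar (evx k 1) by apply/val_inj; rewrite /= val_bar val_evx1 /=; lia.
  exact: P2.
have [ak|ak] := leqP a k.+1.
  have -> : a = odx k (a.-2).+1 by apply/val_inj; rewrite /= val_odx; lia.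
  by apply: Podx; lia.
have -> : a = bar (odx k (k - (a - k.+2))).
  by apply/val_inj; rewrite /= val_bar val_odx; [case: ifP; lia | lia].
by apply: Pbodx; lia.
Qed.

Lemma raise_ind (P : idx -> Prop) : P botx ->
  (forall c, P (lo c) -> P (hi c)) -> (forall c, P (bar (hi c)) -> P (bar (lo c))) ->
  forall a, P a.
Proof.
move=> P0 Pl Pb a; rewrite -[a]barK.
apply: (@lower_ind (fun a => P (bar a))) => // c h.
by rewrite barK; apply: Pl; rewrite barK in h.
Qed.

Lemma wgt_bar (a : idx) : wgt (bar a) = - wgt a.
Proof.
have := ltn_ord a => ha; rewrite /wgt iodd_bar /iodd val_bar; case: ltnP => a1.
  have [h|h] := leqP a.-1 k.
    rewrite ifF; last lia.
    by have -> : ((2 * k).+1 - (2 * k + 3 - a).-1 = a.-1)%N by lia.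
  rewrite ifT; last lia.
  have -> : ((2 * k + 3 - a).-1 = (2 * k).+1 - a.-1)%N by lia.
  by rewrite opprK.
have [->|a0] := eqVneq (a : nat) 0%N; first by [].
have -> : (a : nat) = 1%N by lia.
by rewrite /= opprK.
Qed.

Lemma wgt_odx mu : (0 < mu <= k)%N -> wgt (odx k mu) = coordw R k mu.
Proof.
move=> h; rewrite /wgt /iodd val_odx; last lia.
by case: ifP => [_|]; [case: ifP => //=; lia | lia].
Qed.
Lemma wgt_evx1 : wgt (evx k 1) = coordw R k 0.
Proof. by rewrite /wgt /iodd val_evx1. Qed.

Lemma alpha_hi_lo c : alpha R c = wgt (hi c) - wgt (lo c).
Proof.
case: c => [c||]; rewrite /hi /lo /alpha.
- by have := ltn_ord c => hc; rewrite !wgt_odx //; lia.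
- by rewrite wgt_odx ?wgt_evx1 //; lia.
- by rewrite wgt_bar wgt_odx ?wgt_evx1 ?opprK //; lia.
Qed.

Definition wsq (a : idx) : R := if iodd a then -1 else 1.

Lemma bform_wgt a b : bform (wgt a) (wgt b) = wsq a * ((a == b)%:R - (a == bar b)%:R).
Proof.
(* Replacing an index by its [bar] changes the sign of both sides, so it suffices to treat positions
   0 and 2, ..., k + 1, whose weights are eps_1, delta_1, ..., delta_k. *)
wlog pos : a b / forall x : idx, x = a \/ x = b -> (x <= k.+1)%N && (x != 1 :> nat).
  have red (x : idx) : exists y : idx, ((y <= k.+1)%N && (y != 1 :> nat)) /\ (x = y \/ x = bar y).
    have := ltn_ord x => hx; have [hx1|hx1] := boolP ((x <= k.+1)%N && (x != 1 :> nat)).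
      by exists x; split; [|left].
    exists (bar x); split; last by right; rewrite barK.
    by rewrite val_bar; case: ifP; lia.
  move=> H; have [[y [hy ey]] [z [hz ez]]] := (red a, red b).
  have Hyz : bform (wgt y) (wgt z) = wsq y * ((y == z)%:R - (y == bar z)%:R).
    by apply: H => x [->|->].
  have beq (u v : idx) : (bar u == v) = (u == bar v) by rewrite -{1}[v]barK (inj_eq bar_inj).
  case: ey => ->; case: ez => ->; rewrite ?wgt_bar ?bformNl ?bformNr Hyz ?barK /wsq ?iodd_bar //;
    rewrite ?beq ?barK ?(inj_eq bar_inj); ring.
have /andP[ha ha1] := pos a (or_introl erefl).
have /andP[hb hb1] := pos b (or_intror erefl).
have wE (x : idx) : (x <= k.+1)%N -> x != 1 :> nat -> wgt x = coordw R k x.-1.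
  move=> h1 h2; rewrite /wgt /iodd; case: ltnP => h3; first by rewrite ifT //; lia.
  have e : (x : nat) = 0%N by lia.
  by rewrite e.
have nb : (a == bar b) = false.
  by apply/eqP => /(congr1 (@nat_of_ord _)); rewrite val_bar; case: ifP; lia.
have -> : (a == b) = (a.-1 == b.-1 :> nat) by rewrite -val_eqE /=; lia.
rewrite nb subr0 !wE // bform_coordw; last lia.
rewrite /wsq /iodd; case: eqP => _; last by rewrite mulr0.
by rewrite mulr1; case: ltnP => h; [rewrite ifF // | rewrite ifT //]; lia.
Qed.

Lemma wrank_lt (a : idx) : (wrank a < (2 * k).+2)%N.
Proof.
have := ltn_ord a; have hk1 := hk; rewrite /wrank /iodd.
by do ? case: ifP; lia.
Qed.
Lemma wrank_hi_lo (c : label k) : (wrank (hi c) < wrank (lo c))%N.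
Proof.
rewrite /wrank iodd_hi ?iodd_lo // val_hi // val_lo //.
by have hk1 := hk; case: c => [c||]; [have := ltn_ord c| |]; rewrite /=; do ? case: ifP; lia.
Qed.
Lemma wrank_bar (c : label k) : (wrank (bar (lo c)) < wrank (bar (hi c)))%N.
Proof.
rewrite /wrank !iodd_bar iodd_hi ?iodd_lo // !val_bar // val_hi // val_lo //.
by have hk1 := hk; case: c => [c||]; [have := ltn_ord c| |]; rewrite /=; do ? case: ifP; lia.
Qed.

Lemma top_lo c : (topx == lo c) = false.
Proof.
apply/eqP => /(congr1 (@nat_of_ord _)); rewrite val_lo // val_odx; last lia.
by case: c => [c||]; have := hk; lia.
Qed.
Lemma top_bhi c : (topx == bar (hi c)) = false.
Proof.
apply/eqP => /(congr1 (@nat_of_ord _)); rewrite val_bar // val_hi // val_odx; last lia.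
by have hk1 := hk; case: c => [c||] /=; [have := ltn_ord c => hc | | ]; try case: ifP; lia.
Qed.
Lemma bot_blo c : (botx == bar (lo c)) = false.
Proof. by rewrite (inj_eq bar_inj) top_lo. Qed.
Lemma bot_hi c : (botx == hi c) = false.
Proof. by rewrite -[hi c]barK (inj_eq bar_inj) top_bhi. Qed.

End Indices.

Section VecRep.
Variables (R : realType) (F : fieldType) (iota : {rmorphism R -> F}).
Variables (k : nat) (q : R).
Hypotheses (hk : (0 < k)%N) (hq : 0 < q) (hq1 : q != 1).
Local Notation idx := (idx k).
Local Notation wgt := (@wgt R k).
Local Notation El := (@El F k).
Local Notation P := (@pirep R F iota k q).
Local Notation eps := (@leg_sign F k).
Local Notation qpow := (qpow iota q).
Local Notation W := 'M[F]_((2 * k).+2).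

Definition dg (f : idx -> F) : W := \sum_a f a *: El a a.

Lemma ElE a b c d : El a b c d = ((c == a) && (d == b))%:R.
Proof. by rewrite mxE. Qed.
Lemma mulEl a b c d : El a b *m El c d = (b == c)%:R *: El a d.
Proof. by rewrite /El mul_delta_mx_cond; case: (b == c); rewrite ?scale1r ?scale0r. Qed.
Lemma mxZE a (A : W) x y : (a *: A) x y = a * A x y. Proof. by rewrite mxE. Qed.
Lemma mxDE (A B : W) x y : (A + B) x y = A x y + B x y. Proof. by rewrite mxE. Qed.
Lemma mxNE (A : W) x y : (- A) x y = - A x y. Proof. by rewrite mxE. Qed.
Lemma dgE f x y : dg f x y = f x * (x == y)%:R.
Proof.
rewrite /dg summxE (bigD1 x) //= big1 => [|a ax]; rewrite mxZE ElE ?eqxx 1?[y == x]eq_sym ?addr0 //.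
by rewrite eq_sym (negPf ax) mulr0.
Qed.
Lemma dg_mul f (w : W) x y : (dg f *m w) x y = f x * w x y.
Proof.
rewrite mxE (bigD1 x) //= big1 => [|a ax]; first by rewrite dgE eqxx mulr1 addr0.
by rewrite dgE eq_sym (negPf ax) mulr0 mul0r.
Qed.
Lemma mul_dg f (w : W) x y : (w *m dg f) x y = w x y * f y.
Proof.
rewrite mxE (bigD1 y) //= big1 => [|a ax]; first by rewrite dgE eqxx mulr1 addr0.
by rewrite dgE (negPf ax) !mulr0.
Qed.
Lemma dg_El f a b : dg f *m El a b = f a *: El a b.
Proof.
apply/matrixP => x y; rewrite dg_mul mxZE ElE.
by case: (x =P a) => [->|]; rewrite //= !mulr0.
Qed.
Lemma El_dg f a b : El a b *m dg f = f b *: El a b.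
Proof.
apply/matrixP => x y; rewrite mul_dg mxZE ElE mulrC.
by case: (y =P b) => [->|]; rewrite //= ?andbF !mulr0.
Qed.
Lemma dg_dg f g : dg f *m dg g = dg (fun a => f a * g a).
Proof. by apply/matrixP => x y; rewrite dg_mul !dgE mulrA. Qed.
Lemma dg1 : dg (fun=> 1) = 1%:M.
Proof. by apply/matrixP => x y; rewrite dgE !mxE mul1r. Qed.

Lemma pirep_e c : P (GE c) = El (hi c) (lo c) + eps c *: El (bar (lo c)) (bar (hi c)).
Proof. by case: c => [c||]; rewrite /eps /= ?scale1r ?(barK hk). Qed.
Lemma pirep_f c : P (GF c) = - El (lo c) (hi c)
  - (sgn F (lodd c) * eps c) *: El (bar (hi c)) (bar (lo c)).
Proof.
case: c => [c||]; rewrite /eps /sgn /= ?expr0 ?expr1 ?mul1r ?mulN1r ?scale1r ?(barK hk) ?scaleNr ?opprK //.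
by rewrite opprD.
Qed.
Lemma pirep_h c : P (GH c) = dg (fun a => iota (bform (alpha R c) (wgt a))).
Proof. by []. Qed.
Lemma pirep_K c : P (GK c) = dg (fun a => qpow (bform (alpha R c) (wgt a) / 2)).
Proof. by []. Qed.
Lemma pirep_Kv c : P (GKv c) = dg (fun a => qpow (- (bform (alpha R c) (wgt a) / 2))).
Proof. by []. Qed.

Lemma eps_sq c : eps c * eps c = 1.
Proof. by rewrite /eps; case: (lodd c); rewrite ?mulr1 // -expr2 sqrr_sign. Qed.

Lemma bform_alpha c a : bform (alpha R c) (wgt a) =
  (a == bar (hi c))%:R - (a == hi c)%:R
  + (-1) ^+ lodd c * ((a == lo c)%:R - (a == bar (lo c))%:R).
Proof.
rewrite (alpha_hi_lo R hk) bformDl bformNl !(bform_wgt R hk) /wsq (iodd_hi hk) (iodd_lo hk).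
have beq (u v : idx) : (bar u == v) = (u == bar v) by rewrite -{1}[v](barK hk) (inj_eq (bar_inj hk)).
rewrite -(beq (hi c)) -(beq (lo c)) ![_ == a]eq_sym.
by case: (lodd c); rewrite /= ?expr0 ?expr1; ring.
Qed.

Lemma alpha_wgt_lo c d : bform (alpha R c) (wgt (hi d)) = bform (alpha R c) (alpha R d) + bform (alpha R c) (wgt (lo d)).
Proof. by rewrite -bformDr (alpha_hi_lo R hk d) subrK. Qed.
Lemma alpha_wgt_bhi c d : bform (alpha R c) (wgt (bar (lo d))) =
  bform (alpha R c) (alpha R d) + bform (alpha R c) (wgt (bar (hi d))).
Proof. by rewrite -bformDr (alpha_hi_lo R hk d) !(wgt_bar R hk) addrAC subrr add0r. Qed.

Lemma pirep_KKv c : P (GK c) *m P (GKv c) = 1%:M.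
Proof.
rewrite dg_dg -dg1; congr dg; apply/funext => a.
by rewrite -(qpowD iota hq) addrN qpow0.
Qed.
Lemma pirep_KvK c : P (GKv c) *m P (GK c) = 1%:M.
Proof.
rewrite dg_dg -dg1; congr dg; apply/funext => a.
by rewrite -(qpowD iota hq) addNr qpow0.
Qed.
Lemma dgC f g : dg f *m dg g = dg g *m dg f.
Proof. by rewrite !dg_dg; congr dg; apply/funext => a; rewrite mulrC. Qed.
Let iotaD x y : iota (x + y) = iota x + iota y := rmorphD iota x y.
Lemma pirep_he c d : P (GH c) *m P (GE d) =
  P (GE d) *m P (GH c) + iota (bform (alpha R c) (alpha R d)) *: P (GE d).
Proof.
rewrite !pirep_e pirep_h !mulmxDl !mulmxDr -!scalemxAr -!scalemxAl !dg_El !El_dg.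
rewrite alpha_wgt_lo alpha_wgt_bhi !iotaD.
by lincomb F (W : lmodType F); ring.
Qed.
Lemma pirep_hf c d : P (GH c) *m P (GF d) =
  P (GF d) *m P (GH c) - iota (bform (alpha R c) (alpha R d)) *: P (GF d).
Proof.
rewrite !pirep_f pirep_h !mulmxBl !mulmxBr !mulNmx !mulmxN -!scalemxAr -!scalemxAl !dg_El !El_dg.
rewrite alpha_wgt_lo alpha_wgt_bhi !iotaD.
by lincomb F (W : lmodType F); ring.
Qed.
Lemma pirep_Ke c d : P (GK c) *m P (GE d) =
  qpow (bform (alpha R c) (alpha R d) / 2) *: (P (GE d) *m P (GK c)).
Proof.
rewrite !pirep_e pirep_K !mulmxDl !mulmxDr -!scalemxAr -!scalemxAl !dg_El !El_dg.
rewrite alpha_wgt_lo alpha_wgt_bhi ![(bform _ (alpha R d) + _) / 2]mulrDl !(qpowD iota hq).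
by lincomb F (W : lmodType F); ring.
Qed.
Lemma pirep_Kf c d : P (GK c) *m P (GF d) =
  qpow (- (bform (alpha R c) (alpha R d) / 2)) *: (P (GF d) *m P (GK c)).
Proof.
rewrite !pirep_f pirep_K !mulmxBl !mulmxBr !mulNmx !mulmxN -!scalemxAr -!scalemxAl !dg_El !El_dg.
rewrite alpha_wgt_lo alpha_wgt_bhi ![(bform _ (alpha R d) + _) / 2]mulrDl !(qpowD iota hq).
rewrite (qpowN iota).
by lincomb F (W : lmodType F); field; rewrite (qpow_neq0 iota hq).
Qed.

(** The eigenvalues of h_c on V are 0, 1 and -1, where the q-integer is the integer itself; the
    relation between e_c and f_c thus reduces to its classical form. *)
Lemma qpow_pm1 x : [\/ x = 0, x = 1 | x = -1] ->
  qpow x - qpow (- x) = (iota q - (iota q)^-1) * iota x.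
Proof.
case=> ->; rewrite ?oppr0 ?opprK ?subrr ?(rmorph0 iota) ?mulr0 //.
  by rewrite (qpowN iota) (qpow1 iota hq) (rmorph1 iota) mulr1.
by rewrite (qpowN iota) (qpow1 iota hq) (rmorphN iota) (rmorph1 iota) mulrN1 opprB.
Qed.
Lemma pirep_ef c d : P (GE c) *m P (GF d) = sgn F (lodd c && lodd d) *: (P (GF d) *m P (GE c))
   + ((c == d)%:R / (iota q - (iota q)^-1)) *: (P (GK c) *m P (GK c) - P (GKv c) *m P (GKv c)).
Proof.
rewrite !pirep_e !pirep_f !mulmxDr !mulmxDl !mulmxN !mulNmx -!scalemxAr -!scalemxAl !mulEl.
have beq (u v : idx) : (bar u == bar v) = (u == v) by apply: (inj_eq (bar_inj hk)).
rewrite !beq (lo_bhi hk) [bar (hi c) == lo d]eq_sym (lo_bhi hk) (hi_blo2 hk).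
rewrite [bar (lo d) == _]eq_sym (hi_blo2 hk) !scale0r !scaler0 ?addr0 ?oppr0 ?subr0 ?add0r.
have [<-|cd] := eqVneq c d; last first.
  rewrite mul0r scale0r addr0.
  have lcd : (lo c == lo d) = false by apply/eqP => /(lo_inj hk) /eqP; apply/negP.
  rewrite lcd [lo d == _]eq_sym lcd; have [hcd|] := eqVneq (hi c) (hi d); last first.
    by rewrite !(scale0r, scaler0, oppr0, addr0, subr0).
  rewrite !scale0r !scaler0 !(oppr0, addr0, subr0, add0r, scale1r).
  have [e|] := hi_eq hk hcd; first by rewrite e eqxx in cd.
  (* The labels are s and t in some order. Their lower ends are exchanged by [bar], and the two
     surviving products cancel. *)
  case/andP=> oc od; rewrite oc od /sgn expr1 /eps oc od.
  have -> : bar (lo c) = lo d.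
    by case: c d cd oc od {lcd hcd} => [?||] [?||] //= _ _ _; rewrite (barK hk).
  have -> : bar (lo d) = lo c.
    by case: c d cd oc od {lcd hcd} => [?||] [?||] //= _ _ _; rewrite (barK hk).
  have e2 : (-1) ^+ k * (-1) ^+ k = 1 :> F by rewrite -expr2 sqrr_sign.
  by lincomb F (W : lmodType F); rewrite mulr1 mulN1r mulNr e2 mulrN1.
rewrite !eqxx !scale1r andbb !dg_dg mul1r !scalerA.
have d0 := qsub_neq0 iota hq hq1.
have -> : dg (fun a => qpow (bform (alpha R c) (wgt a) / 2) * qpow (bform (alpha R c) (wgt a) / 2))
   - dg (fun a => qpow (- (bform (alpha R c) (wgt a) / 2)) * qpow (- (bform (alpha R c) (wgt a) / 2)))
 = (iota q - (iota q)^-1) *: (El (bar (hi c)) (bar (hi c)) - El (hi c) (hi c)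
    + sgn F (lodd c) *: (El (lo c) (lo c) - El (bar (lo c)) (bar (lo c)))).
  apply/matrixP => x y.
  rewrite !(mxDE, mxNE, mxZE, ElE, dgE) -!(qpowD iota hq) -!splitr -opprD -splitr bform_alpha.
  have [->|xy] := eqVneq x y; last first.
    have nb a : (x == a) && (y == a) = false.
      by apply/negP => /andP[/eqP xa /eqP ya]; rewrite xa ya eqxx in xy.
    by rewrite !nb !(mulr0, subr0, addr0).
  rewrite !andbb !mulr1 qpow_pm1; last first.
    have sg (b : bool) : [\/ (-1) ^+ b = 0, (-1) ^+ b = 1 | (-1) ^+ b = -1 :> R].
      by case: b; rewrite ?expr1 ?expr0; [apply: Or33 | apply: Or32].
    have sgN (b : bool) : [\/ - (-1) ^+ b = 0, - (-1) ^+ b = 1 | - (-1) ^+ b = -1 :> R].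
      by case: b; rewrite ?expr1 ?expr0 ?opprK; [apply: Or32 | apply: Or33].
    have nbb : (bar (hi c) == bar (lo c)) = false by rewrite beq hi_lo.
    have [->|_] := eqVneq y (hi c).
      by rewrite (hi_bhi hk) (hi_lo hk) (hi_blo hk) !subr0 mulr0 addr0 add0r; apply: Or33.
    have [->|_] := eqVneq y (bar (hi c)).
      rewrite nbb eq_sym (lo_bhi hk).
      by rewrite !subr0 mulr0 addr0; apply: Or32.
    have [->|_] := eqVneq y (lo c).
      by rewrite eq_sym bar_neq // !subr0 add0r mulr1; apply: sg.
    have [_|_] := eqVneq y (bar (lo c)).
      by rewrite !sub0r oppr0 add0r mulrN1; apply: sgN.
    by rewrite !subr0 mulr0 addr0; apply: Or31.
  congr (_ * _).
  have iotaB u v : iota (u - v) = iota u - iota v := rmorphB iota u v.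
  have iotaM u v : iota (u * v) = iota u * iota v := rmorphM iota u v.
  have iotan n : iota n%:R = n%:R := rmorph_nat iota n.
  by rewrite iotaD iotaM !iotaB !iotan [iota (_ ^+ _)](rmorph_sign iota).
rewrite -[_ * eps c * eps c]mulrA eps_sq mulr1 mulrCA eps_sq mulr1 scalerA mulVf // scale1r.
by lincomb F (W : lmodType F); rewrite /sgn; case: (lodd c); rewrite ?expr1 ?expr0; ring.
Qed.
End VecRep.

(** * Tensor square of the vector representation *)

Section VecSquare.
Variables (R : realType) (F : fieldType) (iota : {rmorphism R -> F}).
Variables (k : nat) (q : R).
Hypotheses (hk : (0 < k)%N) (hq : 0 < q) (hq1 : q != 1).
Local Notation idx := (idx k).
Local Notation wgt := (@wgt R k).
Local Notation El := (@El F k).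
Local Notation P := (@pirep R F iota k q).
Local Notation eps := (@leg_sign F k).
Local Notation qpow := (qpow iota q).
Local Notation W := 'M[F]_((2 * k).+2).
Local Notation J := ('I_2 * label k)%type.

Definition grading b : W := dg (fun a : idx => sgn F (iodd a && b)).
Lemma gradingM b c : grading b *m grading c = grading (b (+) c).
Proof.
rewrite dg_dg; congr dg; apply/funext => a; rewrite -sgnM.
by case: (iodd a); case: b; case: c.
Qed.
Lemma grading0 : grading false = 1%:M.
Proof. by rewrite -dg1; congr dg; apply/funext => a; rewrite andbF. Qed.
Lemma gradingC b (g : gen k) : grading b *m P g = sgn F (b && godd g) *: (P g *m grading b).
Proof.
case: g => c; rewrite /grading; try by rewrite pirep_h dgC andbF scale1r.
- rewrite pirep_e // mulmxDr mulmxDl -scalemxAr -scalemxAl !dg_El !El_dg !(iodd_bar hk) iodd_hi // iodd_lo //=.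
  by lincomb F (W : lmodType F); rewrite /sgn; case: (lodd c); case: b => /=; ring.
- rewrite pirep_f // !mulmxBr !mulmxBl !mulmxN !mulNmx -scalemxAr -scalemxAl !dg_El !El_dg.
  rewrite !(iodd_bar hk) iodd_hi // iodd_lo //=.
  by lincomb F (W : lmodType F); rewrite /sgn; case: (lodd c); case: b => /=; ring.
- by rewrite pirep_K dgC andbF scale1r.
- by rewrite pirep_Kv dgC andbF scale1r.
Qed.

(** V (x) V is realized as matrices, [El a b] being v_a (x) v_b. Slot 1 acts on the column index
    through the transpose, and [grading] gives the sign for passing v_a. *)
Definition vv_act (g : 'I_2 * gen k) (w : W) : W :=
  if g.1 == ord0 then P g.2 *m w else grading (godd g.2) *m w *m (P g.2)^T.
Lemma vv_act_linear g : linear (vv_act g).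
Proof.
move=> a u v; rewrite /vv_act; case: ifP => _; rewrite mulmxDr -scalemxAr // mulmxDl -scalemxAl //.
Qed.
HB.instance Definition _ g := GRing.isLinear.Build F W W _ (vv_act g) (vv_act_linear g).
Definition vv_rho g : {linear W -> W} := vv_act g.

Lemma vv_rho0 g w : vv_rho (ord0, g) w = P g *m w. Proof. by []. Qed.
Lemma vv_rho1 i g w : i != ord0 -> vv_rho (i, g) w = grading (godd g) *m w *m (P g)^T.
Proof. by rewrite /vv_rho /= /vv_act /= => /negPf ->. Qed.

Lemma vv_rho00 g h w : vv_rho (ord0, g) (vv_rho (ord0, h) w) = P g *m P h *m w.
Proof. by rewrite !vv_rho0 mulmxA. Qed.
Lemma vv_rho11 i g h w : i != ord0 -> vv_rho (i, g) (vv_rho (i, h) w) =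
  grading (godd g (+) godd h) *m w *m (P g *m P h)^T.
Proof. by move=> i0; rewrite !vv_rho1 // trmx_mul !mulmxA gradingM. Qed.
Lemma vv_rho10 i g h w : i != ord0 -> vv_rho (i, g) (vv_rho (ord0, h) w) =
  sgn F (godd g && godd h) *: vv_rho (ord0, h) (vv_rho (i, g) w).
Proof.
by move=> i0; rewrite !(@vv_rho1 i) // !vv_rho0 !mulmxA gradingC -!scalemxAl.
Qed.

Lemma vv_eq (i j : 'I_2) : i != ord0 -> j != ord0 -> j = i.
Proof. by case: i j => [[|[|]]] //= hi [[|[|]]] //= hj _ _; apply/val_inj. Qed.

Let trD (A B : W) : (A + B)^T = A^T + B^T := raddfD _ A B.
Let trB (A B : W) : (A - B)^T = A^T - B^T := raddfB _ A B.
Let trZ a (A : W) : (a *: A)^T = a *: A^T := linearZ_LR _ a A.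
Ltac slots x y := case: x => i c; case: y => j d; rewrite /slot_form /=;
  have [->|i0] := eqVneq i ord0; have [->|j0] := eqVneq j ord0.

Lemma vv_premodule : premodule iota q vv_rho.
Proof.
split.
- case=> i c w /=; have [->|i0] := eqVneq i ord0.
    by rewrite vv_rho00 pirep_KKv // mul1mx.
  by rewrite vv_rho11 // pirep_KKv // trmx1 mulmx1 grading0 mul1mx.
- case=> i c w /=; have [->|i0] := eqVneq i ord0.
    by rewrite vv_rho00 pirep_KvK // mul1mx.
  by rewrite vv_rho11 // pirep_KvK // trmx1 mulmx1 grading0 mul1mx.
- move=> x y w; slots x y.
  + by rewrite !vv_rho00 dgC.
  + by rewrite vv_rho10 //= scale1r.
  + by rewrite vv_rho10 //= scale1r.
  + by rewrite (vv_eq i0 j0) !vv_rho11 // dgC.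
- move=> x y w; slots x y.
  + by rewrite !vv_rho00 dgC.
  + by rewrite vv_rho10 //= scale1r.
  + by rewrite vv_rho10 //= scale1r.
  + by rewrite (vv_eq i0 j0) !vv_rho11 // dgC.
- move=> x y w; slots x y.
  + by rewrite !vv_rho00 dgC.
  + by rewrite vv_rho10 //= scale1r.
  + by rewrite vv_rho10 //= scale1r.
  + by rewrite (vv_eq i0 j0) !vv_rho11 // dgC.
- move=> x y w; slots x y.
  + by rewrite !vv_rho00 pirep_he // mulmxDl -scalemxAl.
  + by rewrite rmorph0 scale0r addr0 vv_rho10 //= andbF scale1r.
  + by rewrite (negPf i0) rmorph0 scale0r addr0 vv_rho10 //= scale1r.
  + rewrite (vv_eq i0 j0) eqxx !vv_rho11 // vv_rho1 // pirep_he //.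
    by rewrite trD trZ mulmxDr -scalemxAr /= addbF.
- move=> x y w; slots x y.
  + by rewrite !vv_rho00 pirep_hf // mulmxBl -scalemxAl.
  + by rewrite rmorph0 scale0r subr0 vv_rho10 //= andbF scale1r.
  + by rewrite (negPf i0) rmorph0 scale0r subr0 vv_rho10 //= scale1r.
  + rewrite (vv_eq i0 j0) eqxx !vv_rho11 // vv_rho1 // pirep_hf //.
    by rewrite trB trZ mulmxBr -scalemxAr /= addbF.
- move=> x y w; slots x y.
  + by rewrite !vv_rho00 pirep_Ke // -scalemxAl.
  + by rewrite mul0r qpow0 scale1r vv_rho10 //= andbF scale1r.
  + by rewrite (negPf i0) mul0r qpow0 scale1r vv_rho10 //= scale1r.
  + rewrite (vv_eq i0 j0) eqxx !vv_rho11 // pirep_Ke //.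
    by rewrite trZ -scalemxAr /= addbF.
- move=> x y w; slots x y.
  + by rewrite !vv_rho00 pirep_Kf // -scalemxAl.
  + by rewrite mul0r oppr0 qpow0 scale1r vv_rho10 //= andbF scale1r.
  + by rewrite (negPf i0) mul0r oppr0 qpow0 scale1r vv_rho10 //= scale1r.
  + rewrite (vv_eq i0 j0) eqxx !vv_rho11 // pirep_Kf //.
    by rewrite trZ -scalemxAr /= addbF.
- move=> x y w; slots x y.
  + rewrite !vv_rho00 xpair_eqE eqxx pirep_ef // mulmxDl -!scalemxAl.
    by rewrite [(_ - _) *m w]mulmxBl.
  + rewrite xpair_eqE eq_sym (negPf j0) mul0r scale0r addr0 vv_rho10 //= scalerA -sgnM.
    by rewrite andbC addbb scale1r.
  + by rewrite xpair_eqE (negPf i0) mul0r scale0r addr0 vv_rho10.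
  + rewrite (vv_eq i0 j0) xpair_eqE eqxx !vv_rho11 // pirep_ef //.
    rewrite trD trZ trZ trB.
    rewrite mulmxDr -!scalemxAr mulmxBr /= addbC; case: eqVneq => [->|_].
      by rewrite addbb.
    by rewrite !mul0r !scale0r.
Qed.

Section Basis.
Variables (a b : idx) (c : label k).
Lemma pirep_e_El : P (GE c) *m El a b =
  (a == lo c)%:R *: El (hi c) b + (eps c * (a == bar (hi c))%:R) *: El (bar (lo c)) b.
Proof. by rewrite pirep_e // mulmxDl -scalemxAl !mulEl scalerA ![_ == a]eq_sym. Qed.
Lemma pirep_f_El : P (GF c) *m El a b =
  - ((a == hi c)%:R *: El (lo c) b + (sgn F (lodd c) * eps c * (a == bar (lo c))%:R) *: El (bar (hi c)) b).
Proof.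
by rewrite pirep_f // mulmxBl mulNmx -scalemxAl !mulEl scalerA ![_ == a]eq_sym opprD.
Qed.
Lemma El_tr (x y : idx) : (El x y)^T = El y x. Proof. exact: trmx_delta. Qed.

Lemma vv_e0 : vv_rho (ord0, GE c) (El a b) =
  (a == lo c)%:R *: El (hi c) b + (eps c * (a == bar (hi c))%:R) *: El (bar (lo c)) b.
Proof. exact: pirep_e_El. Qed.
Lemma vv_f0 : vv_rho (ord0, GF c) (El a b) =
  - ((a == hi c)%:R *: El (lo c) b + (sgn F (lodd c) * eps c * (a == bar (lo c))%:R) *: El (bar (hi c)) b).
Proof. exact: pirep_f_El. Qed.
End Basis.

Lemma vv_El1 i g a b : i != ord0 ->
  vv_rho (i, g) (El a b) = sgn F (iodd a && godd g) *: (P g *m El b a)^T.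
Proof. by move=> i0; rewrite vv_rho1 // dg_El -scalemxAl trmx_mul El_tr. Qed.

Section Basis1.
Variables (i : 'I_2) (i0 : i != ord0) (a b : idx) (c : label k).
Lemma vv_e1 : vv_rho (i, GE c) (El a b) = sgn F (iodd a && lodd c) *:
  ((b == lo c)%:R *: El a (hi c) + (eps c * (b == bar (hi c))%:R) *: El a (bar (lo c))).
Proof. by rewrite vv_El1 // pirep_e_El trD !trZ !El_tr. Qed.
Lemma vv_f1 : vv_rho (i, GF c) (El a b) = - sgn F (iodd a && lodd c) *:
  ((b == hi c)%:R *: El a (lo c) + (sgn F (lodd c) * eps c * (b == bar (lo c))%:R) *: El a (bar (hi c))).
Proof. by rewrite vv_El1 // pirep_f_El linearN /= trD !trZ !El_tr scalerN scaleNr. Qed.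
End Basis1.

Definition leg (i : 'I_2) (a b : idx) : idx := if i == ord0 then a else b.
Definition gen_val (g : gen k) (l : weight R k) : F :=
  match g with
  | GE _ | GF _ => 0
  | GH c => iota (bform (alpha R c) l)
  | GK c => qpow (bform (alpha R c) l / 2)
  | GKv c => qpow (- (bform (alpha R c) l / 2))
  end.
Lemma vv_diag i g a b : match g with GE _ | GF _ => False | _ => True end ->
  vv_rho (i, g) (El a b) = gen_val g (wgt (leg i a b)) *: El a b.
Proof.
rewrite /leg => hg; have [->|i0] := eqVneq i ord0.
  by rewrite vv_rho0; case: g hg => // c _; rewrite ?pirep_K ?pirep_Kv ?pirep_h dg_El.
rewrite vv_El1 //; case: g hg => // c _; rewrite andbF scale1r ?pirep_K ?pirep_Kv ?pirep_h;
  by rewrite dg_El trZ El_tr.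
Qed.

Lemma El_span (Z : W -> Prop) : Z 0 -> (forall u v, Z u -> Z v -> Z (u + v)) ->
  (forall a u, Z u -> Z (a *: u)) -> (forall a b, Z (El a b)) -> forall w, Z w.
Proof.
move=> Z0 ZD ZZ ZE w; rewrite (matrix_sum_delta w).
apply: (big_ind Z) => // a _; apply: (big_ind Z) => // b _; exact/ZZ/ZE.
Qed.

Lemma eps0 c : eps c != 0. Proof. by rewrite /leg_sign; case: ifP; rewrite ?signr_eq0 ?oner_neq0. Qed.
Lemma sgn_neq0 b : sgn F b != 0. Proof. by rewrite signr_eq0. Qed.

Section Generate.
Variable Z : W -> Prop.
Hypotheses (Z0 : Z 0) (ZD : forall u v, Z u -> Z v -> Z (u + v)) (ZZ : forall a u, Z u -> Z (a *: u)).
Let ZI a u : a != 0 -> Z (a *: u) -> Z u.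
Proof. by move=> a0 /(ZZ a^-1); rewrite scalerA mulVf ?scale1r. Qed.
Let o1 : (sl 1 : 'I_2) != ord0. Proof. by apply/eqP => /(congr1 val); rewrite /= inordK. Qed.

(** Slot 1 first moves b while a stays at the top; slot 0 then moves a for all b at once. *)
Lemma vv_lower : Z (El (topx k) (topx k)) ->
  (forall i c w, Z w -> Z (vv_rho (i, GF c) w)) -> forall w, Z w.
Proof.
move=> Ht Zf; apply: El_span => //.
have Htop : forall b, Z (El (topx k) b).
  apply: (lower_ind hk) => // c H.
    have := Zf (sl 1) c _ H; rewrite vv_f1 // hi_blo // eqxx mulr0 scale0r addr0 scale1r.
    by apply: ZI; rewrite oppr_eq0 sgn_neq0.
  have := Zf (sl 1) c _ H; rewrite vv_f1 // eq_sym hi_blo // eqxx scale0r add0r mulr1 scalerA.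
  by apply: ZI; rewrite !mulf_neq0 ?oppr_eq0 ?sgn_neq0 ?eps0.
apply: (lower_ind hk) => // c H b.
  have := Zf ord0 c _ (H b); rewrite vv_f0 // hi_blo // eqxx mulr0 scale0r addr0 scale1r -scaleN1r.
  by apply: ZI; rewrite oppr_eq0 oner_neq0.
have := Zf ord0 c _ (H b); rewrite vv_f0 // eq_sym hi_blo // eqxx scale0r add0r mulr1 -scaleNr.
by apply: ZI; rewrite oppr_eq0 !mulf_neq0 ?sgn_neq0 ?eps0.
Qed.

Lemma vv_raise : Z (El (botx k) (botx k)) ->
  (forall i c w, Z w -> Z (vv_rho (i, GE c) w)) -> forall w, Z w.
Proof.
move=> Ht Ze; apply: El_span => //.
have Htop : forall b, Z (El (botx k) b).
  apply: (raise_ind hk) => // c H.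
    have := Ze (sl 1) c _ H; rewrite vv_e1 // lo_bhi // eqxx mulr0 scale0r addr0 scale1r.
    by apply: ZI; rewrite sgn_neq0.
  have := Ze (sl 1) c _ H; rewrite vv_e1 // eq_sym lo_bhi // eqxx scale0r add0r mulr1 scalerA.
  by apply: ZI; rewrite !mulf_neq0 ?sgn_neq0 ?eps0.
apply: (raise_ind hk) => // c H b.
  by have := Ze ord0 c _ (H b); rewrite vv_e0 // lo_bhi // eqxx mulr0 scale0r addr0 scale1r.
have := Ze ord0 c _ (H b); rewrite vv_e0 // eq_sym lo_bhi // eqxx scale0r add0r mulr1.
exact: ZI (eps0 c).
Qed.
End Generate.

Lemma vv_e_top x : opE vv_rho x (El (topx k) (topx k)) = 0.
Proof.
case: x => i c; rewrite /opE /=; have [->|i0] := eqVneq i ord0.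
  by rewrite vv_e0 (top_lo hk) (top_bhi hk) mulr0 !scale0r addr0.
by rewrite vv_e1 // (top_lo hk) (top_bhi hk) mulr0 !scale0r addr0 scaler0.
Qed.
Lemma vv_f_bot x : opF vv_rho x (El (botx k) (botx k)) = 0.
Proof.
case: x => i c; rewrite /opF /=; have [->|i0] := eqVneq i ord0.
  by rewrite vv_f0 (bot_hi hk) (bot_blo hk) mulr0 !scale0r addr0 oppr0.
by rewrite vv_f1 // (bot_hi hk) (bot_blo hk) mulr0 !scale0r addr0 scaler0.
Qed.

Let pm := vv_premodule.
Let ker_lin (S : W -> W) : linear S -> [/\ S 0 = 0,
  forall u v, S u = 0 -> S v = 0 -> S (u + v) = 0 & forall a u, S u = 0 -> S (a *: u) = 0].
Proof.
move=> Sl; have S0 : S 0 = 0 by rewrite -[X in S X](addNr 0) -scaleN1r Sl scaleN1r addNr.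
split=> // [u v hu hv|a u hu]; first by rewrite -[u]scale1r Sl hu hv scaler0 addr0.
by rewrite -[X in S X]addr0 Sl hu S0 scaler0 addr0.
Qed.

Lemma vv_serreE : serre_in iota q (eq^~ 0) (opE vv_rho).
Proof.
apply: (serre_in_generated (opE_comm hq pm) (opE_sq hk hq pm) (opE_cubic hq pm)
  (opE_yamane hk hq pm) vv_e_top) => S Sl St SF.
have [S0 SD SZ] := ker_lin Sl; apply: (vv_lower (Z := fun w => S w = 0)) => // i c w hw.
have [a a0 Ha] := SF (i, c); apply: (scalerI a0).
by rewrite scaler0 -Ha hw linear0.
Qed.

Lemma vv_serreF : serre_in iota q (eq^~ 0) (opF vv_rho).
Proof.
apply: (serre_in_generated (opF_comm hq pm) (opF_sq hk hq pm) (opF_cubic hq pm)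
  (opF_yamane hk hq pm) vv_f_bot) => S Sl St SF.
have [S0 SD SZ] := ker_lin Sl; apply: (vv_raise (Z := fun w => S w = 0)) => // i c w hw.
have [a a0 Ha] := SF (i, c); apply: (scalerI a0).
by rewrite scaler0 -Ha hw linear0.
Qed.

Lemma vv_relI x w : relI iota q x -> act vv_rho x w = 0.
Proof.
move=> hx; apply: (relI_act hk hq pm _ _ _ vv_serreE vv_serreF hx) => //.
- by move=> a u v -> ->; rewrite scaler0 addr0.
- by move=> g u ->; rewrite linear0.
Qed.

Lemma pirep_e_step (c : label k) (x : idx) : exists (t : F) (x' : idx), (t != 0 -> (wrank x' < wrank x)%N) /\
  forall b, P (GE c) *m El x b = t *: El x' b.
Proof.
have [->|nl] := eqVneq x (lo c).
  exists 1, (hi c); split=> [_|b]; first exact: wrank_hi_lo.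
  by rewrite pirep_e_El eqxx lo_bhi // mulr0 scale0r addr0.
have [->|nb] := eqVneq x (bar (hi c)).
  exists (eps c), (bar (lo c)); split=> [_|b]; first exact: wrank_bar.
  by rewrite pirep_e_El eqxx eq_sym lo_bhi // mulr1 scale0r add0r.
exists 0, x; split=> [|b]; first by rewrite eqxx.
by rewrite pirep_e_El (negPf nl) (negPf nb) mulr0 !scale0r addr0.
Qed.

Lemma vv_e_step i c a b : exists (t : F) (a' b' : idx),
  (t != 0 -> (wrank (leg i a' b') < wrank (leg i a b))%N) /\
  vv_rho (i, GE c) (El a b) = t *: El a' b'.
Proof.
rewrite /leg; have [->|i0] := eqVneq i ord0.
  by have [t [x [tx E]]] := pirep_e_step c a; exists t, x, b; rewrite vv_rho0 E.
have [t [x [tx E]]] := pirep_e_step c b.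
exists (sgn F (iodd a && lodd c) * t), a, x; split.
  by rewrite mulf_eq0 negb_or => /andP[_]; apply: tx.
by rewrite vv_El1 // E trZ El_tr scalerA.
Qed.

Lemma vv_nil i (s : seq (label k)) a b : (wrank (leg i a b) < size s)%N ->
  foldr (fun c => vv_rho (i, GE c)) (El a b) s = 0.
Proof.
have F0 t : foldr (fun c => vv_rho (i, GE c) : W -> W) 0 t = 0 by elim: t => //= c t ->; rewrite linear0.
have FZ t z w : foldr (fun c => vv_rho (i, GE c) : W -> W) (z *: w) t
    = z *: foldr (fun c => vv_rho (i, GE c) : W -> W) w t.
  by elim: t => //= c t ->; rewrite linearZ_LR.
elim/last_ind: s a b => // s c IH a b; rewrite size_rcons ltnS => hs.
rewrite foldr_rcons; have [t [a' [b' [ht ->]]]] := vv_e_step i c a b.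
rewrite FZ; have [->|t0] := eqVneq t 0; first by rewrite scale0r.
by rewrite IH ?scaler0 //; apply: leq_trans (ht t0) hs.
Qed.

(** A raising generator lowers [wrank] in its slot, and there are 2k + 2 ranks; hence this value of
    [M] works for all basis vectors. *)
Lemma vv_nbI a b x : nbI iota q (wt2 (wgt a) (wgt b)) (2 * k).+2 x ->
  act vv_rho x (El a b) = 0.
Proof.
move=> hx; apply: (nbI_act (rho := vv_rho) (Z := eq^~ 0) _ _ _ _ _ _ _ hx) => //.
- by move=> t u v -> ->; rewrite scaler0 addr0.
- by move=> g u ->; rewrite linear0.
- by move=> y hy w; apply: vv_relI.
- by move=> i c; rewrite vv_diag // /= bformC /leg /wt2; case: ifP.
- by move=> i c; rewrite vv_diag // /= bformC /leg /wt2; case: ifP.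
- by move=> i s hs; apply: vv_nil; rewrite hs; apply: wrank_lt.
Qed.
End VecSquare.

(** * The claimed R-matrix *)

Section RMatrix.
Variables (R : realType) (F : fieldType) (iota : {rmorphism R -> F}).
Variables (k : nat) (q : R).
Hypotheses (hk : (0 < k)%N) (hq : 0 < q) (hq1 : q != 1).
Local Notation idx := (idx k).
Local Notation wgt := (@wgt R k).
Local Notation El := (@El F k).
Local Notation P := (@pirep R F iota k q).
Local Notation eps := (@leg_sign F k).
Local Notation xi := (@xi F k).
Local Notation qpow := (qpow iota q).
Local Notation W := 'M[F]_((2 * k).+2).
Local Notation vv_rho := (vv_rho iota q).
Local Notation rho := (@rho R k).
Local Notation lam := (iota q - (iota q)^-1).

(** The product [zeta a * zinv b] is (-1)^[b] times xi_a xi_b q^(rho, eps_a - eps_b), the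
    coefficient in the second part of the claimed formula; so a and b separate. *)
Definition zeta (a : idx) : F := xi a * qpow (bform rho (wgt a)).
Definition zinv (a : idx) : F := sgn F (iodd a) * xi a * qpow (- bform rho (wgt a)).
(** A truncation to the weights below that of x. The full sum over a is annihilated by the
    transposed coproduct of every e_c, so only boundary terms survive when the latter acts on a
    truncation. *)
Definition barsum (x : idx) : W := \sum_(a | gtw x a) zeta a *: El a (bar a).
(** The value of the claimed matrix on v_x (x) v_y. The signs of the formula and of the graded
    tensor product combine to (-1)^([x][y]) in the first correction term. *)
Definition R_basis (x y : idx) : W := qpow (bform (wgt x) (wgt y)) *: El x y
  + lam *: (((gtw x y)%:R * sgn F (iodd x && iodd y)) *: El y x
            - ((y == bar x)%:R * zinv x) *: barsum x).

Lemma gtw_irr (x : idx) : gtw x x = false. Proof. exact: ltnn. Qed.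

Lemma Xv_diag a : R_basis a a = qpow (wsq R a) *: El a a.
Proof.
rewrite /R_basis gtw_irr [a == _]eq_sym bar_neq // !mul0r !scale0r subr0 scaler0 addr0 bform_wgt //.
by rewrite eqxx [a == _]eq_sym bar_neq // subr0 mulr1.
Qed.
Lemma Xv_bar a : R_basis a (bar a) = qpow (- wsq R a) *: El a (bar a)
  + lam *: (((gtw a (bar a))%:R * sgn F (iodd a)) *: El (bar a) a - zinv a *: barsum a).
Proof.
rewrite /R_basis iodd_bar // andbb eqxx mul1r; congr (qpow _ *: _ + _).
by rewrite bform_wgt // (barK hk) eqxx [a == _]eq_sym bar_neq // sub0r mulrN1.
Qed.
Lemma Xv_off a b : a != b -> a != bar b ->
  R_basis a b = El a b + (lam * ((gtw a b)%:R * sgn F (iodd a && iodd b))) *: El b a.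
Proof.
move=> /negPf ab /negPf ab'; rewrite /R_basis bform_wgt // ab ab' subrr mulr0 qpow0 scale1r.
by rewrite -[b == _](inj_eq (bar_inj hk)) (barK hk) eq_sym ab' mul0r scale0r subr0 scalerA.
Qed.

Lemma xi_sign a : xi a = 1 \/ xi a = -1.
Proof.
rewrite /Defs.xi; case: ifP => _; last by left.
by rewrite -signr_odd; case: (odd _); [right|left]; rewrite ?expr1.
Qed.
Lemma xi_bar (a : idx) : xi (bar a) = (if iodd a then - xi a else 1).
Proof.
rewrite /Defs.xi iodd_bar //; case: ifP => // ha; move: ha (ltn_ord a); rewrite /iodd => h1 h2.
have e : odd (2 * k + 3 - a).-1 = ~~ odd a.-1 by lia.
rewrite val_bar // h1 -[LHS]signr_odd e -[in RHS]signr_odd.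
by case: (odd _); rewrite ?expr1 ?expr0 ?opprK.
Qed.

Variable c : label k.
Local Notation h := (hi c).
Local Notation l := (lo c).
Local Notation h' := (bar (hi c)).
Local Notation l' := (bar (lo c)).

Definition kap (a : idx) : F := qpow (bform (alpha R c) (wgt a) / 2).
Local Notation s := (qpow (1 / 2)).

Lemma lo_hi_neq : (l == h) = false. Proof. by rewrite eq_sym hi_lo. Qed.
Lemma blo_hi_neq : (l' == h) = false. Proof. by rewrite eq_sym hi_blo. Qed.
Lemma bhi_lo_neq : (h' == l) = false. Proof. by rewrite eq_sym lo_bhi. Qed.
Lemma bhi_hi_neq : (h' == h) = false. Proof. by rewrite bar_neq. Qed.
Lemma blo_lo_neq : (l' == l) = false. Proof. by rewrite bar_neq. Qed.
Lemma hi_bhi_neq : (h == h') = false. Proof. by rewrite eq_sym bar_neq. Qed.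
Lemma lo_blo_neq : (l == l') = false. Proof. by rewrite eq_sym bar_neq. Qed.
Lemma bhi_blo_neq : (h' == l') = false. Proof. by rewrite (inj_eq (bar_inj hk)) hi_lo. Qed.
Lemma blo_bhi_neq : (l' == h') = false. Proof. by rewrite (inj_eq (bar_inj hk)) lo_hi_neq. Qed.
Let neqs := (lo_hi_neq, hi_lo hk c, blo_hi_neq, hi_blo hk c, bhi_lo_neq, lo_bhi hk c c, bhi_hi_neq, blo_lo_neq, hi_bhi_neq, lo_blo_neq, bhi_blo_neq, blo_bhi_neq, eqxx).

Lemma gt_hi_lo : gtw h l. Proof. exact: wrank_hi_lo hk c. Qed.
Lemma gt_blo_bhi : gtw l' h'. Proof. exact: wrank_bar hk c. Qed.
(** Between [hi c] and [lo c] in the order there is at most [bar (lo c)], and that only for the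
    label t. *)
Lemma gt_hi (b : idx) : b != l -> b != l' -> b != h -> gtw h b = gtw l b.
Proof.
have hk1 := hk; have hb := ltn_ord b; rewrite -!val_eqE /= ?val_bar // ?val_hi // ?val_lo //.
rewrite /gtw /wrank ?iodd_bar // ?iodd_hi ?iodd_lo // ?val_bar // ?val_hi // ?val_lo // /iodd.
by case: (c) => [c'||]; [have := ltn_ord c' | |]; rewrite /=; do ? case: ifP; lia.
Qed.
Lemma gt_bhi (b : idx) : b != l -> b != l' -> b != h' -> gtw l' b = gtw h' b.
Proof.
have hk1 := hk; have hb := ltn_ord b; rewrite -!val_eqE /= ?val_bar // ?val_hi // ?val_lo //.
rewrite /gtw /wrank ?iodd_bar // ?iodd_hi ?iodd_lo // ?val_bar // ?val_hi // ?val_lo // /iodd.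
by case: (c) => [c'||]; [have := ltn_ord c' | |]; rewrite /=; do ? case: ifP; lia.
Qed.
Lemma gt_hi_blo : gtw h l'. Proof.
have hk1 := hk; rewrite /gtw /wrank ?iodd_bar // ?iodd_hi ?iodd_lo // ?val_bar // ?val_hi // ?val_lo //.
by case: (c) => [c'||]; [have := ltn_ord c' | |]; rewrite /=; do ? case: ifP; lia.
Qed.
Lemma gt_lo_bhi : gtw l h'. Proof.
have hk1 := hk; rewrite /gtw /wrank ?iodd_bar // ?iodd_hi ?iodd_lo // ?val_bar // ?val_hi // ?val_lo //.
by case: (c) => [c'||]; [have := ltn_ord c' | |]; rewrite /=; do ? case: ifP; lia.
Qed.
Lemma gt_hi_bhi : gtw h h'. Proof. exact: ltn_trans gt_hi_lo gt_lo_bhi. Qed.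
(** The order of these two depends on the label: [lo c] is the lower one exactly for t, where its
    weight is -eps_1. *)
Lemma gt_bar : gtw l' l = ~~ gtw l l'. Proof.
have hk1 := hk; rewrite /gtw /wrank ?iodd_bar // ?iodd_hi ?iodd_lo // ?val_bar // ?val_hi // ?val_lo //.
by case: (c) => [c'||]; [have := ltn_ord c' | |]; rewrite /=; do ? case: ifP; lia.
Qed.
Lemma gt_asym (x y : idx) : gtw x y -> gtw y x = false. Proof. by rewrite /gtw; lia. Qed.

Lemma barsumE x : barsum x = \sum_a (gtw x a)%:R *: (zeta a *: El a (bar a)).
Proof.
rewrite /barsum big_mkcond; apply: eq_bigr => a _.
by case: ifP; rewrite ?scale1r ?scale0r.
Qed.
Lemma sum_pick (x : idx) (f : idx -> W) : \sum_a (a == x)%:R *: f a = f x.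
Proof.
rewrite (bigD1 x) //= eqxx scale1r big1 ?addr0 // => a /negPf ->.
by rewrite scale0r.
Qed.
Let zb (a : idx) := zeta a *: El a (bar a).
Let zl_sum : zeta l *: El l l' = \sum_a (a == l)%:R *: zb a.
Proof. by rewrite sum_pick. Qed.
Let zl'_sum : zeta l' *: El l' l = \sum_a (a == l')%:R *: zb a.
Proof. by rewrite sum_pick /zb barK. Qed.
Let zh'_sum : zeta h' *: El h' h = \sum_a (a == h')%:R *: zb a.
Proof. by rewrite sum_pick /zb barK. Qed.
(** Going up from l to h, the truncated sum gains the term at l and, if l' lies between them, the
    term at l'. *)
Lemma barsum_hi : barsum h = barsum l + zeta l *: El l l' + ((~~ gtw l l')%:R * zeta l') *: El l' l.
Proof.
rewrite !barsumE -scalerA zl_sum zl'_sum scaler_sumr -!big_split /=.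
apply: eq_bigr => a _; rewrite -/(zb a) [_ *: (_ *: zb a)]scalerA -!scalerDl; congr (_ *: _).
have [->|al] := eqVneq a l; first by rewrite gt_hi_lo gtw_irr ?neqs mulr0 addr0 add0r.
have [->|al'] := eqVneq a l'.
  by rewrite gt_hi_blo mulr1 addr0; case: gtw; rewrite ?addr0 ?add0r.
have [->|ah] := eqVneq a h; last by rewrite gt_hi // mulr0 !addr0.
by rewrite gtw_irr (gt_asym gt_hi_lo) mulr0 !addr0.
Qed.
Lemma barsum_blo : barsum l' = barsum h' + zeta h' *: El h' h + ((~~ gtw l l')%:R * zeta l) *: El l l'.
Proof.
rewrite !barsumE -scalerA zl_sum zh'_sum scaler_sumr -!big_split /=.
apply: eq_bigr => a _; rewrite -/(zb a) [_ *: (_ *: zb a)]scalerA -!scalerDl; congr (_ *: _).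
have [->|ah'] := eqVneq a h'.
  by rewrite gt_blo_bhi gtw_irr ?neqs mulr0 addr0 add0r.
have [->|al] := eqVneq a l.
  by rewrite gt_bar (gt_asym gt_lo_bhi) mulr1 addr0 add0r.
have [->|al'] := eqVneq a l'; last by rewrite gt_bhi // mulr0 !addr0.
by rewrite gtw_irr (gt_asym gt_blo_bhi) mulr0 !addr0.
Qed.

Definition copT_e : {linear W -> W} :=
  (vv_rho (sl 1, GK c) \o vv_rho (ord0, GE c)) \+ (vv_rho (sl 1, GE c) \o vv_rho (ord0, GKv c)).
Local Notation D := copT_e.
Lemma DE a b : D (El a b) =
  (a == l)%:R *: (kap b *: El h b) + (eps c * (a == h')%:R) *: (kap b *: El l' b)
  + (kap a)^-1 *: (sgn F (iodd a && lodd c) *: ((b == l)%:R *: El a h + (eps c * (b == h')%:R) *: El a l')).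
Proof.
have o1 : (sl 1 : 'I_2) != ord0 by apply/eqP => /(congr1 val); rewrite /= inordK.
have vvD i g u v : vv_rho (i, g) (u + v) = vv_rho (i, g) u + vv_rho (i, g) v := raddfD _ u v.
have vvZ i g t u : vv_rho (i, g) (t *: u) = t *: vv_rho (i, g) u := linearZ_LR _ t u.
rewrite -[LHS]/(vv_rho (sl 1, GK c) (vv_rho (ord0, GE c) (El a b))
  + vv_rho (sl 1, GE c) (vv_rho (ord0, GKv c) (El a b))).
have dK a' b' : vv_rho (sl 1, GK c) (El a' b') = kap b' *: El a' b'.
  by rewrite vv_diag // /leg (negPf o1).
have dKv a' b' : vv_rho (ord0, GKv c) (El a' b') = (kap a')^-1 *: El a' b'.
  by rewrite vv_diag // /leg /gen_val /= (qpowN iota).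
by rewrite dKv vvZ vv_e0 // vv_e1 // vvD !vvZ !dK [(eps c * _) *: _]scalerA mulrC -scalerA.
Qed.
Lemma D_barsum x : D (barsum x) =
  ((gtw x l)%:R * zeta l * kap l') *: El h l'
  + ((gtw x h')%:R * zeta h' * eps c * kap h + (gtw x l')%:R * zeta l' * (kap l')^-1 * sgn F (iodd l && lodd c)) *: El l' h
  + ((gtw x h)%:R * zeta h * eps c * (kap h)^-1 * sgn F (lodd c)) *: El h l'.
Proof.
pose g (a : idx) : F := (gtw x a)%:R * zeta a.
have -> : barsum x = \sum_a g a *: El a (bar a).
  by rewrite barsumE; apply: eq_bigr => a _; rewrite scalerA.
have DZ a u : D (a *: u) = a *: D u := linearZ_LR D a u.
rewrite linear_sum.
have bq (u v : idx) : (bar u == v) = (u == bar v) by rewrite -{1}[v](barK hk) (inj_eq (bar_inj hk)).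
rewrite (eq_bigr (fun a => (a == l)%:R *: ((g a * kap (bar a)) *: El h (bar a))
  + (a == h')%:R *: ((g a * eps c * kap (bar a)) *: El l' (bar a))
  + (a == l')%:R *: ((g a * (kap a)^-1 * sgn F (iodd a && lodd c)) *: El a h)
  + (a == h)%:R *: ((g a * eps c * (kap a)^-1 * sgn F (iodd a && lodd c)) *: El a l'))); last first.
  move=> a _; rewrite DZ DE !bq (barK hk).
  by lincomb F (W : lmodType F); ring.
rewrite !big_split /= !sum_pick !(barK hk) iodd_hi // iodd_bar //.
by lincomb F (W : lmodType F); rewrite /g /=; ring.
Qed.
Lemma D_barsum_lo : D (barsum l) = (zeta h' * eps c * kap h + (gtw l l')%:R * zeta l' * (kap l')^-1) *: El l' h.
Proof.
rewrite D_barsum gtw_irr (gt_asym gt_hi_lo) gt_lo_bhi !mul0r !scale0r add0r addr0 mul1r.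
by rewrite iodd_lo // andNb /sgn expr0 mulr1.
Qed.
Lemma D_barsum_bhi : D (barsum h') = 0.
Proof.
have gh : gtw h' h = false by apply/gt_asym/gt_hi_bhi.
rewrite D_barsum gtw_irr (gt_asym gt_lo_bhi) (gt_asym gt_blo_bhi) gh.
by rewrite !mul0r addr0 !scale0r !addr0.
Qed.

Lemma kap_hi : kap h = s^-1.
Proof.
rewrite /kap bform_alpha // !neqs /= -?(qpowN iota).
by case: (lodd c); congr qpow; rewrite ?expr1 ?expr0; lra.
Qed.
Lemma kap_bhi : kap h' = s.
Proof.
rewrite /kap bform_alpha // !neqs /= -?(qpowN iota).
by case: (lodd c); congr qpow; rewrite ?expr1 ?expr0; lra.
Qed.
Lemma kap_lo : kap l = if lodd c then s^-1 else s.
Proof.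
rewrite /kap bform_alpha // !neqs /= -?(qpowN iota).
by case: (lodd c); congr qpow; rewrite ?expr1 ?expr0; lra.
Qed.
Lemma kap_blo : kap l' = if lodd c then s else s^-1.
Proof.
rewrite /kap bform_alpha // !neqs /= -?(qpowN iota).
by case: (lodd c); congr qpow; rewrite ?expr1 ?expr0; lra.
Qed.
Lemma kap_other b : b != h -> b != l -> b != h' -> b != l' -> kap b = 1. Proof.
move=> /negPf b1 /negPf b2 /negPf b3 /negPf b4; rewrite /kap bform_alpha // b1 b2 b3 b4.
by rewrite subr0 mulr0 addr0 mul0r qpow0.
Qed.

Let s0 : s != 0 := qpow_neq0 iota hq _.
Let lamE : lam = s ^+ 2 - s ^- 2.
Proof. by rewrite (qhalf_sq iota hq). Qed.

Lemma xi_lo : xi l = if lodd c then 1 else - xi h.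
Proof.
rewrite /Defs.xi iodd_lo // iodd_hi // val_lo // val_hi //; case: (c) => [c'||] //=.
by rewrite exprS mulN1r.
Qed.
Lemma xi_hi : lodd c -> xi h = eps c.
Proof. by rewrite /Defs.xi /leg_sign iodd_hi // val_hi //; case: (c) => [c'||]. Qed.
Lemma bform_rho j : (0 < j <= k)%N -> bform rho (coordw R k j) = - (k - j)%:R.
Proof.
move=> /andP[j0 jk]; rewrite bformC (bform_coordwl _ (jk : (j < k.+1)%N)) gtn_eqF // mulN1r; congr (- _).
rewrite /Defs.rho summxE (bigD1_seq j) /= ?mem_index_iota ?iota_uniq ?j0 //= big1_seq => [|i].
  by rewrite !mxE /= eqxx mulr1 addr0.
by move=> /andP[/negPf ij _]; rewrite !mxE /= eq_sym ij mulr0.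
Qed.
Lemma bform_rho0 : bform rho (coordw R k 0) = 0.
Proof.
rewrite bformC (bform_coordwl _ (isT : (0 < k.+1)%N)) mul1r /Defs.rho summxE big1_seq // => i.
by rewrite mem_index_iota => /andP[_ /andP[i0 _]]; rewrite !mxE /= ltn_eqF // mulr0.
Qed.
Definition qr := qpow (bform rho (wgt h)).
(** (rho, alpha_c) is -1 for an even label; for an odd one both ends of the leg are orthogonal to
    rho. *)
Lemma qr_lo : qpow (bform rho (wgt l)) = if lodd c then 1 else qr * s ^+ 2.
Proof.
rewrite -(qpow_half iota hq) /qr -(qpowD iota hq).
case: (c) => [c'||] /=; rewrite ?wgt_bar // ?wgt_evx1 // ?bformNr ?bform_rho0 ?oppr0 ?qpow0 //.
have := ltn_ord c' => hc; rewrite !wgt_odx //; try lia.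
rewrite !bform_rho; try lia; congr qpow.
have -> : (k - c'.+1 = (k - c'.+2).+1)%N by lia.
by rewrite -natr1; lra.
Qed.
Lemma qr_hi : lodd c -> qr = 1.
Proof.
rewrite /qr; case: (c) => [c'||] //= _; rewrite wgt_odx ?bform_rho ?subnn ?oppr0 ?qpow0 //; lia.
Qed.

Lemma zeta_bhi : zeta h' = - (xi h * qr^-1).
Proof. by rewrite /zeta xi_bar iodd_hi // wgt_bar // bformNr (qpowN iota) mulNr. Qed.
Lemma zeta_lo : zeta l = if lodd c then 1 else - (xi h * (qr * s ^+ 2)).
Proof. by rewrite /zeta qr_lo xi_lo; case: (lodd c); rewrite ?mulr1 ?mulNr. Qed.
Lemma zeta_blo : zeta l' = if lodd c then 1 else xi h * (qr * s ^+ 2)^-1.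
Proof.
rewrite /zeta xi_bar iodd_lo // wgt_bar // bformNr (qpowN iota) qr_lo xi_lo.
by case: (lodd c) => /=; rewrite ?invr1 ?mulr1 ?opprK.
Qed.
Lemma zinv_hi : zinv h = - (xi h * qr^-1).
Proof. by rewrite /zinv iodd_hi // (qpowN iota) /sgn expr1 mulN1r mulNr. Qed.
Lemma zinv_bhi : zinv h' = xi h * qr.
Proof.
by rewrite /zinv iodd_bar // xi_bar iodd_hi // wgt_bar // bformNr opprK /sgn expr1 mulN1r opprK.
Qed.
Lemma zinv_lo : zinv l = if lodd c then 1 else xi h * (qr * s ^+ 2)^-1.
Proof.
rewrite /zinv iodd_lo // (qpowN iota) qr_lo xi_lo /sgn.
by case: (lodd c) => /=; rewrite ?expr0 ?expr1 ?invr1 ?mulr1 // mulN1r opprK.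
Qed.
Lemma zinv_blo : zinv l' = if lodd c then 1 else - (xi h * (qr * s ^+ 2)).
Proof.
rewrite /zinv iodd_bar // xi_bar iodd_lo // wgt_bar // bformNr opprK qr_lo xi_lo /sgn.
by case: (lodd c) => /=; rewrite ?expr0 ?expr1 ?mulr1 // opprK mulN1r mulNr.
Qed.
Lemma q_hi : qpow (wsq R h) = s ^- 2.
Proof. by rewrite /wsq iodd_hi // (qpowN iota) (qpow1 iota hq) (qhalf_sq iota hq). Qed.
Lemma q_lo : qpow (wsq R l) = if lodd c then s ^+ 2 else s ^- 2.
Proof. by rewrite /wsq iodd_lo //; case: (lodd c) => /=; rewrite ?(qpowN iota) (qpow1 iota hq) (qhalf_sq iota hq). Qed.

Let DD u v : D (u + v) = D u + D v := linearD D u v.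
Let DZ a u : D (a *: u) = a *: D u := linearZ_LR D a u.
Let DN u : D (- u) = - D u := linearN D u.
Let qr0 : qr != 0 := qpow_neq0 iota hq _.
Let Dlin := (DD, DZ, DN, DE, D_barsum_lo, D_barsum_bhi).
Let par := (iodd_bar hk, iodd_hi hk c, iodd_lo hk c).
Let vals := (kap_hi, kap_bhi, kap_lo, kap_blo, zeta_bhi, zeta_lo, zeta_blo, zinv_hi, zinv_bhi, zinv_lo, zinv_blo).

Let wsq_bar (a : idx) : wsq R (bar a) = wsq R a. Proof. by rewrite /wsq iodd_bar. Qed.
Lemma Xv_barl a : R_basis (bar a) a = qpow (- wsq R a) *: El (bar a) a
  + lam *: (((gtw (bar a) a)%:R * sgn F (iodd a)) *: El a (bar a) - zinv (bar a) *: barsum (bar a)).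
Proof. by have := Xv_bar (bar a); rewrite (barK hk) iodd_bar // wsq_bar. Qed.

Lemma Xv_lt a b : gtw b a -> a != bar b -> R_basis a b = El a b.
Proof.
move=> ba ab'; rewrite Xv_off ?(gt_asym ba) ?mul0r ?mulr0 ?scale0r ?addr0 //.
by apply/eqP => ab; rewrite ab gtw_irr in ba.
Qed.
Lemma Xv_gt a b : gtw a b -> a != bar b ->
  R_basis a b = El a b + (lam * sgn F (iodd a && iodd b)) *: El b a.
Proof.
move=> ba ab'; rewrite Xv_off ?ba ?mul1r //.
by apply/eqP => ab; rewrite ab gtw_irr in ba.
Qed.
Let Xlh : R_basis l h = El l h. Proof. by rewrite Xv_lt ?gt_hi_lo // neqs. Qed.
Let Xh'l : R_basis h' l = El h' l. Proof. by rewrite Xv_lt ?gt_lo_bhi // neqs. Qed.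
Let Xh'l' : R_basis h' l' = El h' l'. Proof. by rewrite Xv_lt ?gt_blo_bhi // (barK hk) neqs. Qed.
Let Xl'h : R_basis l' h = El l' h. Proof. by rewrite Xv_lt ?gt_hi_blo // neqs. Qed.
Let Xhl : R_basis h l = El h l + (lam * sgn F (~~ lodd c)) *: El l h.
Proof. by rewrite Xv_gt ?gt_hi_lo // ?neqs // !par. Qed.
Let Xhl' : R_basis h l' = El h l' + (lam * sgn F (~~ lodd c)) *: El l' h.
Proof. by rewrite Xv_gt ?gt_hi_blo // ?(barK hk) ?neqs // !par. Qed.
Let Xlh' : R_basis l h' = El l h' + (lam * sgn F (~~ lodd c)) *: El h' l.
Proof. by rewrite Xv_gt ?gt_lo_bhi // ?(barK hk) ?neqs // !par andbT. Qed.
Let Xl'h' : R_basis l' h' = El l' h' + (lam * sgn F (~~ lodd c)) *: El h' l'.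
Proof. by rewrite Xv_gt ?gt_blo_bhi // ?(barK hk) ?neqs // !par andbT. Qed.
Let Xs := (Xlh, Xh'l, Xh'l', Xl'h, Xhl, Xhl', Xlh', Xl'h').
Lemma gt_even : ~~ lodd c -> gtw l l'.
Proof.
have hk1 := hk; rewrite /gtw /wrank ?iodd_bar // ?iodd_lo // ?val_bar // ?val_lo //.
by case: (c) => [c'||] //= _; have := ltn_ord c'; do ? case: ifP; lia.
Qed.
Lemma eps_even : ~~ lodd c -> eps c = 1. Proof. by rewrite /leg_sign => /negPf ->. Qed.
Lemma eps_sign : eps c = 1 \/ eps c = -1.
Proof.
rewrite /leg_sign; case: ifP => _; last by left.
by rewrite -signr_odd; case: (odd _); [right|left]; rewrite ?expr1.
Qed.
(** The parity of c, the sign xi or eps, and the order of l and l' are split off; what remains is an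
    identity of rational functions in q^(1/2) and [qr]. *)
Ltac scalars :=
  let pc := fresh "pc" in let t := fresh "t" in let r := fresh "r" in
  let ex := fresh "ex" in let t0 := fresh "t0" in let r0 := fresh "r0" in
  rewrite /sgn; case: (boolP (lodd c)) => pc /=; rewrite ?expr1 ?expr0;
  [ rewrite ?(xi_hi pc) ?(qr_hi pc); case: eps_sign => ex; rewrite ?ex | rewrite ?(eps_even pc) ?(gt_even pc); case: (xi_sign h) => ex; rewrite ?ex ];
  case: (gtw l l') => /=;
  generalize s0 qr0; generalize (qpow (1 / 2)) qr; move=> t r t0 r0; field; rewrite ?t0 ?r0 ?oner_neq0.

(** The intertwining relation of e_c on v_a (x) v_b for a = [lo c]. With [Xv_step_bhi] it covers the
    two a where e_c v_a is nonzero, which is all that the induction over a needs. *)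
Lemma Xv_step_lo b : kap l *: ((b == l)%:R *: R_basis l h + (eps c * (b == h')%:R) *: R_basis l l')
  + (kap b)^-1 *: R_basis h b = D (R_basis l b).
Proof.
have [->|bl] := eqVneq b l.
  rewrite Xv_diag !Xs !Dlin !neqs !par !vals q_lo ?lamE.
  by lincomb F (W : lmodType F); scalars.
have [->|bh] := eqVneq b h.
  rewrite Xv_diag !Xs !Dlin !neqs !par !vals q_hi ?lamE.
  by lincomb F (W : lmodType F); scalars.
have [->|bl'] := eqVneq b l'.
  rewrite Xv_bar !Xs !Dlin !neqs !par !vals (qpowN iota) q_lo ?lamE.
  by lincomb F (W : lmodType F); scalars.
(* Here truncated sums come from both l (x) l' and h (x) h'; [barsum_hi] leaves only boundary terms
   of their combination. *)
have [->|bh'] := eqVneq b h'.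
  rewrite !Xv_bar !Xs gt_hi_bhi !Dlin !neqs !par !barsum_hi !vals !(qpowN iota) q_lo q_hi ?lamE.
  by lincomb F (W : lmodType F); scalars.
have bq (u v : idx) : (bar u == v) = (u == bar v) by rewrite -{1}[v](barK hk) (inj_eq (bar_inj hk)).
rewrite (@Xv_off h b) ?(@Xv_off l b) -?bq ?[_ == b]eq_sym // gt_hi // !Dlin !neqs !par !vals.
rewrite ?(negPf bl) ?(negPf bh') kap_other //.
rewrite !(mulr0, scale0r, scaler0, addr0, add0r, scale1r, invr1).
move: lam ((gtw l b)%:R : F) => z w; rewrite /sgn.
by lincomb F (W : lmodType F); case: (lodd c); case: (iodd b); rewrite /= ?expr1 ?expr0; ring.
Qed.

Lemma Xv_step_bhi b : (kap h' * sgn F (lodd c)) *: ((b == l)%:R *: R_basis h' h + (eps c * (b == h')%:R) *: R_basis h' l')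
  + (eps c * (kap b)^-1) *: R_basis l' b = D (R_basis h' b).
Proof.
have Xh'h := Xv_barl h; have Xl'l := Xv_barl l.
have gh : gtw h' h = false by apply/gt_asym/gt_hi_bhi.
have [->|bl] := eqVneq b l.
  rewrite !Xs Xh'h Xl'l gt_bar gh barsum_blo !Dlin !neqs !par !vals !(qpowN iota) q_lo q_hi lamE.
  by lincomb F (W : lmodType F); scalars.
have [->|bh] := eqVneq b h.
  rewrite Xh'h gh !Xs !Dlin !neqs !par !vals !(qpowN iota) q_hi ?lamE.
  by lincomb F (W : lmodType F); scalars.
have [->|bl'] := eqVneq b l'.
  rewrite Xv_diag !Xs !Dlin !neqs !par wsq_bar !vals q_lo ?lamE.
  by lincomb F (W : lmodType F); scalars.
have [->|bh'] := eqVneq b h'.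
  rewrite Xv_diag !Xs !Dlin !neqs !par wsq_bar !vals q_hi lamE.
  by lincomb F (W : lmodType F); scalars.
have bq (u v : idx) : (bar u == v) = (u == bar v) by rewrite -{1}[v](barK hk) (inj_eq (bar_inj hk)).
rewrite (@Xv_off l' b) ?(@Xv_off h' b) ?(inj_eq (bar_inj hk)) -?bq ?[_ == b]eq_sym // gt_bhi // !Dlin !neqs !par !vals.
rewrite ?(negPf bl) ?(negPf bh') kap_other //.
rewrite !(mulr0, scale0r, scaler0, addr0, add0r, scale1r, invr1).
move: lam ((gtw h' b)%:R : F) => z w; rewrite /sgn.
by lincomb F (W : lmodType F); case: (lodd c); case: (iodd b); rewrite /= ?expr1 ?expr0; ring.
Qed.
End RMatrix.

(** * Value of the universal R-matrix *)

Section Assembly.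
Variables (R : realType) (F : fieldType) (iota : {rmorphism R -> F}).
Variables (k : nat) (q : R).
Hypotheses (hk : (0 < k)%N) (hq : 0 < q) (hq1 : q != 1).
Local Notation idx := (idx k).
Local Notation wgt := (@wgt R k).
Local Notation El := (@El F k).
Local Notation P := (@pirep R F iota k q).
Local Notation eps := (@leg_sign F k).
Local Notation qpow := (qpow iota q).
Local Notation W := 'M[F]_((2 * k).+2).
Local Notation vv_rho := (vv_rho iota q).
Local Notation L l m r := (lead (chi2 iota q l m) r).
Local Notation Xv := (R_basis iota q).
Local Notation d := (2 * k).+2.

(** The inner product of eps_a with eps_y - eps_b is constant along the legs, hence in a, and odd
    under [bar]; so it vanishes for all a, and a = y decides. *)
Lemma wgt_sep (y b : idx) :
  (forall c, bform (alpha R c) (wgt y) = bform (alpha R c) (wgt b)) -> y = b.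
Proof.
move=> H; pose f a := bform (wgt a) (wgt y - wgt b).
have fa c : f (hi c) = f (lo c).
  apply/eqP; rewrite -subr_eq0 /f -bformNl -bformDl -(alpha_hi_lo R hk) bformDr bformNr H.
  by rewrite subrr.
have fb a : f (bar a) = - f a by rewrite /f wgt_bar // bformNl.
have fc a : f a = f (topx k).
  by apply: (lower_ind hk (P := fun a => f a = f (topx k))) => // c; rewrite ?fb -?fa.
have f0 a : f a = 0.
  have := fb a; rewrite !fc => /eqP; rewrite -addr_eq0 -mulr2n mulrn_eq0 /= => /eqP; exact.
have /eqP := f0 y; rewrite /f bformDr bformNr subr_eq0 !bform_wgt // eqxx [y == bar y]eq_sym bar_neq // subr0.
have w0 : wsq R y != 0 by rewrite /wsq; case: ifP; rewrite ?oppr_eq0 ?oner_neq0.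
rewrite (inj_eq (mulfI w0)); have [->//|_] := eqVneq y b.
case: (y == bar b); rewrite /= ?subr0 ?oner_eq0 //.
by rewrite sub0r -addr_eq0 -mulr2n mulrn_eq0 oner_eq0.
Qed.

Section Near.
Variable RR : set_system (Utens F k 2).
Hypothesis hRR : universal_R iota q RR.
#[local] Instance nbhs_RR_filter : Filter (nbhs RR) := @filter_filter _ _ (uR_filter hRR).

Lemma near_all_idx (Q : idx -> Utens F k 2 -> Prop) :
  (forall a, \forall r \near RR, Q a r) -> \forall r \near RR, forall a, Q a r.
Proof. exact: filter_forall. Qed.
Lemma near_all_label (Q : label k -> Utens F k 2 -> Prop) :
  (forall c, \forall r \near RR, Q c r) -> \forall r \near RR, forall c, Q c r.
Proof.
move=> H; have : \forall r \near RR, forall x, Q (@label_dec k x) r by apply: filter_forall.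
by apply: filterS => r Hr c; rewrite -[c]label_encK.
Qed.

Lemma near_cop g a b : \forall r \near RR,
  act vv_rho r (cop_act vv_rho (sl 0) (sl 1) g (El a b))
  = cop_act vv_rho (sl 1) (sl 0) g (act vv_rho r (El a b)).
Proof.
have := uR_Delta hRR (gvar F ord0 g) (wt2 (wgt a) (wgt b)) (2 * k).+2.
apply: filterS => r /(vv_nbI hk hq hq1) /eqP.
by rewrite act_mulB act_Delta act_DeltaT subr_eq0 => /eqP.
Qed.

(** One s near the inverse filter is a left inverse of r on v_a (x) v_b, so r cannot kill this
    vector. *)
Lemma near_inv a b : \forall r \near RR, act vv_rho r (El a b) != 0.
Proof.
have [SS [PS _ H]] := uR_inv hRR.
have [[A B] /= [HA HB] HAB] := H (wt2 (wgt a) (wgt b)) (2 * k).+2.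
have [s Bs] : exists s, B s by apply: (@filter_ex _ SS).
apply: filterS HA => r Ar.
have [_ /(vv_nbI hk hq hq1) /eqP] := HAB (r, s) (conj Ar Bs).
rewrite act_mulB1 subr_eq0 => /eqP E; apply/eqP => E0; move: E; rewrite E0 linear0.
move/matrixP/(_ a b); rewrite ElE !eqxx mxE => /eqP; by rewrite eq_sym oner_eq0.
Qed.

Let sl0 : sl 0 = ord0 :> 'I_2. Proof. by apply/val_inj; rewrite /= inordK. Qed.
Let sl1 : (sl 1 : 'I_2) != ord0. Proof. by apply/eqP => /(congr1 val); rewrite /= inordK. Qed.

Lemma copE c a b : cop_act vv_rho (sl 0) (sl 1) (GE c) (El a b) =
  kap iota q c a *: (sgn F (iodd a && lodd c) *:
     ((b == lo c)%:R *: El a (hi c) + (eps c * (b == bar (hi c))%:R) *: El a (bar (lo c))))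
  + (kap iota q c b)^-1 *: ((a == lo c)%:R *: El (hi c) b + (eps c * (a == bar (hi c))%:R) *: El (bar (lo c)) b).
Proof.
have vvD i g u v : vv_rho (i, g) (u + v) = vv_rho (i, g) u + vv_rho (i, g) v := raddfD _ u v.
have vvZ i g t u : vv_rho (i, g) (t *: u) = t *: vv_rho (i, g) u := linearZ_LR _ t u.
have dK a' b' : vv_rho (ord0, GK c) (El a' b') = kap iota q c a' *: El a' b' by rewrite vv_diag.
have dKv a' b' : vv_rho (sl 1, GKv c) (El a' b') = (kap iota q c b')^-1 *: El a' b'.
  by rewrite vv_diag // /leg (negPf sl1) /gen_val /= (qpowN iota).
rewrite /cop_act sl0 dKv vvZ vv_e0 // vv_e1 // !(vvD, vvZ) !dK.
by lincomb F (W : lmodType F); ring.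
Qed.

Lemma gen_val_wt g a : gen_val iota q g (wgt a) = gen_wt iota q (wgt a) g.
Proof. by case: g => c //=; rewrite bformC. Qed.

Lemma vv_rho_diagE i g (u : W) x y : match g with GE _ | GF _ => False | _ => True end ->
  vv_rho (i, g) u x y = gen_wt iota q (wgt (leg i x y)) g * u x y.
Proof.
move=> hg; rewrite [in LHS](matrix_sum_delta u).
have E : vv_rho (i, g) (\sum_i \sum_j u i j *: delta_mx i j) =
    \sum_a \sum_b (u a b * gen_wt iota q (wgt (leg i a b)) g) *: El a b.
  rewrite linear_sum; apply: eq_bigr => a _; rewrite linear_sum; apply: eq_bigr => b _.
  by rewrite linearZ_LR vv_diag // gen_val_wt scalerA.
rewrite E summxE (bigD1 x) //= [X in _ + X]big1 ?addr0 => [|a xa]; last first.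
  by rewrite summxE big1 // => b _; rewrite mxZE ElE eq_sym (negPf xa) mulr0.
rewrite summxE (bigD1 y) //= [X in _ + X]big1 ?addr0 => [|b yb]; last first.
  by rewrite mxZE ElE [y == b]eq_sym (negPf yb) andbF mulr0.
by rewrite mxZE ElE !eqxx mulr1 mulrC.
Qed.

(** Lowering generators kill the lowest vector in slot 0, and raising ones strictly move b in slot
    1, so the diagonal coefficient is the Cartan part. The other coefficients are excluded by weight
    preservation. *)
Lemma near_bot b : \forall r \near RR,
  act vv_rho r (El (botx k) b) = L (wgt (botx k)) (wgt b) r *: El (botx k) b.
Proof.
pose bot := botx k.
have HH := near_all_label (fun c => near_cop (GH c) bot b).
apply: filterS2 (uR_UmUp hRR) HH => r hr Hh.
pose w := act vv_rho r (El bot b).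
pose T (u : W) := forall x y, u x y != 0 -> x = bot /\ (wrank y <= wrank b)%N.
pose ev (u : W) : F := u bot b.
have ev_lin : scalar ev by move=> a u v; rewrite /ev mxDE mxZE.
pose evl : {scalar W} := HB.pack ev (GRing.isLinear.Build F W F *%R ev ev_lin).
have [Tw Ew] : T w /\ evl w = L (wgt bot) (wgt b) r * evl (El bot b).
  apply: (UmUp_lead (T := T) (ev := evl) _ _ _ _ hr).
  - move=> u v Tu Tv x y; rewrite mxDE => uv; have [u0|] := eqVneq (u x y) 0; last exact: Tu.
    by apply: Tv; rewrite u0 add0r in uv.
  - by move=> a u Tu x y; rewrite mxZE mulf_eq0 negb_or => /andP[_]; apply: Tu.
  - move=> g u hg Tu; have [dg|[c {hg}->]] : match g with GE _ | GF _ => False | _ => True end \/ exists c, g = GF c.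
    + by case: g hg => c // _; [right; exists c | left..].
    + split=> [x y|]; first by rewrite vv_rho_diagE // mulf_eq0 negb_or => /andP[_]; apply: Tu.
      by rewrite /= /ev vv_rho_diagE // /chi2 /wt2 /= /leg sl0 eqxx.
    have -> : vv_rho (sl 0, GF c) u = 0.
      apply/matrixP => x y; rewrite sl0 vv_rho0 [RHS]mxE mxE big1 // => z _.
      have [->|] := eqVneq (u z y) 0; first by rewrite mulr0.
      move=> /Tu [-> _]; rewrite pirep_f // mxDE !mxNE mxZE !ElE (bot_hi hk) (bot_blo hk).
      by rewrite !andbF mulr0 oppr0 addr0 mul0r.
    split=> [x y|]; first by rewrite mxE eqxx.
    by rewrite /= /ev mxE /chi2 /= mul0r.
  - move=> g u hg Tu; have [dg|[c {hg}->]] : match g with GE _ | GF _ => False | _ => True end \/ exists c, g = GE c.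
    + by case: g hg => c // _; [right; exists c | left..].
    + split=> [x y|]; first by rewrite vv_rho_diagE // mulf_eq0 negb_or => /andP[_]; apply: Tu.
      by rewrite /= /ev vv_rho_diagE // /chi2 /wt2 /= /leg (negPf sl1).
    have Tv : forall x y, vv_rho (sl 1, GE c) u x y != 0 -> x = bot /\ (wrank y < wrank b)%N.
      move=> x y; rewrite vv_rho1 // mxE => hs.
      have [z hz] : exists z, (grading F k (godd (GE c)) *m u) x z * (P (GE c))^T z y != 0.
        apply/existsP; rewrite -[[exists _, _]]negbK negb_exists; apply/negP => /forallP hz.
        by move/eqP: hs; apply; apply: big1 => z _; apply/eqP; rewrite -[_ == _]negbK hz.
      move: hz; rewrite mulf_eq0 negb_or dg_mul mulf_eq0 negb_or => /andP[/andP[_ /Tu [-> zb]]].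
      rewrite mxE pirep_e // mxDE mxZE !ElE => yz; split=> //; apply: leq_trans zb.
      have [/andP[/eqP -> /eqP ->]|] := boolP ((y == hi c) && (z == lo c)); first exact: wrank_hi_lo.
      move=> /negPf n1; have [/andP[/eqP -> /eqP ->]|/negPf n2] := boolP ((y == bar (lo c)) && (z == bar (hi c))).
        exact: wrank_bar.
      by move: yz; rewrite n1 n2 mulr0 addr0 eqxx.
    split=> [x y /Tv [-> /ltnW]|] //.
    rewrite /= /chi2 /= mul0r; apply/eqP; rewrite -[_ == _]negbK; apply/negP => /Tv [_].
    by rewrite ltnn.
  - move=> x y; rewrite ElE; have [/andP[/eqP -> /eqP ->]|] := boolP ((x == bot) && (y == b)) => //.
    by rewrite eqxx.
(* The coproduct of h_c equals its transpose, so r preserves the total weight; with the first factor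
   fixed at the bottom, the second keeps the weight of b. *)
have wt_w x y : w x y != 0 -> y = b.
  move=> wxy; have [xb _] := Tw _ _ wxy; rewrite {x}xb in wxy; apply: wgt_sep => c.
  have := Hh c; rewrite /cop_act !vv_diag // -scalerDl linearZ_LR /= => /matrixP /(_ bot y).
  rewrite mxZE mxDE !vv_rho_diagE // -mulrDl => /eqP; rewrite (inj_eq (mulIf wxy)).
  rewrite /leg sl0 (negPf sl1) eqxx /= !(bformC (wgt _)) => /eqP; rewrite addrC => /addIr H.
  by apply: (fmorph_inj iota); rewrite -H.
apply/matrixP => x y; rewrite mxZE ElE.
have [/andP[/eqP -> /eqP ->]|ne] := boolP ((x == bot) && (y == b)).
  by rewrite mulr1; move: Ew; rewrite /= /ev ElE !eqxx mulr1.
rewrite mulr0; apply/eqP; rewrite -[_ == _]negbK; apply/negP => wxy; move/negP: ne; apply.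
by have [-> _] := Tw _ _ wxy; rewrite (wt_w _ _ wxy) !eqxx.
Qed.

(* With [mu = wgt b / 2] the scalars [chi a = L (wgt a) mu / q^(wgt a, mu)] do not
   depend on [a], and [chi a * chi (bar a) = 1]; hence
   [L (wgt a) (wgt b) = (L (wgt a) mu)^2 = q^(wgt a, wgt b)]. *)
Lemma near_lead_bot b : \forall r \near RR,
  L (wgt (botx k)) (wgt b) r = qpow (bform (wgt (botx k)) (wgt b)).
Proof.
pose bot := botx k; pose mu : weight R k := 2^-1 *: wgt b.
have mu2 : mu + mu = wgt b by rewrite /mu -scalerDl -[2^-1]mul1r -splitr scale1r.
have Hsq := near_lead_id_Delta hk hq hRR (wgt bot) mu mu.
have Hinv := near_lead_Delta_id hk hq hRR (wgt bot) (- wgt bot) mu.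
have H0 := near_lead_Delta_id hk hq hRR 0 (wgt bot) mu.
rewrite mu2 in Hsq; rewrite subrr in Hinv; rewrite add0r in H0.
have Hlo : \forall r \near RR, forall c, L (wgt (hi c)) mu r
    = qpow (bform mu (alpha R c)) * L (wgt (lo c)) mu r.
  apply: near_all_label => c.
  have -> : wgt (lo c) = wgt (hi c) - alpha R c by rewrite (alpha_hi_lo R hk) opprB addrC subrK.
  apply: (near_lead_root hk hq hq1 hRR).
  rewrite bformC bform_alpha // eqxx hi_lo // hi_blo // hi_bhi_neq //.
  by rewrite subrr mulr0 addr0 sub0r oppr_eq0 oner_eq0.
have Hbar : \forall r \near RR, forall c, L (wgt (bar (lo c))) mu r
    = qpow (bform mu (alpha R c)) * L (wgt (bar (hi c))) mu r.
  apply: near_all_label => c.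
  have -> : wgt (bar (hi c)) = wgt (bar (lo c)) - alpha R c.
    by rewrite (alpha_hi_lo R hk) !wgt_bar // opprB addrA addNr add0r.
  apply: (near_lead_root hk hq hq1 hRR).
  rewrite bformC bform_alpha // eqxx blo_bhi_neq // blo_hi_neq // blo_lo_neq // subrr add0r sub0r mulrN1 oppr_eq0.
  by rewrite signr_eq0.
have Hnz := near_inv bot b.
have Hbot := near_bot b.
near=> r.
have sq : L (wgt bot) (wgt b) r = L (wgt bot) mu r * L (wgt bot) mu r.
  by near: r; exact: Hsq.
have inv : L 0 mu r = L (wgt bot) mu r * L (- wgt bot) mu r.
  by near: r; exact: Hinv.
have z0 : L (wgt bot) mu r = L 0 mu r * L (wgt bot) mu r.
  by near: r; exact: H0.
have lo_ c : L (wgt (hi c)) mu r = qpow (bform mu (alpha R c)) * L (wgt (lo c)) mu r.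
  by move: c; near: r; exact: Hlo.
have bar_ c : L (wgt (bar (lo c))) mu r = qpow (bform mu (alpha R c)) * L (wgt (bar (hi c))) mu r.
  by move: c; near: r; exact: Hbar.
have nz : act vv_rho r (El bot b) != 0 by near: r.
have eb : act vv_rho r (El bot b) = L (wgt bot) (wgt b) r *: El bot b by near: r.
(* Otherwise r would kill v_low (x) v_b, against its invertibility. Cancelling this scalar then
   yields the value 1 at weight 0. *)
have nzb : L (wgt bot) mu r != 0.
  by apply/eqP => e; move: nz; rewrite eb sq e mulr0 scale0r eqxx.
have L0 : L 0 mu r = 1 by apply: (mulIf nzb); rewrite -z0 mul1r.
pose chi a := L (wgt a) mu r * qpow (- bform (wgt a) mu).
have chiE a : chi a = chi (topx k).
  apply: (lower_ind hk (P := fun a => chi a = chi (topx k))) => // c <-; rewrite /chi.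
    rewrite lo_ [RHS]mulrAC -(qpowD iota hq) [RHS]mulrC; congr (_ * qpow _).
    by rewrite bformC [bform (wgt (hi c)) _]bformC (alpha_hi_lo R hk) bformDr bformNr; ring.
  rewrite bar_ [RHS]mulrAC -(qpowD iota hq) [RHS]mulrC; congr (_ * qpow _).
  rewrite bformC [bform (wgt (bar (lo c))) _]bformC (alpha_hi_lo R hk) !wgt_bar //.
  by rewrite bformDr !bformNr; ring.
have chi1 : chi bot * chi bot = 1.
  rewrite {2}chiE /chi; have -> : topx k = bar bot by rewrite /bot /botx (barK hk).
  rewrite wgt_bar // mulrACA -inv L0 -(qpowD iota hq) bformNl opprK addNr qpow0 mulr1 //.
have qs : qpow (bform (wgt bot) (wgt b)) = qpow (bform (wgt bot) mu) * qpow (bform (wgt bot) mu).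
  by rewrite -(qpowD iota hq) -bformDr mu2.
have Lc : L (wgt bot) mu r = chi bot * qpow (bform (wgt bot) mu).
  by rewrite /chi -mulrA -(qpowD iota hq) addNr qpow0 mulr1.
by rewrite -/bot sq qs Lc mulrACA chi1 mul1r.
Unshelve. all: by end_near.
Qed.

Lemma scale_inj (a : F) (u v : W) : a != 0 -> a *: u = a *: v -> u = v.
Proof. by move=> a0 e; rewrite -[u]scale1r -[v]scale1r -(mulVf a0) -!scalerA e. Qed.

(** Induction on a upwards from the lowest index, for all b simultaneously: the first term of the
    coproduct, q^(h_c/2) (x) e_c, keeps a and changes b. *)
Lemma near_act : \forall r \near RR, forall a b, act vv_rho r (El a b) = Xv a b.
Proof.
have H1 : \forall r \near RR, forall b,
    act vv_rho r (El (botx k) b) = L (wgt (botx k)) (wgt b) r *: El (botx k) b.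
  by apply: near_all_idx => b; apply: near_bot.
have H2 : \forall r \near RR, forall b,
    L (wgt (botx k)) (wgt b) r = qpow (bform (wgt (botx k)) (wgt b)).
  by apply: near_all_idx => b; apply: near_lead_bot.
have H3 : \forall r \near RR, forall c a b,
    act vv_rho r (cop_act vv_rho (sl 0) (sl 1) (GE c) (El a b))
    = cop_act vv_rho (sl 1) (sl 0) (GE c) (act vv_rho r (El a b)).
  by apply: near_all_label => c; apply: near_all_idx => a; apply: near_all_idx => b; apply: near_cop.
near=> r.
have h1 : forall b, act vv_rho r (El (botx k) b) = L (wgt (botx k)) (wgt b) r *: El (botx k) b by near: r.
have h2 : forall b, L (wgt (botx k)) (wgt b) r = qpow (bform (wgt (botx k)) (wgt b)) by near: r.
have h3 : forall c a b, act vv_rho r (cop_act vv_rho (sl 0) (sl 1) (GE c) (El a b))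
    = cop_act vv_rho (sl 1) (sl 0) (GE c) (act vv_rho r (El a b)) by near: r.
have rD u v : act vv_rho r (u + v) = act vv_rho r u + act vv_rho r v := raddfD _ u v.
have rZ t u : act vv_rho r (t *: u) = t *: act vv_rho r u := linearZ_LR _ t u.
have copD (c : label k) w : cop_act vv_rho (sl 1) (sl 0) (GE c) w = copT_e iota q c w by rewrite /cop_act sl0.
have k0 (c : label k) b : (kap iota q c b)^-1 != 0 by rewrite invr_eq0 (qpow_neq0 iota hq).
apply: (raise_ind hk) => [b|c IH b|c IH b].
- rewrite h1 h2 /R_basis.
  have g0 (y : idx) : gtw (botx k) y = false.
    apply/negP; rewrite /gtw => hy; have := wrank_lt hk y; have hk1 := hk.
    have : wrank (botx k) = (2 * k).+1.
      rewrite /wrank iodd_bar // /iodd val_bar // val_odx; last lia.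
      by rewrite /=; case: ifP; lia.
    lia.
  have -> : barsum iota q (botx k) = 0 by rewrite /barsum big_pred0.
  by rewrite g0 mul0r scale0r scaler0 subr0 scaler0 addr0.
(* The terms with first factor [lo c] are known by induction and cancel. The remaining term is r on
   [hi c] and b, with an invertible Cartan factor. *)
- have := h3 c (lo c) b; rewrite copD IH -Xv_step_lo // copE iodd_lo // andNb scale1r eqxx scale1r.
  rewrite lo_bhi // mulr0 scale0r addr0 !(rD, rZ) !IH => /addrI.
  exact: scale_inj (k0 c b).
- have := h3 c (bar (hi c)) b; rewrite copD IH -Xv_step_bhi // copE iodd_bar // iodd_hi //.
  rewrite [bar (hi c) == lo c]eq_sym lo_bhi // eqxx mulr1 scale0r add0r scalerA !(rD, rZ) !IH => /addrI.
  by rewrite scalerA mulrC; apply: scale_inj; rewrite mulf_neq0 ?eps0 ?k0.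
Unshelve. all: by end_near.
Qed.
End Near.

End Assembly.

(** * Comparison with the graded Kronecker product *)

Section Entries.
Variables (R : realType) (F : fieldType) (iota : {rmorphism R -> F}).
Variables (k : nat) (q : R).
Hypotheses (hk : (0 < k)%N) (hq : 0 < q) (hq1 : q != 1).
Local Notation idx := (idx k).
Local Notation wgt := (@wgt R k).
Local Notation El := (@El F k).
Local Notation P := (@pirep R F iota k q).
Local Notation eps := (@leg_sign F k).
Local Notation qpow := (qpow iota q).
Local Notation W := 'M[F]_((2 * k).+2).
Local Notation vv_rho := (vv_rho iota q).
Local Notation L l m r := (lead (chi2 iota q l m) r).
Local Notation Xv := (R_basis iota q).
Local Notation d := (2 * k).+2.

Lemma sum_only (x : idx) (f : idx -> F) : (forall a, a != x -> f a = 0) -> \sum_a f a = f x.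
Proof. by move=> H; rewrite (bigD1 x) //= big1 ?addr0. Qed.
Lemma sum_mxtens (f : 'I_(d * d) -> F) :
  \sum_u f u = \sum_a \sum_b f (mxtens_index (a, b)).
Proof.
rewrite pair_big /= (reindex (@mxtens_index d d)) /=.
  by apply: eq_bigr => -[a b] _.
by exists (@mxtens_unindex d d) => x _; rewrite (mxtens_indexK, mxtens_unindexK).
Qed.

Definition pairv (u : 'I_(d * d)) := mxtens_unindex u.
Local Arguments pairv : simpl never.
Lemma pairvK a b : pairv (mxtens_index (a, b)) = (a, b). Proof. exact: mxtens_indexK. Qed.
Lemma gtensE A B y z : @gtens F k A B y z = sgn F (iodd (pairv z).1 && (iodd (pairv y).2 (+) iodd (pairv z).2))
   * (A (pairv y).1 (pairv z).1 * B (pairv y).2 (pairv z).2).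
Proof.
by rewrite mxE /pairv; case: (mxtens_unindex y) => a c; case: (mxtens_unindex z) => b e.
Qed.

(** [gtens] takes its sign from the parity of each matrix entry, [vv_act] from that of the
    generator; they agree because the image of a generator is homogeneous. *)
Lemma pirep_parity g (x y : idx) b : sgn F (b && (iodd x (+) iodd y)) * P g x y
  = sgn F (b && godd g) * P g x y.
Proof.
have [->|nz] := eqVneq (P g x y) 0; first by rewrite !mulr0.
suff -> : iodd x (+) iodd y = godd g by [].
have E u v (e : bool) : iodd u (+) iodd v = e -> El u v x y != 0 -> iodd x (+) iodd y = e.
  by move=> ue; rewrite ElE; case: andP => [[/eqP -> /eqP ->]|]; rewrite ?eqxx.
have dgz f : dg f x y != 0 -> iodd x (+) iodd y = false.
  by rewrite dgE; case: (x =P y) => [->|]; rewrite ?addbb ?mulr0 ?eqxx.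
case: g nz => c; [rewrite pirep_e //|rewrite pirep_f //|exact: dgz..].
- rewrite mxDE mxZE; have [h0|h0] := eqVneq (El (hi c) (lo c) x y) 0.
    rewrite h0 add0r mulf_eq0 negb_or => /andP[_]; apply: E.
    by rewrite !iodd_bar // iodd_hi // iodd_lo //=; case: lodd.
  by move=> _; apply: E h0; rewrite iodd_hi // iodd_lo //=; case: lodd.
- rewrite mxDE !mxNE mxZE; have [h0|h0] := eqVneq (El (lo c) (hi c) x y) 0.
    rewrite h0 oppr0 add0r oppr_eq0 mulf_eq0 negb_or => /andP[_]; apply: E.
    by rewrite !iodd_bar // iodd_hi // iodd_lo //=; case: lodd.
  by move=> _; apply: E h0; rewrite iodd_hi // iodd_lo //=; case: lodd.
Qed.

Definition pigen (g : 'I_2 * gen k) : 'M[F]_(d * d) :=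
  if g.1 == ord0 then gtens (P g.2) 1%:M else gtens 1%:M (P g.2).

Lemma vv_rhoE g (w : W) y : vv_rho g w (pairv y).1 (pairv y).2
  = \sum_u pigen g y u * w (pairv u).1 (pairv u).2.
Proof.
case: g => i g; rewrite sum_mxtens -[pigen _]/(if i == ord0 then gtens (P g) 1%:M else gtens 1%:M (P g)).
have [->|i0] := eqVneq i ord0.
  rewrite vv_rho0 mxE; apply: eq_bigr => a _.
  rewrite (sum_only (x := (pairv y).2)) => [|b yb]; last first.
    by rewrite gtensE !pairvK [1%:M _ _]mxE eq_sym (negPf yb) !mulr0 mul0r.
  by rewrite gtensE !pairvK [1%:M _ _]mxE eqxx mulr1 addbb andbF mul1r.
rewrite vv_rho1 // mxE exchange_big; apply: eq_bigr => b _.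
rewrite dg_mul mxE (sum_only (x := (pairv y).1)) => [|a ya]; last first.
  by rewrite gtensE !pairvK [1%:M _ _]mxE eq_sym (negPf ya) mul0r mulr0 mul0r.
by rewrite gtensE !pairvK [1%:M _ _]mxE eqxx mul1r pirep_parity mulrAC.
Qed.

Lemma pipiE x y z : pipi iota q x y z = act vv_rho x (El (pairv z).1 (pairv z).2) (pairv y).1 (pairv y).2.
Proof.
apply: (eq_linear (f := fun x => pipi iota q x y z : F^o)
  (g := fun x => act vv_rho x (El (pairv z).1 (pairv z).2) (pairv y).1 (pairv y).2 : F^o)).
- by move=> a u v; rewrite /pipi linext_is_linear mxE [in LHS]mxE.
- by move=> a u v; rewrite actP mxDE mxZE.
move=> m; rewrite /pipi linext_mon act_mon.
elim: m y => [|g m IH] y.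
  rewrite big_nil [foldr _ _ _]/(El (pairv z).1 (pairv z).2) ElE [LHS]mxE.
  congr ((nat_of_bool _)%:R); apply/eqP/andP => [->|[/eqP e1 /eqP e2]]; first by rewrite !eqxx.
  rewrite -[y]mxtens_unindexK -[z]mxtens_unindexK -/(pairv y) -/(pairv z).
  by rewrite [pairv y]surjective_pairing e1 e2 -surjective_pairing.
rewrite big_cons [foldr _ _ _]/(vv_rho g (foldr (fun g => vv_rho g : W -> W) _ m)) vv_rhoE [LHS]mxE.
by apply: eq_bigr => u _; rewrite -IH.
Qed.

Lemma gtens_El a b e f y z : gtens (El a b) (El e f) y z =
  ((pairv z == (b, f))%:R * sgn F (iodd b && (iodd e (+) iodd f))) * El a e (pairv y).1 (pairv y).2.
Proof.
rewrite gtensE !ElE; case: (pairv y) (pairv z) => y1 y2 [z1 z2]; rewrite xpair_eqE /=.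
case: (z1 =P b) => [->|_]; last by rewrite andbF mul0r !(mul0r, mulr0).
case: (z2 =P f) => [->|_]; last by rewrite !andbF !(mul0r, mulr0).
case: (y1 =P a) => _; last by rewrite ?andbF !(mul0r, mulr0).
case: (y2 =P e) => [->|_]; last by rewrite !(mul0r, mulr0).
by rewrite /= !(mulr1, mul1r).
Qed.

Definition Rmatrix : 'M[F]_(d * d) :=
    (\sum_(a : idx) \sum_(b : idx) qpow (bform (wgt a) (wgt b))
        *: gtens (El a a) (El b b)
     + (iota q - (iota q)^-1) *:
       \sum_(a : idx) \sum_(b : idx | gtw b a)
         sgn F (iodd b) *: gtens (El a b) (sigmat iota q b a)).

Lemma sum_at (x : idx) (p : pred idx) (f : idx -> F) :
  \sum_(a | p a) (x == a)%:R * f a = (p x)%:R * f x.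
Proof.
rewrite big_mkcond (sum_only (x := x)) => [|a ax]; last first.
  by rewrite eq_sym (negPf ax) mul0r; case: ifP.
by rewrite eqxx mul1r; case: ifP; rewrite ?mul1r ?mul0r.
Qed.

Lemma sigmatE a b y z : gtens (El a b) (sigmat iota q b a) y z =
  ((pairv z).1 == b)%:R * (((pairv z).2 == a)%:R * sgn F (iodd b && (iodd a (+) iodd b)) * El a b (pairv y).1 (pairv y).2
   - ((pairv z).2 == bar b)%:R * (xi F a * xi F b * qpow (bform (rho R k) (wgt a - wgt b)))
      * El a (bar a) (pairv y).1 (pairv y).2).
Proof.
(* Both summands of [sigmat] have parity [a] + [b], so both receive the sign u from the graded
   tensor product; in the second it cancels the sign written in [sigmat]. *)
set t := xi F a * xi F b * _; pose u := sgn F (iodd b && (iodd a (+) iodd b)).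
have uu : u * u = 1 by rewrite /u /sgn -expr2 sqrr_sign.
have -> : gtens (El a b) (sigmat iota q b a) y z
    = gtens (El a b) (El b a) y z - (u * t) * gtens (El a b) (El (bar a) (bar b)) y z.
  by rewrite !gtensE /sigmat mxDE mxNE mxZE -/u -!mulrA -/t; ring.
rewrite !gtens_El !iodd_bar // [iodd b (+) _]addbC -/u; case: (pairv z) => z1 z2; rewrite !xpair_eqE /=.
have [_|_] := eqVneq z1 b; last by rewrite !mul0r mulr0 subrr.
rewrite !mul1r; congr (_ - _); have -> : u * t * ((z2 == bar b)%:R * u * El a (bar a) (pairv y).1 (pairv y).2)
  = (u * u) * ((z2 == bar b)%:R * t * El a (bar a) (pairv y).1 (pairv y).2) by ring.
by rewrite uu mul1r.
Qed.

Lemma RmatrixE y z : Rmatrix y z = Xv (pairv z).1 (pairv z).2 (pairv y).1 (pairv y).2.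
Proof.
have mxD (A B : 'M[F]_(d * d)) : (A + B) y z = A y z + B y z by rewrite mxE.
have mxZ t (A : 'M[F]_(d * d)) : (t *: A) y z = t * A y z by rewrite mxE.
rewrite /Rmatrix mxD mxZ !summxE /R_basis mxDE !mxZE mxDE mxNE !mxZE.
congr (_ + _ * _).
  rewrite (eq_bigr (fun a => ((pairv z).1 == a)%:R * (qpow (bform (wgt a) (wgt (pairv z).2))
      * El a (pairv z).2 (pairv y).1 (pairv y).2))) ?(sum_at _ predT) ?mul1r // => a _.
  rewrite summxE (eq_bigr (fun b => ((pairv z).2 == b)%:R * (((pairv z).1 == a)%:R *
    (qpow (bform (wgt a) (wgt b)) * El a b (pairv y).1 (pairv y).2)))) ?(sum_at _ predT) ?mul1r // => b _.
  rewrite mxZ gtens_El addbb andbF /sgn expr0 mulr1; case: (pairv z) => u v.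
  by rewrite xpair_eqE /= -mulnb natrM; ring.
set z1 := (pairv z).1; set z2 := (pairv z).2; set y1 := (pairv y).1; set y2 := (pairv y).2.
rewrite (eq_bigr (fun a => (gtw z1 a)%:R * (sgn F (iodd z1) * ((z2 == a)%:R * sgn F (iodd z1 && (iodd a (+) iodd z1)) * El a z1 y1 y2
   - (z2 == bar z1)%:R * (xi F a * xi F z1 * qpow (bform (rho R k) (wgt a - wgt z1))) * El a (bar a) y1 y2)))); last first.
  move=> a _; rewrite summxE.
  (* On v_z1 (x) v_z2 only b = z1 survives in the sum over b. *)
  pose g b := sgn F (iodd b) * ((z2 == a)%:R * sgn F (iodd b && (iodd a (+) iodd b)) * El a b y1 y2
   - (z2 == bar b)%:R * (xi F a * xi F b * qpow (bform (rho R k) (wgt a - wgt b))) * El a (bar a) y1 y2).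
  apply: (eq_trans _ (sum_at z1 (fun b => gtw b a) g)); apply: eq_bigr => b _.
  by rewrite mxZ sigmatE mulrCA.
rewrite (eq_bigr (fun a => (z2 == a)%:R * ((gtw z1 a)%:R * sgn F (iodd z1) * sgn F (iodd z1 && (iodd a (+) iodd z1)) * El a z1 y1 y2)
   + - ((z2 == bar z1)%:R * zinv iota q z1) * ((gtw z1 a)%:R * (zeta iota q a * El a (bar a) y1 y2)))); last first.
  move=> a _; rewrite /zinv /zeta bformDr bformNr (qpowD iota hq); ring.
rewrite big_split (sum_at _ predT) mul1r -mulr_sumr /=; congr (_ + _).
  rewrite -[_ * sgn F _ * sgn F _]mulrA -sgnM; congr (_ * sgn F _ * _).
  by case: (iodd z1); case: (iodd z2).
rewrite mulNr; congr (- (_ * _)).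
rewrite (barsumE iota q) summxE; apply: eq_bigr => a _.
by rewrite !mxZE.
Qed.

End Entries.

Theorem proposition4p1 (R : realType) (F : fieldType)
    (iota : {rmorphism R -> F}) (k : nat) (q : R)
    (hk : (0 < k)%N) (hq : 0 < q) (hq1 : q != 1)
    (RR : set_system (Utens F k 2)) (hRR : universal_R iota q RR) :
  pipi_value iota q RR
    (\sum_(a : idx k) \sum_(b : idx k) qpow iota q (bform (wgt R a) (wgt R b))
        *: gtens (El F a a) (El F b b)
     + (iota q - (iota q)^-1) *:
       \sum_(a : idx k) \sum_(b : idx k | gtw b a)
         sgn F (iodd b) *: gtens (El F a b) (sigmat iota q b a)).
Proof.
rewrite -/(Rmatrix iota k q) /pipi_value.
have ? : Filter (nbhs RR) := @filter_filter _ _ (uR_filter hRR).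
apply: filterS (near_act hk hq hq1 hRR) => r Hr.
by apply/matrixP => y z; rewrite RmatrixE // pipiE // Hr.
Qed.
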